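(* Assume $\mathcal{N}\neq\emptyset$. For any $h\in H$ there exists a unique decomposition $$f_h(\mathbf{t}_{\mathcal{N}})=P_h(\mathbf{t}_{\mathcal{N}})+f_h^{-}(\mathbf{t}_{\mathcal{N}})$$ such that $P_h(\mathbf{t}_{\mathcal{N}})$ is a Laurent polynomial, supported on $\pi_{\mathcal{N}}(L')\setminus\mathbb{Q}_{<0}\langle E_v\rangle_{v\in\mathcal{N}}$, with $P_h(\mathbf{1})=\mathrm{pc}^{\pi_{\mathcal{N}}(\mathcal{S}'_{\mathbb{R}})}(Z_h(\mathbf{t}_{\mathcal{N}}))$, and $f_h^{-}(\mathbf{t}_{\mathcal{N}})$ is a rational function satisfying $$f_h^{-}(\mathbf{t}_{\mathcal{N}})=\sum_{\overline{vw}\text{ edge of }\mathcal{T}^{orb}}f_h^{vw,-}(\mathbf{t}_{\mathcal{N}})-\sum_{v\in\mathcal{N}}(\delta_v^{orb}-1)f_h^{v,-}(\mathbf{t}_{\mathcal{N}}).$$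
   Context: $\mathcal{T}$ is a finite tree (a connected negative definite plumbing graph with all genera zero) with vertex set $\mathcal{V}$; $\delta_v$ is the valency of $v$; $\mathcal{N}=\{v:\delta_v\ge3\}$ is the set of nodes and $\mathcal{E}=\{v:\delta_v=1\}$ the set of ends. The orbifold graph $\mathcal{T}^{orb}$ has vertex set $\mathcal{N}$, two nodes being joined by an edge if they are connected in $\mathcal{T}$ by a path all of whose vertices other than the two nodes have valency $2$; $\delta_v^{orb}$ is the valency of $v$ in $\mathcal{T}^{orb}$. $L=\mathbb{Z}\langle E_v\rangle_{v\in\mathcal{V}}$ is a free lattice with a negative definite integral symmetric form $(\,,\,)$ such that, for $v\ne w$, $(E_v,E_w)=1$ if $\overline{vw}$ is an edge of $\mathcal{T}$ and $0$ otherwise. $L'\subset L\otimes\mathbb{Q}$ is the dual lattice, freely generated by the $E_v^*$ with $(E_v^*,E_w)=-1$ if $v=w$ and $0$ otherwise (all coordinates of $E_v^*$ in the basis $\{E_w\}$ are positive). $H=L'/L$ is finite; $[x]$ is the class of $x$. $\mathcal{S}'_{\mathbb{R}}=\mathbb{R}_{\ge0}\langle E_v^*\rangle_v$. $\pi_{\mathcal{I}}:\mathbb{R}\langle E_v\rangle_{v\in\mathcal{V}}\to\mathbb{R}\langle E_v\rangle_{v\in\mathcal{I}}$ is the coordinate projection; $\pi_v=\pi_{\{v\}}$, $\pi_{vw}=\pi_{\{v,w\}}$. For a field $k$, $k_{<0}\langle\cdots\rangle$, $k_{\le 0}\langle\cdots\rangle$ denote combinations with all coefficients negative, resp. nonpositive.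 For $y=\sum y_vE_v$ put $\mathbf{t}^y=\prod_{v\in\mathcal{V}}t_v^{y_v}$, $\mathbf{t}_{\mathcal{N}}^y=\prod_{v\in\mathcal{N}}t_v^{y_v}$. Define $f_h$ by $\prod_{v\in\mathcal{V}}(1-[E_v^*]\mathbf{t}^{E_v^*})^{\delta_v-2}=\sum_{h\in H}f_h(\mathbf{t})\cdot h$ (coefficients in $\mathbb{Z}[H]$), and let $f_h(\mathbf{t}_{\mathcal{N}})$ be $f_h(\mathbf{t})$ with $t_v=1$ for $v\notin\mathcal{N}$; one has $f_h(\mathbf{t}_{\mathcal{N}})=R_h(\mathbf{t}_{\mathcal{N}})/\prod_{u\in\mathcal{E}}(1-\mathbf{t}_{\mathcal{N}}^{|H|E_u^*})$ with $R_h\in\mathbb{Z}[\pi_{\mathcal{N}}(L')]$. $Z_h(\mathbf{t}_{\mathcal{N}})$ is the Taylor expansion of $f_h(\mathbf{t}_{\mathcal{N}})$ at the origin. ''Laurent polynomial'' means an element of $\mathbb{Z}[\pi_{\mathcal{N}}(L')]$ (rational exponents allowed); its support is the set of exponents occurring. Periodic constant: let $Z_h(\mathbf{t}_{\mathcal{N}})=\sum_l c_l\mathbf{t}_{\mathcal{N}}^l$ and $Q(x)=\sum_{l\not\ge x}c_l$ for $x\in\pi_{\mathcal{N}}(L')$ (coordinatewise order; finite sum). If on $\widetilde L\cap(l_*+\pi_{\mathcal{N}}(\mathcal{S}'_{\mathbb{R}}))$, for some finite-index sublattice $\widetilde L\subset\pi_{\mathcal{N}}(L')$ and some $l_*\in\pi_{\mathcal{N}}(\mathcal{S}'_{\mathbb{R}})$,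 $Q$ coincides with a quasipolynomial on $\widetilde L$ (polynomial on each coset of a finite-index sublattice), then $\mathrm{pc}^{\pi_{\mathcal{N}}(\mathcal{S}'_{\mathbb{R}})}(Z_h(\mathbf{t}_{\mathcal{N}}))$ is the value of this quasipolynomial at $0$. One-variable parts. For $v\in\mathcal{N}$, $P_h^v(\mathbf{t}_{\mathcal{N}})$ is the polynomial part of $f_h(\mathbf{t}_{\mathcal{N}})$ as a function in $t_v$ (other variables being regarded as coefficients): the unique Laurent polynomial such that $f_h(\mathbf{t}_{\mathcal{N}})=P_h^v+P'/\prod_{u\in\mathcal{E}}(1-\mathbf{t}_{\mathcal{N}}^{|H|E_u^*})$ with $P'$ a Laurent polynomial, the $\pi_v$-projections of the exponents of $P_h^v$ lie in $\mathbb{Q}_{\ge0}\langle E_v\rangle$, and those of $P'$ lie in $\sum_{u\in\mathcal{E}}[0,1)\,\pi_v(|H|E_u^* )$. Put $f_h^{v,-}=f_h-P_h^v$. Two-variable parts. For an edge $\overline{vw}$ of $\mathcal{T}^{orb}$, removing from $\mathcal{T}$ the open path connecting $v$ and $w$ leaves two subtrees $\mathcal{T}_v\ni v$ and $\mathcal{T}_w\ni w$; let $\mathcal{E}_v$, $\mathcal{E}_w$ be the elements of $\mathcal{E}$ lying in $\mathcal{T}_v$, $\mathcal{T}_w$ (so $\mathcal{E}=\mathcal{E}_v\sqcup\mathcal{E}_w$), and let $D_v=\prod_{u\in\mathcal{E}_v}(1-\mathbf{t}_{\mathcal{N}}^{|H|E_u^*})$, $D_w=\prod_{u\in\mathcal{E}_w}(1-\mathbf{t}_{\mathcal{N}}^{|H|E_u^*})$,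 $B_v=\sum_{u\in\mathcal{E}_v}[0,1)\pi_{vw}(|H|E_u^* )$, $B_w=\sum_{u\in\mathcal{E}_w}[0,1)\pi_{vw}(|H|E_u^* )$. Then $P_h^{vw}(\mathbf{t}_{\mathcal{N}})$, the polynomial part of $f_h(\mathbf{t}_{\mathcal{N}})$ as a function in $t_v,t_w$, is the first term of the unique decomposition $f_h(\mathbf{t}_{\mathcal{N}})=P_h^{vw}+\frac{P'}{D_v}+\frac{P''}{D_w}+\frac{P'''}{D_vD_w}$ into Laurent polynomials $P_h^{vw},P',P'',P'''$ such that the $\pi_{vw}$-projections of the exponents of $P_h^{vw}$, $P'$, $P''$, $P'''$ lie respectively in the complement of $\mathbb{Q}_{<0}\langle E_v,E_w\rangle$, in $\mathbb{Q}_{\le0}\langle E_v\rangle+B_v$, in $\mathbb{Q}_{\le0}\langle E_w\rangle+B_w$, and in $B_v+B_w$. Put $f_h^{vw,-}=f_h-P_h^{vw}$. *)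

(* Defs.v *)
From HB Require Import structures.
From mathcomp Require Import all_boot all_order all_algebra.
From mathcomp Require Import finmap.
From mathcomp Require Import boolp classical_sets cardinality fsbigop reals.
From mathcomp Require Import monalg.
From mathcomp Require mpoly.

Set Implicit Arguments.
Unset Strict Implicit.
Unset Printing Implicit Defensive.

Import Order.TTheory GRing.Theory Num.Theory.
Local Open Scope ring_scope.

(* [galg R G] is R[G] for an additive group G. The carrier is the type of
   finitely supported functions of monalg, whose own product is only available
   for monoids without nontrivial units. *)
Definition galg (R : comNzRingType) (G : zmodType) : predArgType := {malg R[G]}.

HB.instance Definition _ (R : comNzRingType) (G : zmodType) :=
  GRing.Zmodule.on (galg R G).

Definition gmon (R : comNzRingType) (G : zmodType) (r : R) (g : G) : galg R G :=
  mkmalgU g r.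

Definition gcoef (R : comNzRingType) (G : zmodType) (a : galg R G) (g : G) : R :=
  mcoeff g a.

Definition gsupp (R : comNzRingType) (G : zmodType) (a : galg R G) : {fset G} :=
  msupp a.

Section GroupAlgebra.
Variables (R : comNzRingType) (G : zmodType).
Implicit Types a b c : galg R G.

Definition gone : galg R G := gmon 1 0.

Definition gmul a b : galg R G :=
  \sum_(x <- gsupp a) \sum_(y <- gsupp b) gmon (gcoef a x * gcoef b y) (x + y).

Lemma gcoef0 x : gcoef (0 : galg R G) x = 0.
Proof. exact: mcoeff0. Qed.

Lemma gcoef_sum (I : Type) (s : seq I) (F : I -> galg R G) x :
  gcoef (\sum_(i <- s) F i) x = \sum_(i <- s) gcoef (F i) x.
Proof. exact: (raddf_sum (mcoeff x)). Qed.

Lemma gcoef_gmon (r : R) (x y : G) : gcoef (gmon r x) y = r *+ (x == y).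
Proof. exact: mcoeffU. Qed.

Lemma gcoef_eq0 a x : (gcoef a x == 0) = (x \notin gsupp a).
Proof. exact: mcoeff_eq0. Qed.

Lemma gmulw (d1 d2 : {fset G}) a b :
  (gsupp a `<=` d1)%fset -> (gsupp b `<=` d2)%fset ->
  gmul a b =
  \sum_(x <- d1) \sum_(y <- d2) gmon (gcoef a x * gcoef b y) (x + y).
Proof.
move=> le1 le2; rewrite /gmul (big_fset_incl _ le1) /=.
  apply/eq_bigr => x _; apply/big_fset_incl => // y _ /mcoeff_outdom yb.
  by rewrite /gcoef yb mulr0 /gmon monalgU0.
move=> x _ /mcoeff_outdom xa; rewrite big1 // => y _.
by rewrite /gcoef xa mul0r /gmon monalgU0.
Qed.

Lemma gmulC : commutative gmul.
Proof.
move=> a b; rewrite /gmul exchange_big; apply/eq_bigr => y _.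
by apply/eq_bigr => x _; rewrite mulrC [x + y]addrC.
Qed.

Lemma gmulDl : left_distributive gmul +%R.
Proof.
move=> a b c; rewrite [in RHS](gmulw (fsubsetUl _ (gsupp b)) (fsubset_refl _)).
rewrite [in RHS](gmulw (fsubsetUr (gsupp a) _) (fsubset_refl _)).
rewrite (gmulw (msuppD_le _ _) (fsubset_refl _)).
rewrite -big_split /=; apply/eq_bigr => x _.
rewrite -big_split /=; apply/eq_bigr => y _.
by rewrite /gcoef mcoeffD mulrDl /gmon monalgUD.
Qed.

Lemma gmul0 a : gmul 0 a = 0.
Proof. by rewrite /gmul /gsupp msupp0 big_seq_fset0. Qed.

Lemma gmulUU (r s : R) (x y : G) : gmul (gmon r x) (gmon s y) = gmon (r * s) (x + y).
Proof.
by rewrite (gmulw msuppU_le msuppU_le) !big_seq_fset1 /gcoef /gmon !mcoeffUU.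
Qed.

Lemma gmonE a : a = \sum_(x <- gsupp a) gmon (gcoef a x) x.
Proof. exact: monalgE. Qed.

Lemma gmul1 : left_id gone gmul.
Proof.
move=> a; rewrite (gmulw msuppU_le (fsubset_refl _)) big_seq_fset1 [RHS]gmonE.
by apply/eq_bigr => x _; rewrite /gcoef /gone /gmon mcoeffUU mul1r add0r.
Qed.

Lemma gmulDr : right_distributive gmul +%R.
Proof. by move=> a b c; rewrite ![gmul a _]gmulC gmulDl. Qed.

Lemma gmul_suml (I : Type) (s : seq I) (F : I -> galg R G) b :
  gmul (\sum_(i <- s) F i) b = \sum_(i <- s) gmul (F i) b.
Proof. exact: (big_morph (gmul^~ b) (fun x y => gmulDl x y b) (gmul0 b)). Qed.

Lemma gmul_sumr (I : Type) (s : seq I) (F : I -> galg R G) a :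
  gmul a (\sum_(i <- s) F i) = \sum_(i <- s) gmul a (F i).
Proof. by rewrite gmulC gmul_suml; apply/eq_bigr => i _; rewrite gmulC. Qed.

Lemma gmulA : associative gmul.
Proof.
move=> a b c.
rewrite (gmonE a) !gmul_suml; apply/eq_bigr => x _.
rewrite (gmonE b) !(gmul_suml, gmul_sumr); apply/eq_bigr => y _.
rewrite (gmonE c) !gmul_sumr; apply/eq_bigr => z _.
by rewrite !gmulUU mulrA addrA.
Qed.

Lemma gone_neq0 : gone != 0.
Proof. by rewrite monalgU_eq0 oner_eq0. Qed.

HB.instance Definition _ := GRing.Zmodule_isComNzRing.Build (galg R G)
  gmulA gmulC gmul1 gmulDl gone_neq0.

Definition gunit : {pred galg R G} := fun a => `[< exists b, b * a = 1 >].

Definition ginv a : galg R G := xget a [set b | b * a = 1]%classic.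

Lemma gmulVx : {in gunit, left_inverse 1 ginv *%R}.
Proof. by move=> a /asboolP ua; apply: (xgetPex a ua). Qed.

Lemma gunitPl a b : b * a = 1 -> gunit a.
Proof. by move=> ba; apply/asboolP; exists b. Qed.

Lemma ginv_out : {in [predC gunit], ginv =1 id}.
Proof.
move=> a; rewrite inE => /asboolPn nua; apply: xgetPN => b ba.
by apply: nua; exists b.
Qed.

HB.instance Definition _ := GRing.ComNzRing_hasMulInverse.Build (galg R G)
  gmulVx gunitPl ginv_out.

End GroupAlgebra.

(* [expo V] is L (x) Q, in coordinates with respect to the basis E_v. *)
Notation expo V := {ffun V -> rat}.

Section LexOrder.
Variable V : finType.
Implicit Types (x y z : expo V) (s : seq V) (A : seq (expo V)).

Fixpoint lexle s x y : bool :=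
  if s is v :: s' then (x v < y v) || (x v == y v) && lexle s' x y else true.

Lemma lexle_refl s x : lexle s x x.
Proof. by elim: s => //= v s ->; rewrite eqxx orbT. Qed.

Lemma lexle_total s x y : lexle s x y || lexle s y x.
Proof. by elim: s => //= v s IHs; case: (ltgtP (x v) (y v)) => //=. Qed.

Lemma lexle_trans s y x z : lexle s x y -> lexle s y z -> lexle s x z.
Proof.
elim: s => //= v s IHs.
case/orP => [xy | /andP[/eqP-> xy]]; case/orP => [yz | /andP[/eqP<- yz]].
- by rewrite (lt_trans xy yz).
- by rewrite xy.
- by rewrite yz.
- by rewrite eqxx IHs ?orbT.
Qed.

Lemma lexle_addI s x y x' y' : lexle s x y -> lexle s x' y' ->
  x + x' = y + y' -> {in s, x =1 y}.
Proof.
elim: s => //= v s IHs xy xy' exy.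
have ev : x v + x' v = y v + y' v.
  by move/ffunP/(_ v): exy; rewrite !ffunE.
have le1 : x v <= y v by case/orP: xy => [/ltW | /andP[/eqP->]].
have le2 : x' v <= y' v by case/orP: xy' => [/ltW | /andP[/eqP->]].
have e1 : x v = y v.
  by apply: le_anti; rewrite le1 /= -(lerD2r (x' v)) ev lerD2l.
have e2 : x' v = y' v by apply: (addrI (x v)); rewrite {2}e1.
move: xy xy'; rewrite e1 e2 !ltxx !eqxx /= => xy xy' u.
by rewrite inE => /predU1P[-> // | us]; apply: IHs.
Qed.

Lemma lexle_max s A x0 : x0 \in A -> exists2 x, x \in A & {in A, forall y, lexle s y x}.
Proof.
elim: A x0 => // a A IHA x0 _.
case: A IHA => [_ | a' A IHA].
  by exists a; rewrite ?mem_head // => y; rewrite inE => /eqP->; apply: lexle_refl.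
have [x xA xmax] := IHA a' (mem_head _ _).
case/orP: (lexle_total s a x) => ax.
  exists x; first by rewrite inE xA orbT.
  by move=> y; rewrite inE => /predU1P[-> // | /xmax].
exists a; first exact: mem_head.
move=> y; rewrite inE => /predU1P[-> | /xmax yx]; first exact: lexle_refl.
exact: lexle_trans yx ax.
Qed.

End LexOrder.

Lemma galg_integral (R : idomainType) (V : finType) :
  GRing.integral_domain_axiom (galg R (expo V)).
Proof.
move=> a b ab0; apply/negPn/negP; rewrite negb_or => /andP[a0 b0].
have supp_ex (c : galg R (expo V)) : c != 0 -> exists x, x \in gsupp c.
  move=> c0; apply: contrapT => /forallNP nc; case/eqP: c0.
  by apply/malgP => k; rewrite mcoeff0; apply/mcoeff_outdom/negP/nc.
have [x0 x0a] := supp_ex a a0; have [y0 y0b] := supp_ex b b0.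
have [x xa xmax] := lexle_max (enum V) x0a.
have [y yb ymax] := lexle_max (enum V) y0b.
have uniq_xy x' y' : x' \in gsupp a -> y' \in gsupp b ->
    (x' + y' == x + y) = (x' == x) && (y' == y).
  move=> x'a y'b; apply/eqP/andP => [e | [/eqP-> /eqP->] //].
  have ex : x' = x.
    apply/ffunP => v; apply: (lexle_addI (xmax _ x'a) (ymax _ y'b) e).
    by rewrite mem_enum.
  by split; apply/eqP => //; apply: (addrI x); rewrite -{1}ex.
have : gcoef (a * b) (x + y) = 0 by rewrite ab0 gcoef0.
rewrite [a * b]/(gmul a b) /gmul gcoef_sum (big_fsetD1 x) //= gcoef_sum.
rewrite (big_fsetD1 y) //= gcoef_gmon eqxx mulr1n.
rewrite big1_fset => [|y']; last first.
  rewrite in_fsetD1 => /andP[y'y y'b] _.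
  by rewrite gcoef_gmon uniq_xy // (negPf y'y) andbF mulr0n.
rewrite big1_fset => [|x']; last first.
  rewrite in_fsetD1 => /andP[x'x x'a] _; rewrite gcoef_sum big1_fset // => y' y'b _.
  by rewrite gcoef_gmon uniq_xy // (negPf x'x) mulr0n.
rewrite !addr0 => /eqP; rewrite mulf_eq0.
by rewrite !gcoef_eq0 xa yb.
Qed.

HB.instance Definition _ (R : idomainType) (V : finType) :=
  GRing.ComUnitRing_isIntegral.Build (galg R (expo V)) (@galg_integral R V).

(* Laurent polynomials and rational functions in the variables t_v. Every
   Laurent polynomial or function of t_N is viewed in these rings: it only
   involves exponents whose coordinates outside N vanish. *)
Notation lpoly V := (galg int (expo V)).
Notation ratfun V := {fraction lpoly V}.

Notation "x %:F" := (FracField.tofrac x) : ring_scope.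

Definition mon (V : finType) (x : expo V) : lpoly V := gmon 1 x.

(* The value at t = (1, ..., 1). *)
Definition eval_one (V : finType) (P : lpoly V) : int :=
  \sum_(x <- gsupp P) gcoef P x.

(* q E_v *)
Definition axis (V : finType) (v : V) (q : rat) : expo V :=
  [ffun w => if w == v then q else 0].

(* The coordinate projection pi_I, with values in the span of the E_v, v in I,
   seen as a subspace of L (x) Q. *)
Definition proj (V : finType) (I : {set V}) (x : expo V) : expo V :=
  [ffun v => if v \in I then x v else 0].

(* L inside L (x) Q *)
Definition int_lattice (V : finType) : {pred expo V} :=
  fun x => [forall v, x v \is a Num.int].

Lemma int_lattice_zmod (V : finType) : zmod_closed (@int_lattice V).
Proof.
split=> [|x y /forallP xL /forallP yL]; first by apply/forallP => v; rewrite ffunE.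
by apply/forallP => v; rewrite !ffunE rpredB.
Qed.

HB.instance Definition _ (V : finType) :=
  GRing.isZmodClosed.Build (expo V) (@int_lattice V) (@int_lattice_zmod V).

(* (L (x) Q) / L, whose subgroup H = L'/L is [disc_group] below. *)
Definition rat_quot (V : finType) : zmodType :=
  Quotient.quot (@int_lattice V : zmodClosed (expo V)).

Definition cls (V : finType) (x : expo V) : rat_quot V :=
  (\pi_(Quotient.quot (@int_lattice V : zmodClosed (expo V))) x)%qT.

Definition finite_index (V : finType) (M N : set (expo V)) : Prop :=
  [/\ M 0, forall x y, M x -> M y -> M (x - y), forall x, M x -> N x &
      exists s : seq (expo V), forall x, N x -> exists2 y, y \in s & M (x - y)].

Definition is_tree (V : finType) (e : rel V) : Prop :=
  [/\ symmetric e, irreflexive e, forall v w, connect e v w &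
      forall c, cycle e c -> uniq c -> (size c <= 2)%N].

Section Plumbing.

(* e is the adjacency relation of the tree, b v is the integer (E_v, E_v). *)
Variables (V : finType) (e : rel V) (b : V -> int).
Implicit Types (x y l : expo V) (v w u : V) (P : lpoly V) (f : ratfun V).

Definition valency v : nat := #|[set w | e v w]|.
Definition nodes : {set V} := [set v | (3 <= valency v)%N].
Definition ends : {set V} := [set v | valency v == 1%N].

Definition form x y : rat :=
  \sum_v \sum_w x v * y w * (if v == w then (b v)%:~R else (e v w)%:R).

Definition negative_definite : Prop :=
  forall x, x \in @int_lattice V -> x != 0 -> form x x < 0.

Definition dual_lattice : set (expo V) :=
  [set x | forall y, y \in @int_lattice V -> form x y \is a Num.int]%classic.

(* E_v^*: the unique such vector, as the form is nondegenerate. *)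
Definition dual_vec v : expo V :=
  xget 0 [set x | forall w, form x (axis w 1) = - (v == w)%:R]%classic.

Definition disc_group : set (rat_quot V) :=
  [set cls x | x in dual_lattice]%classic.

Definition disc_order : nat := #|` fset_set disc_group|%fset.

(* pi_N(L') *)
Definition proj_dual : set (expo V) :=
  [set proj nodes x | x in dual_lattice]%classic.

(* p lists the interior vertices of a simple path from v to w. *)
Definition open_path v w (p : seq V) : bool :=
  path e v (rcons p w) && uniq (v :: rcons p w).

Definition orb_adj v w : bool :=
  [&& v \in nodes, w \in nodes &
   `[< exists2 p, open_path v w p & all (fun u => valency u == 2%N) p >]].

Definition orb_valency v : nat := #|[set w | orb_adj v w]|.

(* The tree minus the open path from v to w with interior vertices p; if v and
   w are adjacent, then p is empty and the edge between them is removed. *)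
Definition cut_path v w (p : seq V) : rel V := fun u u' =>
  [&& e u u', u \notin p, u' \notin p & (u, u') \notin [:: (v, w); (w, v)]].

(* T_v, for the edge vw of the orbifold graph; T_w is [subtree w v]. *)
Definition subtree v w : {set V} :=
  [set u | `[< exists2 p, open_path v w p & connect (cut_path v w p) v u >]].

Definition subtree_ends v w : {set V} := ends :&: subtree v w.

(* prod_v (1 - [E_v^*] t^{E_v^*})^(delta_v - 2); the factors with negative
   exponent are units because |H| [E_v^*] = 0 in H. The coefficient ring is the
   fraction field of Z[L (x) Q], and Z[H] sits inside Z[(L (x) Q) / L]. *)
Definition zeta : galg (ratfun V) (rat_quot V) :=
  \prod_v (1 - gmon ((mon (dual_vec v))%:F : ratfun V) (cls (dual_vec v)))
          ^ ((valency v)%:Z - 2).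

Definition f_full (h : rat_quot V) : ratfun V := gcoef zeta h.

(* Setting t_v = 1 for v not in N, first in a Laurent polynomial, then in a
   rational function having a denominator which does not become 0. *)
Definition restrict_poly P : lpoly V :=
  \sum_(x <- gsupp P) gmon (gcoef P x) (proj nodes x).

Definition restrict f : ratfun V :=
  xget 0 [set g | exists a d : lpoly V,
    [/\ restrict_poly d != 0, f = a%:F / d%:F &
        g = (restrict_poly a)%:F / (restrict_poly d)%:F]]%classic.

Definition f_nodes (h : rat_quot V) : ratfun V := restrict (f_full h).

(* prod_{u in S} (1 - t_N^{|H| E_u^*}) *)
Definition denom (S : {set V}) : lpoly V :=
  \prod_(u in S) (1 - mon (proj nodes (dual_vec u *+ disc_order))).

(* Membership in Z[pi_N(L')]. *)
Definition laurent P : Prop := forall x, x \in gsupp P -> proj_dual x.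

(* c gives the coefficients of the expansion of f at the origin, a power series
   with nonnegative exponents in pi_N(L'); d * c = a determines c. *)
Definition is_taylor f (c : expo V -> int) : Prop :=
  (forall l, c l != 0 -> proj_dual l /\ forall v, 0 <= l v) /\
  exists a d : lpoly V, [/\ d != 0, f = a%:F / d%:F &
    forall x, \sum_(y <- gsupp d) gcoef d y * c (x - y) = gcoef a x].

Definition taylor f : expo V -> int :=
  xget (fun=> 0) [set c | is_taylor f c]%classic.

(* The sum of the c_l over l not >= x in the coordinates of N; it is finite for
   the series at hand. *)
Definition counting (c : expo V -> int) x : int :=
  \sum_(l \in [set l : expo V | ~ forall v, v \in nodes -> x v <= l v]%classic) c l.

(* The projection of x by pi_I lies in the sum over u in S of the sets
   [0,1) pi_I(y), where y is |H| times E_u^*. Rational coefficients suffice: x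
   is rational and, for the sets used below, the vectors pi_I(y), u in S, are
   positive multiples of one another. *)
Definition in_box (I S : {set V}) x : Prop :=
  exists2 a : V -> rat, forall u, 0 <= a u < 1 &
    forall i, i \in I -> x i = \sum_(u in S) a u * (dual_vec u *+ disc_order) i.

Definition is_poly_part1 f v P : Prop :=
  exists P' : lpoly V,
  [/\ laurent P /\ laurent P',
      f = P%:F + P'%:F / (denom ends)%:F,
      forall x, x \in gsupp P -> 0 <= x v &
      forall x, x \in gsupp P' -> in_box [set v] ends x].

(* The first term of the decomposition, which exists and is unique; the default
   value 0 is irrelevant, and likewise for [poly_part2]. *)
Definition poly_part1 f v : lpoly V :=
  xget 0 [set P | is_poly_part1 f v P]%classic.

Definition neg_part1 f v : ratfun V := f - (poly_part1 f v)%:F.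

Definition is_poly_part2 f v w P : Prop :=
  let Ev := subtree_ends v w in
  let Ew := subtree_ends w v in
  let I := [set v; w] in
  exists P1 P2 P3 : lpoly V,
  [/\ [/\ laurent P, laurent P1, laurent P2 & laurent P3],
      f = P%:F + P1%:F / (denom Ev)%:F + P2%:F / (denom Ew)%:F
          + P3%:F / ((denom Ev)%:F * (denom Ew)%:F),
      forall x, x \in gsupp P -> ~ (x v < 0 /\ x w < 0) &
  [/\ forall x, x \in gsupp P1 ->
        exists2 q : rat, q <= 0 & in_box I Ev (x - axis v q),
      forall x, x \in gsupp P2 ->
        exists2 q : rat, q <= 0 & in_box I Ew (x - axis w q) &
      forall x, x \in gsupp P3 ->
        exists2 y : expo V, in_box I Ev y & in_box I Ew (x - y)]].

Definition poly_part2 f v w : lpoly V :=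
  xget 0 [set P | is_poly_part2 f v w P]%classic.

Definition neg_part2 f v w : ratfun V := f - (poly_part2 f v w)%:F.

(* Each edge is counted once, with one of its two orientations; which one is
   immaterial, as [neg_part2] is symmetric in v and w. *)
Definition sum_orb_edges (F : V -> V -> ratfun V) : ratfun V :=
  \sum_(p : V * V | orb_adj p.1 p.2 && (enum_rank p.1 < enum_rank p.2)%N)
    F p.1 p.2.

Variable R : realType.

(* pi_N(S'_R) *)
Definition proj_cone (s : V -> R) : Prop :=
  exists2 a : V -> R, forall u, 0 <= a u &
    forall v, s v = if v \in nodes then \sum_u a u * ratr (dual_vec u v) else 0.

Definition quasipolynomial (M : set (expo V)) (q : expo V -> R) : Prop :=
  exists2 M' : set (expo V), finite_index M' M &
    forall r, M r -> exists p : mpoly.mpoly #|V| R, forall m, M' m ->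
      q (r + m) = mpoly.meval (fun i => ratr ((r + m) (enum_val i))) p.

(* The periodic constant with respect to pi_N(S'_R) of the series with
   coefficients c exists and equals p. *)
Definition is_periodic_constant (c : expo V -> int) (p : R) : Prop :=
  exists (M : set (expo V)) (l0 : V -> R) (q : expo V -> R),
  [/\ finite_index M proj_dual, proj_cone l0, quasipolynomial M q,
      forall x, M x -> proj_cone (fun v => ratr (x v) - l0 v) ->
        (counting c x)%:~R = q x &
      q 0 = p].

End Plumbing.

(* Main.v *)
Require Import Defs.
From mathcomp Require Import all_boot all_order all_algebra.
From mathcomp Require Import finmap boolp classical_sets functions cardinality fsbigop reals
  monalg.
From mathcomp Require mpoly.
From mathcomp Require Import ring lra zify.
Set Implicit Arguments.
Unset Strict Implicit.
Unset Printing Implicit Defensive.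
Import Order.TTheory GRing.Theory Num.Theory.
Local Open Scope ring_scope.

(** The last condition prescribes the second component, and the first one then
    determines P, so uniqueness is immediate. The orbifold graph is a tree, hence
    the coefficients 1 of its edges and 1 - delta_v^orb of its nodes add up to 1
    ([euler]), and f - f^- is the same combination of polynomial parts: the sum of
    the P^{vw} over the edges minus the sum of the (delta_v^orb - 1) P^v over the
    nodes ([poly_part], [sum_neg_parts]). It is a Laurent polynomial, and its
    exponents inherit the condition on the support. The content of the theorem is
    that its value at 1 is the periodic constant, that is, that the counting
    function Q agrees deep in the cone, on a sublattice, with a polynomial having
    this value at the origin ([good_counting]).

    Gluing. Let Q_I(x) be the sum of the coefficients whose exponent is not at
    least x at some node of I. Then, deep in the cone, Q is the sum of the Q_{vw}
    over the edges minus the sum of the (delta_v^orb - 1) Q_v. This is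
    inclusion-exclusion ([union_count]), in which a set S of nodes contributes
    nothing as soon as a node m separates two of its elements: the terms smaller
    than x on S but not at m have sum zero ([separated_zero]). To see this, count
    with the product of all (1 - t^{E_v^*})^{delta_v - 2} before any variable is
    set to 1 ([cnt_f_nodes]). The counting condition does not change under
    translation by E_v for v outside S and m, so these t^{E_v} may be replaced by
    1. Then a branch not meeting S loses all its poles after multiplication by the
    single factor 1 - t^{E_m^*} of the vertex m where it is attached
    ([poly_mod_branch]), by induction and the relation that expresses E_r by
    E_r^* and the E_w^* of its neighbours. As m has exponent delta_m - 2 and at
    least two branches at m meet S, there remains a Laurent polynomial times the
    product over a set B of vertices that does not contain m and is entered only
    through S ([front_root]). The exponents y in that series have (y, E_t)
    bounded below for t outside B. For x deep, the maximum principle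
    ([mean_value]) therefore deduces y_m < x_m from y_s < x_s on S, and no term
    is left.

    One and two nodes. If f = P^v + P'/D, then P^v contributes P^v(1) to Q_v once x
    is deep. The count of P'/D satisfies a difference equation for each factor of
    D, so it is polynomial on a sublattice, and every factor extends the validity
    of the formula by one step towards the origin. The box condition on P' is
    what brings it down to the origin, where nothing is counted and the value is 0
    ([good_part1]). For an edge vw, the region where l_v < x_v or l_w < x_w is the
    union of two plane cones meeting in a third, bounded by the coordinate lines
    and by the lines parallel to the projections of E_v^* and E_w^*; the same
    argument in the two directions applies to each ([good_part2]).

    The polynomial parts exist by division with remainder by products of
    binomials, each time in the direction of a linear function that is positive on
    the exponents of the divisor ([poly_part1_exists], [poly_part2_exists]). *)

(** * Group algebras and their action on series *)

Section GroupAlgebraExtra.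
Variables (R : comNzRingType) (G : zmodType).
Implicit Types (a b : galg R G) (x y : G).

Lemma gcoefD a b x : gcoef (a + b) x = gcoef a x + gcoef b x.
Proof. exact: mcoeffD. Qed.

Lemma gcoefN a x : gcoef (- a) x = - gcoef a x.
Proof. exact: mcoeffN. Qed.

Lemma gcoefB a b x : gcoef (a - b) x = gcoef a x - gcoef b x.
Proof. exact: mcoeffB. Qed.

Lemma galgP a b : (forall x, gcoef a x = gcoef b x) -> a = b.
Proof. by move=> ab; apply/malgP. Qed.

Lemma gmonD (r s : R) x : gmon (r + s) x = gmon r x + gmon s x :> galg R G.
Proof. exact: monalgUD. Qed.

Lemma gmon0 x : gmon 0 x = 0 :> galg R G.
Proof. exact: monalgU0. Qed.

Lemma galg_ind (P : galg R G -> Prop) :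
  P 0 -> (forall a b, P a -> P b -> P (a + b)) -> (forall r x, P (gmon r x)) ->
  forall a, P a.
Proof. by move=> P0 PD PU a; rewrite (gmonE a); apply: big_ind. Qed.

Lemma gmulUU' (r s : R) x y : gmon r x * gmon s y = gmon (r * s) (x + y) :> galg R G.
Proof. exact: gmulUU. Qed.

Lemma gsumw (M : zmodType) (F : R -> G -> M) (X : {fset G}) a :
  (forall x, F 0 x = 0) -> (gsupp a `<=` X)%fset ->
  \sum_(x <- gsupp a) F (gcoef a x) x = \sum_(x <- X) F (gcoef a x) x.
Proof.
move=> F0 aX; apply/big_fset_incl => // x _; rewrite -gcoef_eq0 => /eqP ->.
exact: F0.
Qed.

Lemma gsum_add (M : zmodType) (F : R -> G -> M) a b :
  (forall x, F 0 x = 0) -> (forall r s x, F (r + s) x = F r x + F s x) ->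
  \sum_(x <- gsupp (a + b)) F (gcoef (a + b) x) x =
  \sum_(x <- gsupp a) F (gcoef a x) x + \sum_(x <- gsupp b) F (gcoef b x) x.
Proof.
move=> F0 FD; pose X := (gsupp a `|` gsupp b)%fset.
have aX : (gsupp a `<=` X)%fset by apply: fsubsetUl.
have bX : (gsupp b `<=` X)%fset by apply: fsubsetUr.
have abX : (gsupp (a + b)%R `<=` X)%fset by apply: msuppD_le.
rewrite (gsumw F0 aX) (gsumw F0 bX) (gsumw F0 abX).
by rewrite -big_split; apply: eq_bigr => x _; rewrite gcoefD FD.
Qed.

Lemma gsum_mon (M : zmodType) (F : R -> G -> M) (r : R) y :
  (forall x, F 0 x = 0) ->
  \sum_(x <- gsupp (gmon r y : galg R G)) F (gcoef (gmon r y : galg R G) x) x = F r y.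
Proof.
move=> F0; rewrite (gsumw (X := [fset y]%fset) F0); last exact: msuppU_le.
by rewrite big_seq_fset1 gcoef_gmon eqxx.
Qed.

Lemma gsupp_gmon (r : R) y x : x \in gsupp (gmon r y : galg R G) -> x = y.
Proof. by move/(fsubsetP msuppU_le); rewrite inE => /eqP. Qed.

Lemma gsuppD a b x : x \in gsupp (a + b) -> x \in gsupp a \/ x \in gsupp b.
Proof. by move/(fsubsetP (msuppD_le _ _)); rewrite inE => /orP. Qed.

Lemma gsuppN a x : (x \in gsupp (- a)) = (x \in gsupp a).
Proof. by rewrite /gsupp msuppN. Qed.

Lemma gsupp_sum (I : Type) (s : seq I) (P : pred I) (F : I -> galg R G) x :
  x \in gsupp (\sum_(i <- s | P i) F i) -> exists2 i, P i & x \in gsupp (F i).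
Proof.
elim: s => [|i s IHs]; first by rewrite big_nil /gsupp msupp0.
rewrite big_cons; case: ifP => // Pi /gsuppD[xi|/IHs //]; by exists i.
Qed.

Lemma gsuppM a b x : x \in gsupp (a * b) ->
  exists y z, [/\ y \in gsupp a, z \in gsupp b & x = y + z].
Proof.
rewrite -[a * b]/(gmul a b) /gmul big_seq => /gsupp_sum[y ya].
rewrite big_seq => /gsupp_sum[z zb /gsupp_gmon ->].
by exists y, z.
Qed.

End GroupAlgebraExtra.

Lemma finite_set_min (T : eqType) (le : rel T) (s : seq T) x0 :
  reflexive le -> transitive le -> total le -> x0 \in s ->
  exists2 x, x \in s & {in s, forall y, le x y}.
Proof.
move=> rle tle totle; elim: s x0 => // a s IHs x0 _.
case: s IHs => [_ | a' s IHs].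
  by exists a; rewrite ?mem_head // => y; rewrite inE => /eqP->.
have [x xs xmin] := IHs a' (mem_head _ _).
case/orP: (totle a x) => ax.
  exists a; first exact: mem_head.
  by move=> y; rewrite inE => /predU1P[-> // | /xmin]; apply: tle.
exists x; first by rewrite inE xs orbT.
by move=> y; rewrite inE => /predU1P[-> // | /xmin].
Qed.

Section Series.
Variable V : finType.
Implicit Types (d a : lpoly V) (c : expo V -> int) (x y l n : expo V).

(** The action of Laurent polynomials on formal series, given by their
    coefficients. *)
Definition act d c x : int := \sum_(y <- gsupp d) gcoef d y * c (x - y).

Lemma actD d d' c x : act (d + d') c x = act d c x + act d' c x.
Proof.
apply: (gsum_add (F := fun r y => r * c (x - y))) => [y|r s y]; first by rewrite mul0r.
by rewrite mulrDl.
Qed.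

Lemma act0 c x : act 0 c x = 0.
Proof. by rewrite /act /gsupp msupp0 big_seq_fset0. Qed.

Lemma act_gmon (r : int) y c x : act (gmon r y) c x = r * c (x - y).
Proof. by apply: (gsum_mon _ _ (F := fun r y => r * c (x - y))) => z; rewrite mul0r. Qed.

Lemma act_serD d c c' x : act d (fun l => c l + c' l) x = act d c x + act d c' x.
Proof. by rewrite -big_split; apply: eq_bigr => y _; rewrite mulrDr. Qed.

Lemma act_serB d c c' x : act d (fun l => c l - c' l) x = act d c x - act d c' x.
Proof. by rewrite -sumrB; apply: eq_bigr => y _; rewrite mulrBr. Qed.

Lemma eq_act d c c' : c =1 c' -> act d c =1 act d c'.
Proof. by move=> cc x; apply: eq_bigr => y _; rewrite cc. Qed.

Lemma actN d c x : act (- d) c x = - act d c x.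
Proof.
by rewrite /act -sumrN /gsupp msuppN; apply: eq_bigr => y _; rewrite gcoefN mulNr.
Qed.

Lemma actM d d' c x : act (d * d') c x = act d (act d' c) x.
Proof.
elim/galg_ind: d => [|d1 d2 IH1 IH2|r y]; first by rewrite mul0r !act0.
  by rewrite mulrDl !actD IH1 IH2.
rewrite act_gmon; elim/galg_ind: d' => [|d1 d2 IH1 IH2|s z].
- by rewrite mulr0 !act0 mulr0.
- by rewrite mulrDr !actD IH1 IH2 mulrDr.
- by rewrite gmulUU' !act_gmon mulrA opprD addrA.
Qed.

Lemma gcoefM d a x : gcoef (d * a) x = act d (gcoef a) x.
Proof.
elim/galg_ind: d => [|d1 d2 IH1 IH2|r y]; first by rewrite mul0r act0 gcoef0.
  by rewrite mulrDl actD gcoefD IH1 IH2.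
rewrite act_gmon; elim/galg_ind: a => [|d1 d2 IH1 IH2|s z].
- by rewrite mulr0 !gcoef0 mulr0.
- by rewrite mulrDr !gcoefD IH1 IH2 mulrDr.
- rewrite gmulUU' !gcoef_gmon -[z == _](inj_eq (addrI y)).
  by rewrite addrCA subrr addr0 mulrnAr.
Qed.

Lemma act_neq0 d c x : act d c x != 0 -> exists2 y, y \in gsupp d & c (x - y) != 0.
Proof.
move=> dc; apply: contrapT => nex; case/eqP: dc; rewrite /act big_seq big1 // => y yd.
have [->|cn] := eqVneq (c (x - y)) 0; first by rewrite mulr0.
by case: nex; exists y.
Qed.

(** The leading term of a product, for an order refining that of a weight
    omega whose sublevel sets meet the support of c in finite sets, is the
    product of the leading terms: series of this kind form a torsion free
    module. *)
Lemma act_torsion (omega : expo V -> rat) c d :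
  {morph omega : x y / x + y} ->
  (forall B, finite_set [set l | c l != 0 /\ omega l <= B]%classic) ->
  d != 0 -> (forall x, act d c x = 0) -> forall l, c l = 0.
Proof.
move=> omD fin d0 dc0 l0; apply/eqP/negPn/negP => cl0.
pose le x y := (omega x < omega y) || (omega x == omega y) && lexle (enum V) x y.
have le_refl : reflexive le by move=> x; rewrite /le eqxx lexle_refl orbT.
have le_total : total le.
  move=> x y; rewrite /le; case: (ltgtP (omega x) (omega y)) => //= _.
  exact: lexle_total.
have le_trans : transitive le.
  move=> y x z; rewrite /le.
  case/orP=> [xy|/andP[/eqP-> xy]]; case/orP=> [yz|/andP[/eqP<- yz]].
  - by rewrite (lt_trans xy yz).
  - by rewrite xy.
  - by rewrite yz.
  - by rewrite eqxx (lexle_trans xy yz) orbT.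
have le_omega x y : le x y -> omega x <= omega y.
  by case/orP=> [/ltW|/andP[/eqP->]].
set S := [set l | c l != 0 /\ omega l <= omega l0]%classic in fin.
have Sfin : finite_set S by exact: fin.
have memS l : l \in fset_set S <-> c l != 0 /\ omega l <= omega l0.
  by rewrite in_fset_set // inE.
have [x xS xmin] : exists2 x, x \in fset_set S & {in fset_set S, forall y, le x y}.
  by apply: (@finite_set_min _ _ _ l0) => //; apply/memS.
have [cx xl0] := (memS x).1 xS.
have {}xmin y : c y != 0 -> le x y.
  move=> cy; have [yl0|yl0] := leP (omega y) (omega l0); first exact/xmin/memS.
  by rewrite /le (le_lt_trans xl0).
have [y0 y0d] : exists y, y \in gsupp d.
  apply: contrapT => /forallNP nc; case/eqP: d0; apply: galgP => k.
  by rewrite gcoef0; apply/eqP; rewrite gcoef_eq0; apply/negP/nc.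
have [y yd ymin] := finite_set_min le_refl le_trans le_total y0d.
have: act d c (x + y) = 0 by [].
rewrite /act (big_fsetD1 y) //= addrK big1_fset ?addr0.
  by move/eqP; rewrite mulf_eq0 gcoef_eq0 yd (negPf cx).
move=> y'; rewrite in_fsetD1 => /andP[y'y y'd] _.
apply/eqP; rewrite mulf_eq0; apply/orP; right; apply/negPn/negP => cx'.
case/eqP: y'y; set x' := x + y - y' in cx'.
have exy : x + y = x' + y' by rewrite /x' subrK.
have := xmin _ cx'; have := ymin _ y'd.
have eom : omega x + omega y = omega x' + omega y' by rewrite -!omD exy.
move=> ley lex; have leox := le_omega _ _ lex; have leoy := le_omega _ _ ley.
have eox : omega x = omega x' by lra.
have eoy : omega y = omega y' by lra.
move: lex ley; rewrite /le eox eoy !ltxx !eqxx /= => lex ley.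
have exx : x = x'.
  by apply/ffunP => v; apply: (lexle_addI lex ley exy); rewrite mem_enum.
by apply: (addrI x); rewrite [RHS]exy -exx.
Qed.

(** * Expansions of rational functions at the origin *)

Variable N : {set V}.

(** Without a finiteness condition the formal series with d c = a is not
    unique. This one is stable under the operations below, and makes all sums
    over bounded sets finite. *)
Definition lfin c : Prop :=
  forall v, v \in N -> forall B : rat, finite_set [set l | c l != 0 /\ l v < B]%classic.

Definition expan (f : ratfun V) c : Prop :=
  lfin c /\ exists a d : lpoly V,
    [/\ d != 0, f = a%:F / d%:F & forall x, act d c x = gcoef a x].

Definition expandable f : Prop := exists c, expan f c.

Definition expansion f : expo V -> int := xget (fun=> 0) [set c | expan f c]%classic.

Lemma tofrac_neq0 d : (d%:F != 0 :> ratfun V) = (d != 0).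
Proof. by rewrite tofrac_eq0. Qed.

Lemma frac_eq a d a' d' : d != 0 -> d' != 0 ->
  (a%:F / d%:F = a'%:F / d'%:F :> ratfun V) <-> a * d' = a' * d.
Proof.
move=> d0 d'0.
have e : (a%:F / d%:F == a'%:F / d'%:F :> ratfun V) = (a * d' == a' * d).
  by rewrite eqr_div ?tofrac_neq0 // -!tofracM tofrac_eq.
by split=> /eqP; [rewrite e => /eqP | rewrite -e => /eqP].
Qed.

Lemma lfin_le c v B : lfin c -> v \in N -> finite_set [set l | c l != 0 /\ l v <= B]%classic.
Proof.
move=> lc vN; apply: sub_finite_set (lc v vN (B + 1)) => l /= [-> lB]; split=> //.
by rewrite (le_lt_trans lB) // ltrDl.
Qed.

Lemma lfin_sub c c' : (forall l, c' l != 0 -> c l != 0) -> lfin c -> lfin c'.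
Proof.
by move=> cc' lc v vN B; apply: sub_finite_set (lc v vN B) => l /= [/cc' ? ?].
Qed.

Lemma lfinD c c' : lfin c -> lfin c' -> lfin (fun l => c l + c' l).
Proof.
move=> lc lc' v vN B.
have fU : finite_set ([set l | c l != 0 /\ l v < B] `|` [set l | c' l != 0 /\ l v <
  B])%classic.
  by rewrite finite_setU; split; [exact: lc | exact: lc'].
apply: sub_finite_set fU => l /= [cl lB].
have [cl0|] := eqVneq (c l) 0; last by left.
by right; split=> //; apply: contraNneq cl => ->; rewrite cl0.
Qed.

Lemma lfinN c : lfin c -> lfin (fun l => - c l).
Proof. by apply: lfin_sub => l; rewrite oppr_eq0. Qed.

Lemma lfin_act d c : lfin c -> lfin (act d c).
Proof.
move=> lc v vN B.
have fin : finite_set (\bigcup_(y in [set` gsupp d]) [set (l + y) | l in [set l | c l != 0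
  /\ l v < B - y v]])%classic.
  by apply: bigcup_finite => // y _; apply: finite_image; apply: lc.
apply: sub_finite_set fin => l /= [/act_neq0[y yd cy] lB]; exists y => //=.
by exists (l - y); rewrite ?subrK // !ffunE; split=> //; rewrite ltrD2r.
Qed.

Lemma lfin_poly a : lfin (gcoef a).
Proof.
move=> v _ B; apply: (finite_subfset (gsupp a)) => l /= [+ _].
by rewrite gcoef_eq0 negbK.
Qed.

Hypothesis N0 : N != finset.set0.

Lemma lfin_torsion c d : lfin c -> d != 0 -> (forall x, act d c x = 0) -> forall l, c l = 0.
Proof.
move=> lc d0 dc0; have [v vN] := finset.set0Pn _ N0.
apply: (act_torsion (omega := fun x : expo V => x v)) d0 dc0 => [x y|B].
  by rewrite ffunE.
exact: lfin_le.
Qed.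

Lemma expan_uniq f c c' : expan f c -> expan f c' -> c = c'.
Proof.
move=> [lc [a [d [d0 -> dc]]]] [lc' [a' [d' [d'0 /(frac_eq _ _ d0 d'0) aa dc']]]].
apply/funext => l; apply/eqP; rewrite -subr_eq0; apply/eqP; move: l.
apply: (@lfin_torsion _ (d * d')); first exact: lfinD lc (lfinN lc').
  by rewrite mulf_neq0.
move=> x; rewrite act_serB.
rewrite {1}mulrC !actM (eq_act _ dc) (eq_act _ dc') -!gcoefM.
by rewrite mulrC aa mulrC subrr.
Qed.

Lemma expansionE f c : expan f c -> expansion f = c.
Proof.
move=> fc; apply: (expan_uniq (f := f)) => //.
exact: (xgetI (P := [set c | expan f c]%classic) _ fc).
Qed.

Lemma expansionP f : expandable f -> expan f (expansion f).
Proof. by case=> c fc; rewrite (expansionE fc). Qed.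

Lemma expan_poly a : expan a%:F (gcoef a).
Proof.
split; first exact: lfin_poly.
exists a, 1; split; first exact: oner_neq0.
  by rewrite tofrac1 divr1.
by move=> x; rewrite -gcoefM mul1r.
Qed.

Lemma expanD f f' c c' : expan f c -> expan f' c' -> expan (f + f') (fun l => c l + c' l).
Proof.
move=> [lc [a [d [d0 -> dc]]]] [lc' [a' [d' [d'0 -> dc']]]].
split; first exact: lfinD.
exists (a * d' + a' * d), (d * d'); split; first by rewrite mulf_neq0.
  by rewrite addf_div ?tofrac_neq0 // tofracD !tofracM.
move=> x; rewrite act_serD {1}mulrC !actM (eq_act _ dc) (eq_act _ dc') -!gcoefM.
by rewrite -gcoefD ![_ * d]mulrC ![_ * d']mulrC.
Qed.

Lemma expanM p f c : expan f c -> expan (p%:F * f) (act p c).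
Proof.
move=> [lc [a [d [d0 -> dc]]]]; split; first exact: lfin_act.
exists (p * a), d; split=> //; first by rewrite tofracM mulrA.
by move=> x; rewrite -actM mulrC actM (eq_act _ dc) -gcoefM.
Qed.

Definition posN n := forall v, v \in N -> 0 < n v.

Lemma rat_archimedean (x y : rat) : 0 < y -> exists k : nat, x < y *+ k.
Proof.
move=> y0; exists (Num.bound `|x / y|).
have := archi_boundP (normr_ge0 (x / y)); set k := Num.bound _ => xk.
rewrite -mulr_natl; have : x / y < k%:R by rewrite (le_lt_trans (ler_norm _)).
by rewrite ltr_pdivrMr.
Qed.

Lemma ffunMnE n k v : (n *+ k) v = n v *+ k.
Proof. by elim: k => [|k IH]; rewrite ?mulr0n ?ffunE // !mulrS ffunE IH. Qed.

(** The quotient is the sum of the translates of c by the multiples of n,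
    which is finite at each exponent because n is positive on N. *)
Lemma expan_geom f c n : expan f c -> posN n ->
  exists2 c', expan (f / (1 - mon n)%:F) c' &
    forall l, c' l != 0 -> exists k : nat, c (l - n *+ k) != 0.
Proof.
move=> [lc [a [d [d0 fE dc]]]] pn; have [v vN] := finset.set0Pn _ N0.
have bnd x : exists k : nat, forall j, (k <= j)%N -> c (x - n *+ j) = 0.
  have fin := lfin_le (x v) lc vN.
  set S := [set l | c l != 0 /\ l v <= x v]%classic in fin.
  have lowb (s : seq (expo V)) : exists B : rat, forall l, l \in s -> B <= l v.
    elim: s => [|l s [B HB]]; first by exists 0.
    exists (Num.min B (l v)) => l'; rewrite inE => /predU1P[->|/HB].
      by rewrite ge_min lexx orbT.
    by move=> h; rewrite ge_min h.
  have [B HB] := lowb (fset_set S).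
  have [k kx] := rat_archimedean (x v - B) (pn v vN).
  exists k => j kj; apply/eqP/negPn/negP => cj.
  have njk : n v *+ k <= n v *+ j.
    by apply: ler_wpMn2l => //; exact/ltW/pn.
  have nj0 : 0 <= n v *+ j by rewrite mulrn_wge0 // ltW // pn.
  have /HB : x - n *+ j \in fset_set S.
    rewrite in_fset_set // inE; split=> //; rewrite !ffunE ffunMnE.
    by lra.
  by rewrite !ffunE ffunMnE; lra.
have [K HK] := choice bnd.
pose c' x := \sum_(j < K x) c (x - n *+ j).
have c'E x k : (K x <= k)%N -> c' x = \sum_(j < k) c (x - n *+ j).
  move=> kK; rewrite /c' -!(big_mkord xpredT (fun j => c (x - n *+ j))).
  rewrite [RHS](big_cat_nat (n := K x)) //= [X in _ = _ + X](_ : _ = 0) ?addr0 //.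
  by rewrite big_nat big1 // => j /andP[kj _]; rewrite HK.
have c'S l : c' l != 0 -> exists k : nat, c (l - n *+ k) != 0.
  move=> cl; apply: contrapT => nex; case/eqP: cl; apply: big1 => j _.
  by apply/eqP/negPn/negP => h; apply: nex; exists j.
have c'eq x : c' x - c' (x - n) = c x.
  pose k := maxn (K x) (K (x - n)).
  have -> : c' x = \sum_(j < k.+1) c (x - n *+ j).
    by apply: c'E; apply: leq_trans (leq_maxl _ _) (leqnSn _).
  have -> : c' (x - n) = \sum_(j < k) c (x - n - n *+ j) by apply: c'E; apply: leq_maxr.
  rewrite big_ord_recl mulr0n subr0 (eq_bigr (fun j : 'I_k => c (x - n - n *+ j))).
    by rewrite addrK.
  by move=> j _; rewrite /bump /= mulrS opprD addrA.
exists c' => //; split.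
  move=> w wN B; have fin := lc w wN B.
  set S := [set l | c l != 0 /\ l w < B]%classic in fin.
  have upb (s : seq (expo V)) : exists M : nat, forall l, l \in s -> B - l w < n w *+ M.
    elim: s => [|l s [M HM]]; first by exists 0%N.
    have [k kl] := rat_archimedean (B - l w) (pn w wN).
    exists (maxn M k) => l'; rewrite inE => /predU1P[->|/HM h].
      by apply: lt_le_trans kl _; apply: ler_wpMn2l (leq_maxr _ _); exact/ltW/pn.
    by apply: lt_le_trans h _; apply: ler_wpMn2l (leq_maxl _ _); exact/ltW/pn.
  have [M HM] := upb (fset_set S).
  have fin2 : finite_set (\bigcup_(j in [set` 'I_M]) [set (l + n *+ (j : 'I_M)) | l in
    S])%classic.
    by apply: bigcup_finite => // y _; apply: finite_image.
  apply: sub_finite_set fin2 => l /= [/c'S[k ck] lB].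
  have nk0 : 0 <= n w *+ k by rewrite mulrn_wge0 // ltW // pn.
  have lS : l - n *+ k \in fset_set S.
    by rewrite in_fset_set // inE; split=> //; rewrite !ffunE ffunMnE; lra.
  have kM : (k < M)%N.
    have := HM _ lS; rewrite !ffunE ffunMnE => h.
    have: n w *+ k < n w *+ M by lra.
    by rewrite ltr_pMn2l ?pn.
  exists (Ordinal kM) => //=; exists (l - n *+ k); last by rewrite subrK.
  by move: lS; rewrite in_fset_set // inE.
have n0 : 1 - mon n != 0 :> lpoly V.
  apply/eqP => /(congr1 (fun p => gcoef p 0)); rewrite gcoefB gcoef0.
  rewrite /mon -[1]/(gmon 1 0 : lpoly V) !gcoef_gmon eqxx.
  have -> : (n == 0) = false.
    by apply/eqP => n0; have := pn v vN; rewrite n0 ffunE ltxx.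
  by move/eqP; rewrite subr0 oner_eq0.
exists a, (d * (1 - mon n)); split; first by rewrite mulf_neq0.
  by rewrite fE tofracM invfM mulrA.
move=> x; rewrite actM -dc; apply: eq_act => {}x.
rewrite actD -[1]/(gmon 1 0 : lpoly V) actN /mon !act_gmon subr0 !mul1r.
exact: c'eq.
Qed.

End Series.

(** * Counting functions *)

Section Counting.
Variables (V : finType) (N : {set V}).
Hypothesis N0 : N != finset.set0.
Implicit Types (d a : lpoly V) (c : expo V -> int) (x y l n : expo V) (f : ratfun V).
Implicit Types (A B : set (expo V)).

Definition csum A c : int := \sum_(l \in A) c l.

Definition shift n A : set (expo V) := [set l | A (l + n)]%classic.

(** The sets on which a locally finite series has finitely many terms. *)
Definition bounded A : Prop :=
  exists B : rat, forall l, A l -> exists2 v, v \in N & l v < B.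

Lemma bounded_sub A B : (forall l, A l -> B l) -> bounded B -> bounded A.
Proof. by move=> AB [x bx]; exists x => l /AB /bx. Qed.

Lemma boundedU A B : bounded A -> bounded B -> bounded (A `|` B)%classic.
Proof.
move=> [x hx] [y hy]; exists (Num.max x y) => l [/hx|/hy] [v vN h]; exists v => //;
  by rewrite lt_max h ?orbT.
Qed.

Lemma bounded_fin A c : lfin N c -> bounded A ->
  exists X : {fset expo V}, forall l, A l -> c l != 0 -> l \in X.
Proof.
move=> lc [B HB]; set S := (\bigcup_(v in [set` N]) [set l | c l != 0 /\ l v < B])%classic.
have fS : finite_set S by apply: bigcup_finite => // v /= vN; apply: lc.
exists (fset_set S) => l /HB[v vN lB] cl; rewrite in_fset_set // inE.
by exists v.
Qed.

Lemma csumE (X : {fset expo V}) A c : (forall l, A l -> c l != 0 -> l \in X) ->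
  csum A c = \sum_(l <- X) (if `[< A l >] then c l else 0).
Proof.
move=> AX; rewrite /csum fsbig_mkcond (fsbigTE X).
  apply: eq_bigr => l _; rewrite /patch.
  by case: asboolP => Al; [rewrite mem_set | rewrite memNset].
move=> l lX; rewrite /patch; case: ifP => //; rewrite inE => Al.
by apply/eqP; apply: contraNT lX; apply: AX.
Qed.

Lemma eq_csum A B c : (forall l, c l != 0 -> A l <-> B l) -> csum A c = csum B c.
Proof.
move=> AB; rewrite /csum fsbig_supp [RHS]fsbig_supp; congr (\big[_/_]_(i \in _) _).
by apply/seteqP; split=> l /= [Al cl]; split=> //; apply/AB => //; apply/eqP.
Qed.

Lemma csum0 A c : (forall l, A l -> c l = 0) -> csum A c = 0.
Proof. by move=> A0; apply: fsbig1. Qed.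

Lemma csumD A c c' : lfin N c -> lfin N c' -> bounded A ->
  csum A (fun l => c l + c' l) = csum A c + csum A c'.
Proof.
move=> lc lc' bA; have [X HX] := bounded_fin lc bA; have [X' HX'] := bounded_fin lc' bA.
have HU l : A l -> c l + c' l != 0 -> l \in (X `|` X')%fset.
  move=> Al; rewrite in_fsetU; have [c0|/HX-> //] := eqVneq (c l) 0.
  by rewrite c0 add0r => /HX'->; rewrite ?orbT.
rewrite (csumE HU) (@csumE (X `|` X')%fset A c); last first.
  by move=> l Al /HX h; rewrite in_fsetU h.
rewrite (@csumE (X `|` X')%fset A c'); last first.
  by move=> l Al /HX' h; rewrite in_fsetU h ?orbT.
by rewrite -big_split; apply: eq_bigr => l _; case: ifP; rewrite ?addr0.
Qed.

Lemma csum_shift A c n : csum A (fun l => c (l - n)) = csum (shift n A) c.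
Proof.
rewrite /csum (reindex_fsbig (fun l => l + n) (shift n A) A).
  by apply: eq_fsbigr => l _; rewrite addrK.
split=> [l //|l l' _ _ /addIr //|l Al].
by exists (l - n); rewrite ?/shift /= subrK.
Qed.

Lemma csumU A B c : lfin N c -> bounded A -> bounded B ->
  csum (A `|` B)%classic c = csum A c + csum B c - csum (A `&` B)%classic c.
Proof.
move=> lc bA bB; have [X HX] := bounded_fin lc (boundedU bA bB).
rewrite (csumE HX) (@csumE X A); last by move=> l Al; apply: HX; left.
rewrite (@csumE X B); last by move=> l Al; apply: HX; right.
rewrite (@csumE X (A `&` B)%classic); last by move=> l [Al _]; apply: HX; left.
rewrite -big_split -sumrB; apply: eq_bigr => l _ /=.
have [Al|Al] := asboolP (A l); have [Bl|Bl] := asboolP (B l).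
- by rewrite !asboolT ?addrK //; left.
- by rewrite asboolT ?asboolF ?subr0 ?addr0 //; [case|left].
- by rewrite asboolT ?asboolF ?subr0 ?add0r //; [case|right].
- by rewrite !asboolF ?subr0 ?addr0 //; [case|case].
Qed.

Lemma csumD1 A B c : lfin N c -> bounded A ->
  csum A c = csum (A `&` B)%classic c + csum (A `&` ~` B)%classic c.
Proof.
move=> lc bA.
have bAB : bounded (A `&` B)%classic by apply: bounded_sub bA => l [].
have bAC : bounded (A `&` ~` B)%classic by apply: bounded_sub bA => l [].
rewrite -{1}(setIT A) -(setUv B) setIUr csumU // [X in _ - X]csum0 ?subr0 //.
by move=> l [[_ Bl] [_]].
Qed.

Lemma csum_poly A a : (forall l, l \in gsupp a -> A l) -> csum A (gcoef a) = eval_one a.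
Proof.
move=> aA; rewrite (@csumE (gsupp a)) /eval_one; last first.
  by move=> l _; rewrite gcoef_eq0 negbK.
by rewrite big_seq [RHS]big_seq; apply: eq_bigr => l /aA Al; rewrite asboolT.
Qed.

Definition cnt A f : int := csum A (expansion N f).

Local Notation expandable := (expandable N).

Lemma expandable_poly a : expandable a%:F.
Proof. by exists (gcoef a); apply: expan_poly. Qed.

Lemma expandableD f f' : expandable f -> expandable f' -> expandable (f + f').
Proof. by move=> [c fc] [c' fc']; eexists; apply: expanD fc fc'. Qed.

Lemma expandableM a f : expandable f -> expandable (a%:F * f).
Proof. by move=> [c fc]; eexists; apply: expanM fc. Qed.

Lemma expandableB f f' : expandable f -> expandable f' -> expandable (f - f').
Proof.
move=> ef ef'; apply: expandableD => //.
have -> : - f' = (-1 : lpoly V)%:F * f' by rewrite tofracN tofrac1 mulN1r.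
exact: expandableM.
Qed.

Lemma expandable_sum (I : Type) (s : seq I) (P : pred I) (F : I -> ratfun V) :
  (forall i, P i -> expandable (F i)) -> expandable (\sum_(i <- s | P i) F i).
Proof.
move=> eF; apply: (big_ind (fun f => expandable f)) => //; last exact: expandableD.
by rewrite -tofrac0; apply: expandable_poly.
Qed.

Lemma expandable_geom f n : expandable f -> posN N n -> expandable (f / (1 - mon n)%:F).
Proof. by move=> [c fc] /(expan_geom N0 fc)[c' fc' _]; exists c'. Qed.

Definition geom (s : seq (expo V)) : ratfun V := \prod_(n <- s) ((1 - mon n)%:F)^-1.

Lemma expan_geoms (K : expo V -> Prop) f c (s : seq (expo V)) :
  expan N f c -> (forall l, c l != 0 -> K l) ->
  (forall n, n \in s -> posN N n /\ forall l, K l -> K (l + n)) ->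
  exists2 c', expan N (f * geom s) c' & forall l, c' l != 0 -> K l.
Proof.
move=> fc cK; elim: s => [|n s IHs] Hs.
  by exists c => //; rewrite /geom big_nil mulr1.
have [|c' fc' c'K] := IHs; first by move=> m ms; apply: Hs; rewrite inE ms orbT.
have [pn nK] := Hs n (mem_head _ _).
have [c'' fc'' c''K] := expan_geom N0 fc' pn.
exists c''; first by rewrite /geom big_cons mulrCA mulrC.
move=> l /c''K[k /c'K]; have -> : K l = K (l - n *+ k + n *+ k) by rewrite subrK.
by elim: k (l - _) => [|k IHk] m Km; rewrite ?mulr0n ?addr0 // mulrS addrA; apply/IHk/nK.
Qed.

Lemma expandable_geoms f (s : seq (expo V)) :
  expandable f -> {in s, forall n, posN N n} -> expandable (f * geom s).
Proof.
move=> [c fc] ps; have [|c' fc' _] := @expan_geoms (fun _ => True) f c s fc (fun _ _ => I).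
  by move=> n /ps.
by exists c'.
Qed.

(** The closure condition on K lets any property stable under the directions
    of the geometric series be transported to the exponents of the expansion. *)
Lemma geoms_supp (K : expo V -> Prop) a (s : seq (expo V)) :
  (forall l, l \in gsupp a -> K l) ->
  (forall n, n \in s -> posN N n /\ forall l, K l -> K (l + n)) ->
  forall l, expansion N (a%:F * geom s) l != 0 -> K l.
Proof.
move=> aK sK; have [|c' fc' c'K] := expan_geoms (expan_poly N a) _ sK.
  by move=> l; rewrite gcoef_eq0 negbK => /aK.
by rewrite (expansionE N0 fc').
Qed.

Lemma lfin_expansion f : expandable f -> lfin N (expansion N f).
Proof. by move/(expansionP N0) => []. Qed.

Lemma cntD A f f' : expandable f -> expandable f' -> bounded A ->
  cnt A (f + f') = cnt A f + cnt A f'.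
Proof.
move=> ef ef' bA; have [c fc] := ef; have [c' fc'] := ef'.
rewrite /cnt (expansionE N0 (expanD fc fc')) (expansionE N0 fc) (expansionE N0 fc').
by apply: csumD => //; [case: fc|case: fc'].
Qed.

Lemma cnt_poly A a : cnt A a%:F = csum A (gcoef a).
Proof. by rewrite /cnt (expansionE N0 (expan_poly N a)). Qed.

Lemma cnt_mon A f (r : int) n : expandable f ->
  cnt A ((gmon r n)%:F * f) = r * cnt (shift n A) f.
Proof.
move=> [c fc]; rewrite /cnt (expansionE N0 (expanM (gmon r n) fc)) (expansionE N0 fc).
rewrite -csum_shift.
rewrite (_ : act _ _ = fun l => r * c (l - n)); last by apply/funext => l; rewrite act_gmon.
by rewrite /csum -mulr_fsumr.
Qed.

Lemma cntM A a f : expandable f -> bounded A ->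
  cnt A (a%:F * f) = \sum_(z <- gsupp a) gcoef a z * cnt (shift z A) f.
Proof.
move=> ef bA; elim/galg_ind: a => [|a b IHa IHb|r n].
- rewrite /gsupp msupp0 big_seq_fset0 tofrac0 mul0r -tofrac0 cnt_poly.
  by apply: csum0 => l _; rewrite gcoef0.
- rewrite tofracD mulrDl cntD ?IHa ?IHb //; try exact: expandableM.
  rewrite (gsum_add (F := fun r z => r * cnt (shift z A) f)) // => [z|r s z].
    by rewrite mul0r.
  by rewrite mulrDl.
- rewrite cnt_mon // (gsum_mon _ _ (F := fun r z => r * cnt (shift z A) f)) // => z.
  by rewrite mul0r.
Qed.

Lemma cntN A f : expandable f -> cnt A (- f) = - cnt A f.
Proof.
move=> ef; have -> : - f = (gmon (-1) 0 : lpoly V)%:F * f.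
  have -> : gmon (-1) 0 = -1 :> lpoly V by rewrite /gmon monalgUN.
  by rewrite tofracN tofrac1 mulN1r.
rewrite cnt_mon // mulN1r; congr (- csum _ _).
by apply/seteqP; split=> l; rewrite /shift /= addr0.
Qed.

Lemma cntB A f f' : expandable f -> expandable f' -> bounded A ->
  cnt A (f - f') = cnt A f - cnt A f'.
Proof.
move=> ef ef' bA; rewrite cntD ?cntN //.
by have := expandableB (expandable_poly 0) ef'; rewrite tofrac0 sub0r.
Qed.

Lemma cnt_sum A (I : Type) (s : seq I) (P : pred I) (F : I -> ratfun V) :
  (forall i, P i -> expandable (F i)) -> bounded A ->
  cnt A (\sum_(i <- s | P i) F i) = \sum_(i <- s | P i) cnt A (F i).
Proof.
move=> eF bA; elim: s => [|i s IHs].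
  by rewrite !big_nil -tofrac0 cnt_poly; apply: csum0 => l _; rewrite gcoef0.
rewrite !big_cons; case: ifP => // Pi; rewrite cntD ?IHs //; first exact: eF.
exact: expandable_sum.
Qed.

Lemma one_mon_neq0 n : posN N n -> 1 - mon n != 0 :> lpoly V.
Proof.
have [v vN] := finset.set0Pn _ N0; move=> pn.
apply/eqP => /(congr1 (fun p => gcoef p 0)); rewrite gcoefB gcoef0.
rewrite /mon -[1]/(gmon 1 0 : lpoly V) !gcoef_gmon eqxx.
have -> : (n == 0) = false.
  by apply/eqP => n0; have := pn v vN; rewrite n0 ffunE ltxx.
by move/eqP; rewrite subr0 oner_eq0.
Qed.

(** The difference equation satisfied by a counting function. *)
Lemma cnt_geom A f n : expandable f -> posN N n -> bounded A ->
  cnt A (f / (1 - mon n)%:F) - cnt (shift n A) (f / (1 - mon n)%:F) = cnt A f.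
Proof.
move=> ef pn bA; have eg := expandable_geom ef pn.
rewrite -[cnt (shift n A) _]mul1r -cnt_mon // -cntB //; last exact: expandableM.
congr cnt; rewrite -{1}[f / _]mul1r -mulrBl -tofrac1 -tofracB mulrC divfK //.
by rewrite tofrac_neq0 one_mon_neq0.
Qed.

End Counting.

(** * Branches of a tree *)

Section Tree.
Import mathcomp.boot.fintype mathcomp.boot.finset.
Variables (V : finType) (e : rel V).
Hypothesis e_tree : is_tree e.
Implicit Types (u v w m r c x y : V) (p : seq V).

Let e_sym : symmetric e. Proof. by case: e_tree. Qed.
Let e_irr : irreflexive e. Proof. by case: e_tree. Qed.

Lemma edge_neq v w : e v w -> v != w.
Proof. by apply: contraTneq => ->; rewrite e_irr. Qed.

Lemma connect_ind (g : rel V) (P : V -> Prop) a b :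
  connect g a b -> P a -> (forall x y, P x -> g x y -> P y) -> P b.
Proof.
case/connectP=> p + -> Pa Pg; elim: p a Pa => //= x p IH a Pa /andP[ax xp].
by apply: IH xp; apply: Pg ax.
Qed.

Definition avoid m : rel V := fun x y => [&& e x y, x != m & y != m].

(** The component of T minus m that contains r. It is locked because
    membership would otherwise be unfolded in every simplification. *)
Definition branch m r : {set V} := locked [set v | connect (avoid m) r v].

Lemma avoid_csym m : connect_sym (avoid m).
Proof. by apply: sym_connect_sym => x y; rewrite /avoid /= e_sym [(x != m) && _]andbC. Qed.

Lemma mem_branch m r v : (v \in branch m r) = connect (avoid m) r v.
Proof. by rewrite /branch -lock inE. Qed.

Lemma mem_branch_self m r : r \in branch m r.
Proof. by rewrite mem_branch connect0. Qed.

Lemma branch_neq m r v : r != m -> v \in branch m r -> v != m.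
Proof. by rewrite mem_branch => rm rv; apply: (connect_ind (P := fun x => x != m) rv) => //
  x y _ /and3P[]. Qed.

Lemma branch_edge m r x y : x \in branch m r -> x != m -> y != m -> e x y -> y \in branch m r.
Proof.
rewrite !mem_branch => rx xm ym xy; apply: connect_trans rx _; apply: connect1.
by rewrite /avoid xy xm.
Qed.

Lemma path_avoid m r p : path e r p -> r != m -> m \notin p -> path (avoid m) r p.
Proof.
elim: p r => //= x p IH r /andP[rx xp] rm; rewrite inE negb_or => /andP[mx mp].
by rewrite /avoid rx rm eq_sym mx IH // eq_sym.
Qed.

Lemma nbr_inj m r r' : e m r -> e m r' -> r' \in branch m r -> r' = r.
Proof.
move=> mr mr'; rewrite mem_branch => /connectP[p0 restrict_poly0 er']; rewrite {}er' in mr' *.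
case/shortenP: restrict_poly0 mr' => p rp up _ mr'; apply/eqP/negPn/negP => r'r.
have mp x : x \in r :: p -> x != m.
  rewrite inE => /predU1P[->|xp]; first by rewrite eq_sym edge_neq.
  elim: p r rp {up mr mr' r'r} xp => //= y p IH r /andP[/and3P[_ _ ym] yp].
  by rewrite inE => /predU1P[->//|]; apply: IH yp.
have ep : path e r p by apply: sub_path rp => x y /and3P[].
have [_ _ _ /(_ (m :: r :: p))] := e_tree.
rewrite /= mr rcons_path ep e_sym mr' => /(_ isT).
have -> : m \notin r :: p by apply/negP => /mp; rewrite eqxx.
move=> /(_ up); case: p r'r {rp up mr' mp ep} => //=.
by rewrite eqxx.
Qed.

Lemma branch_exists m v : v != m -> exists2 r, e m r & v \in branch m r.
Proof.
move=> vm; have [_ _ /(_ m v) + _] := e_tree.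
case/connectP=> p0 mp0 ev; rewrite {}ev in vm *.
case/shortenP: mp0 vm => [[|r p]] /= mp up _ vm; first by rewrite eqxx in vm.
have [/andP[mr rp] /andP[mrp _]] := (mp, up); exists r => //.
move: mrp; rewrite inE negb_or => /andP[mr' mp'].
by rewrite mem_branch; apply/connectP; exists p => //; apply: path_avoid; rewrite // eq_sym.
Qed.

(** The neighbour of m on the way from m to v. *)
Definition toward m v : V := odflt m [pick r | e m r & v \in branch m r].

Lemma towardP m v : v != m -> e m (toward m v) /\ v \in branch m (toward m v).
Proof.
move=> vm; rewrite /toward; case: pickP => [r /andP[]//|nr].
by have [r mr rv] := branch_exists vm; have := nr r; rewrite mr rv.
Qed.

Lemma branch_eq m r r' v : e m r -> e m r' -> v \in branch m r -> v \in branch m r' -> r = r'.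
Proof.
move=> mr mr'; rewrite !mem_branch => rv r'v; apply: (@nbr_inj m) => //.
by rewrite mem_branch; apply: (connect_trans r'v); rewrite avoid_csym.
Qed.

Lemma toward_eq m r v : e m r -> v \in branch m r -> toward m v = r.
Proof.
move=> mr rv; have vm : v != m by apply: branch_neq rv; rewrite eq_sym edge_neq.
by have [mn nv] := towardP vm; apply: branch_eq nv rv.
Qed.

Lemma branch_toward m r v : e m r -> (v \in branch m r) = (v != m) && (toward m v == r).
Proof.
move=> mr; apply/idP/andP => [rv|[vm /eqP <-]]; last by case: (towardP vm).
by split; [apply: branch_neq rv; rewrite eq_sym edge_neq | apply/eqP/toward_eq].
Qed.

Lemma branch_sub m r c : e m r -> e r c -> c != m -> branch r c \subset branch m r.
Proof.
move=> mr rc cm; apply/fintype.subsetP => v cv; have {}cv' := cv; rewrite mem_branch in cv'.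
have [] : v \in branch r c /\ v \in branch m r; last by [].
have rm : r != m by rewrite eq_sym edge_neq.
apply: (connect_ind (P := fun x => x \in branch r c /\ x \in branch m r) cv').
  by split; [apply: mem_branch_self | apply: branch_edge rc; rewrite ?mem_branch_self].
move=> x y [xc xm] /and3P[xy xr yr].
have yc : y \in branch r c by apply: branch_edge xy.
split=> //; apply: branch_edge xy => //; first exact: branch_neq xm.
apply: contraNneq cm => ym; rewrite -(@nbr_inj r m c) ?mem_branch_self //; first by rewrite
  e_sym.
by rewrite -ym; move: yc; rewrite !mem_branch avoid_csym.
Qed.

Lemma branch_compl m r : e m r -> branch m r = ~: branch r m.
Proof.
move=> mr; have rm : e r m by rewrite e_sym.
apply/setP => v; rewrite in_setC (branch_toward _ rm).
have [->|vr] /= := eqVneq v r; first by rewrite mem_branch_self.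
apply/idP/idP => [vm|nm]; last first.
  have [rc cv] := towardP vr; exact: (fintype.subsetP (branch_sub mr rc nm) _ cv).
apply/negP => /eqP nm; have [_] := towardP vr; rewrite nm mem_branch.
case/connectP=> p0 mp0 ev; have v0 : v != m by apply: branch_neq vm; rewrite eq_sym edge_neq.
rewrite {}ev in vm vr nm v0 *; case/shortenP: mp0 vm vr nm v0 => [[|r' p]] /= mp up _ vm vr
  nm v0.
  by rewrite eqxx in v0.
case/andP: mp => /and3P[mr' _ r'r] r'p; case/andP: up => mrp _.
have ep : path e r' p by apply: sub_path r'p => x y /and3P[].
move: mrp; rewrite inE negb_or => /andP[mr'' mp'].
case/eqP: r'r; apply: (branch_eq mr' mr _ vm); rewrite mem_branch; apply/connectP; exists p
  => //.
by apply: path_avoid; rewrite // eq_sym.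
Qed.

(** Induction from the ends of the tree: a branch consists of its root r and
    of the branches at r that point away from m. *)
Lemma branch_ind (P : V -> V -> Prop) :
  (forall m r, e m r -> (forall c, e r c -> c != m -> P r c) -> P m r) ->
  forall m r, e m r -> P m r.
Proof.
move=> IH m r; move: {2}#|_| (leqnn #|branch m r|) => n.
elim: n m r => [|n IHn] m r.
  by rewrite leqn0 cards_eq0 => /eqP h; have := mem_branch_self m r; rewrite h inE.
move=> len mr; apply: IH => // c rc cm; apply: IHn => //.
rewrite -ltnS; apply: leq_trans len; apply: proper_card; apply/fintype.properP.
split; first exact: branch_sub; exists r; first exact: mem_branch_self.
by apply/negP => /branch_neq; rewrite eqxx eq_sym edge_neq // => /(_ isT).
Qed.

(** From a vertex u that is not on the side of w, the way to w passes through
    v. *)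
Lemma branch_cover v w u : v != w -> u \notin branch v (toward v w) -> u \in branch w
  (toward w v).
Proof.
move=> vw nu; have [ewv vin] := towardP vw.
have [->//|uv] := eqVneq u v.
have [er ur] := towardP uv; set r := toward v u in er ur.
have wr : w \notin branch v r.
  apply: contraNN nu => wr; have <- : r = toward v w by rewrite (toward_eq er wr).
  by [].
have rv : r != v by rewrite eq_sym edge_neq.
have rw : r \in branch w (toward w v).
  apply: branch_edge er => //; apply: contraNneq wr => <-; exact: mem_branch_self.
suff [] : u \in branch v r /\ u \in branch w (toward w v) by [].
rewrite mem_branch in ur.
apply: (connect_ind (P := fun x => x \in branch v r /\ x \in branch w (toward w v)) ur).
  by rewrite mem_branch_self.
move=> x y [xr xw] /and3P[xy xv yv].
have yr : y \in branch v r by apply: branch_edge xy.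
by split=> //; apply: branch_edge xy => //; [apply: contraNneq wr => <- | apply: contraNneq
  wr => <-].
Qed.

Lemma toward_cover v w u : v != w -> u != v -> toward v u != toward v w ->
  toward w u = toward w v.
Proof.
move=> vw uv nuw; have [ewv _] := towardP vw; apply: toward_eq => //.
apply: branch_cover => //; have wv : w != v by rewrite eq_sym.
by have [evw _] := towardP wv; rewrite branch_toward // (negPf nuw) andbF.
Qed.

(** * Chains of vertices of valency 2 *)

Lemma open_path_exists v w : v != w -> exists p, open_path e v w p.
Proof.
move=> vw; have [_ _ /(_ v w) + _] := e_tree.
case/connectP=> p0 vp0 ew; rewrite {}ew in vw *.
case/shortenP: vp0 vw => p vp up _ vw.
case/lastP: p vp up vw => [|p x]; first by rewrite eqxx.
by rewrite last_rcons => vp up _; exists p; rewrite /open_path vp.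
Qed.

Lemma open_path_head v w p : open_path e v w p ->
  [/\ e v (head w p), w \in branch v (head w p) & {subset p <= branch v (head w p)}].
Proof.
case/andP=> vp up; have sub : {subset rcons p w <= branch v (head w p)} /\ e v (head w p).
  case: p vp up => [|r p] /=.
    rewrite andbT => vw _; split=> // x; rewrite inE => /eqP ->; exact: mem_branch_self.
  case/andP=> vr rp /andP[+ up]; rewrite inE negb_or => /andP[vr' vp].
  split=> // x xp; rewrite mem_branch.
  have ap : path (avoid v) r (rcons p w) by apply: path_avoid; rewrite // eq_sym.
  move: xp; rewrite inE => /predU1P[->|xp]; first exact: connect0.
  by case/splitPr: xp ap => p1 p2; rewrite cat_path /= => /and3P[r1 h _];
    apply/connectP; exists (rcons p1 x); rewrite ?rcons_path ?r1 ?last_rcons.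
by case: sub => sub ev; split=> // [|x xp]; apply: sub; rewrite mem_rcons inE ?eqxx ?xp ?orbT.
Qed.

Lemma open_path_neq v w p : open_path e v w p -> v != w.
Proof.
by case/andP=> _ /= /andP[+ _]; apply: contraNneq => ->; rewrite mem_rcons mem_head.
Qed.

Lemma open_path_toward v w p : open_path e v w p -> toward v w = head w p.
Proof. by case/open_path_head => ev wv _; apply: toward_eq. Qed.

Lemma open_path_rev v w p : open_path e v w p -> open_path e w v (rev p).
Proof.
case/andP=> vp up; apply/andP; split.
  have := rev_path e v (rcons p w); rewrite last_rcons belast_rcons /= rev_cons => ->.
  by apply: sub_path vp => x y; rewrite e_sym.
have -> : w :: rcons (rev p) v = rev (v :: rcons p w) by rewrite rev_cons rev_rcons.
by rewrite rev_uniq.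
Qed.

Lemma head_rev v p : head v (rev p) = last v p.
Proof. by case/lastP: p => //= p x; rewrite rev_rcons last_rcons. Qed.

Lemma open_path_last v w p : open_path e v w p -> toward w v = last v p.
Proof. by move/open_path_rev/open_path_toward; rewrite head_rev. Qed.

(** Cutting the open path leaves v with all its branches but the one towards
    w. *)
Lemma connect_cut v w p u : open_path e v w p ->
  connect (cut_path e v w p) v u = (u \notin branch v (toward v w)).
Proof.
move=> op; rewrite (open_path_toward op); have [ev wv sub] := open_path_head op.
have hv : head w p != v by rewrite eq_sym edge_neq.
have vp : v \notin p by case/andP: op => _ /= /andP[]; rewrite mem_rcons inE negb_or =>
  /andP[].
have vw := open_path_neq op.
apply/idP/idP => [cu|nu].
  apply: (connect_ind (P := fun x => x \notin branch v (head w p)) cu); first by apply/negP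
    => /branch_neq; rewrite eqxx => /(_ hv).
  move=> x y nx /and4P[xy xp yp]; rewrite !inE !xpair_eqE negb_or => /andP[nvw nwv].
  apply: contraNN nx => yb; have yv := branch_neq hv yb.
  have [xv|xv] := eqVneq x v; last by apply: branch_edge yb yv xv _; rewrite e_sym.
  rewrite xv in xy nvw; have yh : y = head w p by apply: nbr_inj yb.
  case: p {op wv sub cu ev vp} hv xp yp yh yb => [|z p] /=.
    by move=> _ _ _ yw; rewrite yw !eqxx in nvw.
  by move=> _ _ + yz; rewrite yz mem_head.
have [->|uv] := eqVneq u v; first exact: connect0.
have [er ur] := towardP uv; set r := toward v u in er ur.
have rh : r != head w p by apply: contraNneq nu => <-.
have nb x : x \in branch v r -> x \notin branch v (head w p).
  by move=> xr; apply: contraNN rh => xh; rewrite (branch_eq er ev xr xh).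
have np x : x \in branch v r -> x \notin p by move=> /nb; apply: contraNN => /sub.
have nw x : x \in branch v r -> x != w by move=> /nb; apply: contraNneq => ->.
have rv : r != v by rewrite eq_sym edge_neq.
have vr : cut_path e v w p v r.
  rewrite /cut_path er vp np ?mem_branch_self //= !inE !xpair_eqE negb_or eqxx /=.
  by rewrite nw ?mem_branch_self //= (negPf vw).
suff [] : u \in branch v r /\ connect (cut_path e v w p) v u by [].
rewrite mem_branch in ur.
apply: (connect_ind (P := fun x => x \in branch v r /\ connect (cut_path e v w p) v x) ur).
  by rewrite mem_branch_self connect1.
move=> x y [xr cx] /and3P[xy xv yv].
have yr : y \in branch v r by apply: branch_edge xy.
split=> //; apply: connect_trans cx (connect1 _).
by rewrite /cut_path xy !np //= !inE !xpair_eqE (negPf xv) (negPf (nw _ xr)).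
Qed.

Lemma subtreeE v w : v != w -> subtree e v w = ~: branch v (toward v w).
Proof.
move=> vw; apply/setP => u; rewrite in_setC inE.
apply/asboolP/idP => [[p op]|nu].
  by rewrite connect_cut.
have [p op] := open_path_exists vw; exists p => //.
by rewrite connect_cut.
Qed.

(** The two neighbours of an interior vertex of the chain lie on the chain, so
    one leaves the chain only through its ends. *)
Lemma chain_branch v w p u : open_path e v w p -> all (fun x => valency e x == 2%N) p ->
  u \in branch v (toward v w) -> u \notin p -> u \notin branch w (toward w v).
Proof.
move=> op; rewrite (open_path_last op) (open_path_toward op).
have [vp up] := andP op; have elw : e (last v p) w by move: vp; rewrite rcons_path => /andP[].
rewrite (@branch_compl w) 1?e_sym // in_setC negbK => {op elw}.
elim: p v vp up => [|r p IH] v //=.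
case/andP=> vr rp /andP[+ up] /andP[r2 p2] ub; rewrite inE negb_or => /andP[vr' vrp].
rewrite inE negb_or => /andP[ur upp].
apply: IH => //; move: ub; rewrite branch_compl // in_setC.
have rv : e r v by rewrite e_sym.
have erh : e r (head w p) by case: p rp {up p2 vrp upp} => [|x p] /= /andP[].
rewrite (branch_toward _ rv) ur /= => nv; rewrite branch_toward // ur /=.
have [ern _] := towardP ur; move: r2 => /eqP r2.
apply/negPn/negP => nh; suff : (3 <= valency e r)%N by rewrite r2.
have hv : head w p != v by apply: contraNneq vrp => <-; case: (p) => [|x q]; rewrite /=
  mem_head.
have -> : 3%N = #|[set v; head w p; toward r u]|.
  by rewrite -setUA cardsU1 cards2 !inE negb_or ![v == _]eq_sym hv nv eq_sym nh.
by apply: subset_leq_card; apply/fintype.subsetP => x; rewrite !inE -orbA => /or3P[] /eqP ->.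
Qed.

(** Following a branch outwards stops at a vertex without further neighbours. *)
Lemma branch_ends m r : e m r -> exists2 u, u \in ends e & u \in branch m r.
Proof.
move: m r; apply: branch_ind => m r mr IH.
have [v1|] := boolP (r \in ends e); first by exists r; rewrite ?mem_branch_self.
rewrite inE => v1; have : exists2 c, e r c & c != m.
  apply: contrapT => nc; case/negP: v1; apply/eqP.
  have -> : 1%N = #|[set m]| by rewrite cards1.
  congr #|pred_of_set _|; apply/setP => x; rewrite !inE.
  apply/idP/eqP => [rx|->]; last by rewrite e_sym.
  by apply/eqP/negPn/negP => xm; case: nc; exists x.
case=> c rc cm; have [u uE uc] := IH c rc cm; exists u => //.
exact: (fintype.subsetP (branch_sub mr rc cm) _ uc).
Qed.

Lemma node_nbr v w : v \in nodes e -> exists2 r, e v r & r != w.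
Proof.
rewrite inE => v3; apply: contrapT => nr; move: v3; rewrite /valency.
have : [set x | e v x] \subset [set w].
  apply/fintype.subsetP => x; rewrite !inE => vx; apply/negPn/negP => xw.
  by apply: nr; exists x.
by move/subset_leq_card; rewrite cards1 => h; rewrite leqNgt (leq_ltn_trans h).
Qed.

Lemma subtree_end_exists v w : v \in nodes e -> v != w ->
  exists u, u \in subtree_ends e v w.
Proof.
move=> vN vw; have [r vr rw] := node_nbr (toward v w) vN.
have [u uE ur] := branch_ends vr; exists u; rewrite inE uE subtreeE // inE.
rewrite branch_toward; first by rewrite (toward_eq vr ur) (negPf rw) andbF.
by rewrite eq_sym in vw; case: (towardP vw).
Qed.

(** * The orbifold graph *)

Lemma orb_adjP v w : reflect (exists p, [/\ v \in nodes e, w \in nodes e, open_path e v w p &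
   all (fun x => valency e x == 2%N) p]) (orb_adj e v w).
Proof.
apply: (iffP and3P) => [[vN wN /asboolP[p op p2]]|[p [vN wN op p2]]].
  by exists p.
by split=> //; apply/asboolP; exists p.
Qed.

Lemma orb_adj_sym : symmetric (orb_adj e).
Proof.
suff sub v w : orb_adj e v w -> orb_adj e w v by move=> v w; apply/idP/idP; apply: sub.
case/orb_adjP=> p [vN wN op p2]; apply/orb_adjP; exists (rev p).
by rewrite all_rev open_path_rev.
Qed.

Lemma orb_adj_neq v w : orb_adj e v w -> v != w.
Proof. by case/orb_adjP=> p [_ _ /open_path_neq]. Qed.

Lemma orb_adj_branch v w u : orb_adj e v w -> valency e u != 2%N ->
  u \in branch v (toward v w) -> u \notin branch w (toward w v).
Proof.
case/orb_adjP=> p [_ _ op p2] u2 ub; apply: (chain_branch op p2 ub).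
by apply: contraNN u2 => /(allP p2).
Qed.

Lemma node_valency2 v : v \in nodes e -> valency e v != 2%N.
Proof. by rewrite inE; apply: contraTneq => ->. Qed.

(** The interior vertices of the chain between v and w have valency 2, so that
    cutting it loses no end. *)
Lemma subtree_ends_cover v w : orb_adj e v w ->
  ends e = subtree_ends e v w :|: subtree_ends e w v.
Proof.
move=> vw; have nvw := orb_adj_neq vw; have nwv : w != v by rewrite eq_sym.
apply/setP => u; rewrite /subtree_ends in_setU !in_setI.
have [uE|//] := boolP (u \in ends e); rewrite !subtreeE // !in_setC /=.
apply/esym/orP; have [ub|] := boolP (u \in branch v (toward v w)); last by left.
right; apply: orb_adj_branch ub => //; move: uE; rewrite inE => /eqP ->.
by [].
Qed.

Lemma subtree_ends_disj v w : v != w ->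
  [disjoint subtree_ends e v w & subtree_ends e w v].
Proof.
move=> nvw; have nwv : w != v by rewrite eq_sym.
rewrite -setI_eq0; apply/eqP/setP => u; rewrite /subtree_ends !in_setI in_set0.
rewrite !subtreeE // !in_setC; apply/negP => /andP[/andP[_ u1] /andP[_]].
by rewrite (branch_cover nvw u1).
Qed.

Variable rho : V.
Hypothesis rhoN : rho \in nodes e.

(** The parent relation of the orbifold tree rooted at rho: of two adjacent
    nodes, one is on the way to rho from the other. *)
Definition up v w : bool := orb_adj e v w && (rho \in branch v (toward v w)).

Definition parent v : V := odflt v [pick w | up v w].

Lemma path_valency v p w x : path e v (rcons p w) -> uniq (v :: rcons p w) ->
  x \in p -> (2 <= valency e x)%N.
Proof.
move=> vp up xp; case/splitPr: xp vp up => p1 p2.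
rewrite rcons_cat -cat_cons cat_uniq cat_path /= => /and3P[_ yx xz] /and3P[_ /norP[_ up] _].
set y := last v p1 in yx; have {xz} : e x (head w p2) by case: p2 xz {up} => [|z p2] /=
  /andP[].
set z := head w p2 => xz.
have yz : y != z.
  apply: contraNneq up => yz; apply/hasP; exists y; last exact: mem_last.
  by rewrite yz /z; case: (p2) => [|? ?]; rewrite /= mem_head.
have -> : 2%N = #|[set y; z]| by rewrite cards2 yz.
apply: subset_leq_card; apply/fintype.subsetP => u; rewrite !inE => /orP[] /eqP -> //.
by rewrite e_sym.
Qed.

Lemma up_exists v : v \in nodes e -> v != rho -> exists w, up v w.
Proof.
move=> vN vr; have [p op] := open_path_exists vr.
have hasN : has (mem (nodes e)) (rcons p rho).
  by apply/hasP; exists rho; rewrite ?mem_rcons ?mem_head.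
have [p1 [w [p2 [eqp wN p1N]]]] : exists p1 w p2, [/\ rcons p rho = rcons p1 w ++ p2,
    w \in nodes e & ~~ has (mem (nodes e)) p1].
  by case/split_find: hasN => w p1 p2 wN p1N; exists p1, w, p2.
have [vp upq] := andP op; rewrite eqp in vp upq.
have op1 : open_path e v w p1.
  move: vp upq; rewrite cat_path => /andP[vp1 _]; rewrite -cat_cons cat_uniq => /andP[u1 _].
  exact/andP.
exists w; apply/andP; split.
  apply/orb_adjP; exists p1; split=> //; apply/allP => x xp1.
  have [vp1 up1] := andP op1; have := path_valency vp1 up1 xp1.
  have xN : x \notin nodes e by move/hasPn: p1N => /(_ _ xp1).
  by move=> h2; move: xN; rewrite inE -leqNgt => h1; rewrite eqn_leq h1.
rewrite (open_path_toward op1) (_ : head w p1 = head rho p).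
  by case: (open_path_head op).
by have := congr1 (head rho) eqp; case: (p) (p1) => [|? ?] [|? ?].
Qed.

Lemma up_uniq v w w' : up v w -> up v w' -> w = w'.
Proof.
case/andP=> vw rw /andP[vw' rw'].
have [nvw nvw'] := (orb_adj_neq vw, orb_adj_neq vw').
have nwv : w != v by rewrite eq_sym.
have nw'v : w' != v by rewrite eq_sym.
have [[ev wb] [ev' wb']] := (towardP nwv, towardP nw'v).
have enn : toward v w = toward v w' by apply: branch_eq rw rw'.
have [wN wN'] : w \in nodes e /\ w' \in nodes e by case/and3P: vw; case/and3P: vw'.
have h1 := orb_adj_branch vw (node_valency2 wN'); rewrite enn in h1; have {}h1 := h1 wb'.
have h2 := orb_adj_branch vw' (node_valency2 wN); rewrite -enn in h2; have {}h2 := h2 wb.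
apply/eqP/negPn/negP => ww'.
have [e1 _] := towardP nvw; have [e1' _] := towardP nvw'.
have ww : w' != w by rewrite eq_sym.
rewrite branch_toward // ww /= in h1; rewrite branch_toward // ww' /= in h2.
have := toward_cover ww' nvw; rewrite eq_sym h1 => /(_ isT) h3.
by rewrite h3 eqxx in h2.
Qed.

Lemma parentP v : v \in nodes e -> v != rho -> up v (parent v).
Proof.
move=> vN vr; rewrite /parent; case: pickP => [//|nw].
by have [w vw] := up_exists vN vr; rewrite nw in vw.
Qed.

Lemma up_parent v w : up v w -> parent v = w.
Proof.
move=> vw; rewrite /parent; case: pickP => [x vx|/(_ w)]; last by rewrite vw.
exact: up_uniq vx vw.
Qed.

Lemma up_neq_rho v w : up v w -> v != rho.
Proof.
case/andP=> vw; apply: contraTneq => <-; have := orb_adj_neq vw.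
rewrite eq_sym => wv; have [ev _] := towardP wv.
by apply/negP => /branch_neq; rewrite eqxx eq_sym edge_neq // => /(_ isT).
Qed.

(** The node rho lies on exactly one side of an edge. *)
Lemma up_asym v w : orb_adj e v w -> up w v = ~~ up v w.
Proof.
move=> vw; rewrite /up orb_adj_sym vw /=.
have [rv|rv] := boolP (rho \in branch v (toward v w)).
  apply/negP/negP; exact: orb_adj_branch (node_valency2 rhoN) rv.
by rewrite (branch_cover _ rv) // orb_adj_neq.
Qed.

Definition beyond w : {set V} := ~: branch w (toward w rho).

Lemma beyond_proper v w : v != rho -> w != rho -> v != w -> v \in beyond w ->
  beyond v \proper beyond w.
Proof.
move=> vr wr vw; have rv : rho != v by rewrite eq_sym.
have rw : rho != w by rewrite eq_sym.
have [[ev rbv] [ew rbw]] := (towardP rv, towardP rw).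
rewrite in_setC branch_toward // vw /= => nwv; have wv : w != v by rewrite eq_sym.
have nvr : toward v rho = toward v w by apply: toward_cover => //; rewrite eq_sym.
apply/fintype.properP; split; last first.
  exists w; rewrite in_setC; first by rewrite branch_toward // eqxx.
  by rewrite nvr negbK; case: (towardP wv).
apply/fintype.subsetP => x; rewrite !in_setC nvr => xv.
have /(toward_eq _) := branch_cover vw xv; have [ewv _] := towardP vw; move=> /(_ ewv) xw.
by rewrite branch_toward // xw (negPf nwv) andbF.
Qed.

Lemma up_beyond v w : up v w -> w != rho -> v \in beyond w.
Proof.
move=> uvw wr; have vw : orb_adj e v w by case/andP: uvw.
have := up_asym vw; rewrite uvw /up orb_adj_sym vw /= => rb.
have nvw := orb_adj_neq vw; have [ewv _] := towardP nvw.
have rw : rho != w by rewrite eq_sym.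
have [ew _] := towardP rw.
rewrite in_setC branch_toward // nvw /=; apply: contraFN rb => /eqP ->.
by case: (towardP rw).
Qed.

(** The nodes can be enumerated from the root so that each new node is
    separated by its parent from the other nodes listed before it: remove a
    node w with the fewest vertices beyond it; no other remaining node lies
    beyond w. *)
Lemma orb_ind (P : {set V} -> Prop) : P [set rho] ->
  (forall (A : {set V}) w, P A -> A \subset nodes e -> w \in nodes e -> w \notin A ->
     w != rho -> rho \in A -> parent w \in A -> up w (parent w) ->
     (forall v, v \in A -> v != parent w -> toward (parent w) w != toward (parent w) v) -> P
       (w |: A)) ->
  P (nodes e).
Proof.
move=> P1 Pstep.
suff: forall n (A : {set V}), (#|A| <= n)%N -> A \subset nodes e -> rho \in A ->
    (forall v, v \in A -> v != rho -> parent v \in A) -> P A.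
  apply; first exact: leqnn; rewrite ?subxx //.
  by move=> v vN vr; have /andP[/and3P[]] := parentP vN vr.
elim=> [|n IH] A An AN rA Apar.
  by move: An; rewrite leqn0 cards_eq0 => /eqP A0; rewrite A0 inE in rA.
have [A1|A1] := eqVneq A [set rho]; first by rewrite A1.
have [w0 /andP[w0A w0r]] : exists w0, (w0 \in A) && (w0 != rho).
  apply: contrapT => nw; case/eqP: A1; apply/setP => x; rewrite inE.
  apply/idP/eqP => [xA|->//]; apply/eqP/negPn/negP => xr; case: nw; exists x.
  by rewrite xA.
have [w /andP[wA wr] wmin] := @arg_minnP _ w0 [pred w | (w \in A) && (w != rho)]
  (fun w => #|beyond w|) (introT andP (conj w0A w0r)).
have wN := subsetP AN w wA; have uw := parentP wN wr; set m := parent w in uw *.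
have nob v : v \in A -> v != w -> v != rho -> v \notin beyond w.
  move=> vA vw vr; apply/negP => /(beyond_proper vr wr vw)/proper_card.
  by rewrite ltnNge wmin //= vA.
have wA' : w \notin A :\ w by rewrite !inE eqxx.
have -> : A = w |: (A :\ w) by rewrite setD1K.
have dual_binomial : orb_adj e w m by case/andP: uw.
have wm := orb_adj_neq dual_binomial; have mw : m != w by rewrite eq_sym.
have mA : m \in A :\ w by rewrite !inE mw Apar.
have rA' : rho \in A :\ w by rewrite !inE eq_sym wr.
have AN' : A :\ w \subset nodes e by apply: subset_trans AN; apply: subD1set.
apply: Pstep => //.
  apply: IH => //.
    by rewrite -ltnS (leq_trans _ An) // (cardsD1 w A) wA.
  move=> v; rewrite !inE => /andP[vw vA] vr; rewrite Apar // andbT.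
  apply/eqP => pv; have := parentP (fintype.subsetP AN v vA) vr; rewrite pv => uv.
  by have := nob v vA vw vr; rewrite up_beyond.
move=> v; rewrite !inE => /andP[vw vA] vm; apply/eqP => nn.
have [em wb] := towardP wm; have [_ vb] := towardP vm; rewrite -nn in vb.
have om' : orb_adj e m w by rewrite orb_adj_sym.
have := orb_adj_branch om' (node_valency2 (fintype.subsetP AN v vA)) vb.
have [ew mb] := towardP mw; have rb : rho \in branch w (toward w m) by case/andP: uw.
have nr : toward w rho = toward w m by apply: toward_eq.
move=> vb'; have vr : v != rho by apply: contraNneq vb' => ->.
by have := nob v vA vw vr; rewrite in_setC nr (negPf vb').
Qed.

(** An edge is attributed to its endpoint farther from rho. The orientation by
    rank on the left is unrelated to rho, whence the symmetry of F. *)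
Lemma sum_edges_parent (M : zmodType) (F : V -> V -> M) :
  (forall v w, F v w = F w v) ->
  \sum_(p : V * V | orb_adj e p.1 p.2 && (enum_rank p.1 < enum_rank p.2)%N) F p.1 p.2 =
  \sum_(v in nodes e :\ rho) F v (parent v).
Proof.
move=> Fsym; pose lt (p : V * V) := (enum_rank p.1 < enum_rank p.2)%N.
rewrite (bigID (fun p : V * V => up p.1 p.2)) /=.
rewrite [X in _ + X](_ : _ = \sum_(p : V * V | up p.1 p.2 && ~~ lt p) F p.1 p.2); last first.
  rewrite (reindex_inj (h := fun p : V * V => (p.2, p.1))) /=; last by move=> [? ?] [? ?]
    [-> ->].
  apply: eq_big => [[v w]|[v w] _] /=; last exact: Fsym.
  rewrite orb_adj_sym /lt /=; have [vw|nvw] := boolP (orb_adj e v w); last first.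
    by rewrite /up (negPf nvw).
  rewrite (up_asym vw) negbK /=.
  case: (ltngtP (enum_rank v) (enum_rank w)) => [||/ord_inj/enum_rank_inj ewv]; rewrite
    ?andbT ?andbF //.
  by have := orb_adj_neq vw; rewrite ewv eqxx.
rewrite [X in X + _](_ : _ = \sum_(p : V * V | up p.1 p.2 && lt p) F p.1 p.2); last first.
  apply: eq_bigl => [[v w]] /=; rewrite /up /lt /=.
  by case: (orb_adj e v w); rewrite //= andbC.
rewrite -(bigID lt (fun p : V * V => up p.1 p.2)) /=.
rewrite -(pair_big_dep xpredT (fun v w => up v w) (fun v w => F v w)) /=.
rewrite big_mkcond [RHS]big_mkcond; apply: eq_bigr => v _.
have [|nv] := boolP (v \in nodes e :\ rho).
  rewrite in_setD1 => /andP[vr vN]; have uv := parentP vN vr; rewrite (big_pred1 (parent v))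
    // => w /=.
  by apply/idP/eqP => [/up_parent|->].
rewrite big_pred0 // => w; apply/negP => uvw; case/negP: nv; rewrite in_setD1.
by rewrite (up_neq_rho uvw); case/andP: uvw => /and3P[].
Qed.

End Tree.

(** * The intersection form and its maximum principle *)

Lemma common_denom (s : seq rat) : exists2 k : nat, (0 < k)%N &
  {in s, forall q, q * k%:R \is a Num.int}.
Proof.
elim: s => [|q s [k k0 ks]]; first by exists 1%N.
exists (k * `|denq q|)%N; first by rewrite muln_gt0 k0 absz_gt0 denq_neq0.
move=> q'; rewrite inE => /predU1P[->|/ks q'k]; rewrite natrM.
  rewrite mulrCA rpredM ?rpred_nat //.
  rewrite -[q in q * _]divq_num_den natr_absz gtr0_norm ?denq_gt0 //.
  by rewrite divfK ?rpred_int // intr_eq0 denq_neq0.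
by rewrite mulrA rpredM // rpred_nat.
Qed.

Section Form.
Import mathcomp.boot.fintype mathcomp.boot.finset.
Variables (V : finType) (e : rel V) (b : V -> int).
Hypothesis e_tree : is_tree e.
Hypothesis b_neg : negative_definite e b.
Implicit Types (x y z l : expo V) (u v w t m : V).

Let e_sym : symmetric e. Proof. by case: e_tree. Qed.
Let e_irr : irreflexive e. Proof. by case: e_tree. Qed.

Local Notation form := (Defs.form e b).

(** The intersection number (x, E_t). *)
Definition ev x t : rat := (b t)%:~R * x t + \sum_(w | e t w) x w.

Lemma formE x y : form x y = \sum_t y t * ev x t.
Proof.
rewrite /Defs.form exchange_big; apply: eq_bigr => t _ /=.
rewrite /ev mulrDr (bigD1 t) //= eqxx; congr (_ + _); first by ring.
rewrite mulr_sumr [RHS]big_mkcond [RHS](bigD1 t) //= e_irr add0r; apply: eq_bigr => w weight.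
by rewrite (negPf weight) e_sym; case: (e t w); rewrite ?mulr1 ?mulr0 // mulrC.
Qed.

Lemma form_axis x t : form x (axis t 1) = ev x t.
Proof.
rewrite formE (bigD1 t) //= ffunE eqxx mul1r big1 ?addr0 // => w weight.
by rewrite ffunE (negPf weight) mul0r.
Qed.

Lemma formC x y : form x y = form y x.
Proof.
rewrite /Defs.form exchange_big; apply: eq_bigr => v _; apply: eq_bigr => w _ /=.
by rewrite e_sym [w == v]eq_sym [y v * _]mulrC; case: eqP => [->|].
Qed.

Lemma evD x y t : ev (x + y) t = ev x t + ev y t.
Proof.
rewrite /ev ffunE (eq_bigr (fun w => x w + y w)) => [|w _]; last by rewrite ffunE.
by rewrite big_split /=; ring.
Qed.

Lemma evN x t : ev (- x) t = - ev x t.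
Proof.
rewrite /ev ffunE (eq_bigr (fun w => - x w)) => [|w _]; last by rewrite ffunE.
by rewrite sumrN; ring.
Qed.

Lemma ev0 t : ev 0 t = 0.
Proof. by rewrite /ev ffunE big1 => [|w _]; rewrite ?ffunE // mulr0 addr0. Qed.

Lemma form_neg x : x != 0 -> form x x < 0.
Proof.
move=> x0; have [k k0 ks] := common_denom [seq x v | v <- enum V].
pose y : expo V := [ffun v => x v * k%:R].
have yL : y \in @int_lattice V.
  apply/forallP => v; rewrite ffunE; apply: ks.
  by apply/mapP; exists v; rewrite ?mem_enum.
have kr : (k%:R : rat) != 0 by rewrite pnatr_eq0 -lt0n.
have y0 : y != 0.
  apply: contraNneq x0 => y0; apply/eqP/ffunP => v.
  have := congr1 (fun f : expo V => f v) y0; rewrite !ffunE => /eqP.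
  by rewrite mulf_eq0 (negPf kr) orbF => /eqP.
have := b_neg yL y0; rewrite (_ : form y y = form x x * (k%:R * k%:R)).
  by rewrite pmulr_llt0 // mulr_gt0 // ltr0n.
rewrite /Defs.form mulr_suml; apply: eq_bigr => v _; rewrite mulr_suml; apply: eq_bigr => w _.
by rewrite !ffunE; ring.
Qed.

Lemma form_eq0 x : 0 <= form x x -> x = 0.
Proof. by move=> h; apply/eqP; apply: contraLR h => /form_neg; rewrite ltNge. Qed.

(** Write z as the difference of its positive part and its negative part z'.
    Then (z, z') is at most 0 by the hypotheses, while the positive part and
    z' have disjoint supports, hence a nonnegative product. So (z', z') is
    nonnegative and z' = 0. *)
Lemma max_principle (I : {set V}) z : (forall t, t \in I -> 0 <= z t) ->
  (forall t, t \notin I -> ev z t <= 0) -> forall t, 0 <= z t.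
Proof.
move=> zI zC; pose zm : expo V := [ffun t => Num.max 0 (- z t)].
have zm0 t : 0 <= zm t by rewrite ffunE le_max lexx.
have zp0 t : 0 <= (z + zm) t.
  by rewrite !ffunE; have [] := leP 0 (- z t); rewrite ?subrr ?addr0 //; lra.
have zpm t : zm t * (z + zm) t = 0.
  by rewrite !ffunE; have [] := leP 0 (- z t); rewrite ?subrr ?mulr0 ?mul0r.
have h1 : form z zm <= 0.
  rewrite formE; apply: sumr_le0 => t _.
  have [tI|tI] := boolP (t \in I); last exact: mulr_ge0_le0 (zm0 t) (zC t tI).
  by rewrite ffunE; have := zI t tI; have [] := leP 0 (- z t) => ? ?; rewrite ?mul0r // (_ :
    z t = 0) ?oppr0 ?mul0r //; lra.
have h2 : 0 <= form (z + zm) zm.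
  rewrite formE; apply: sumr_ge0 => t _; rewrite /ev mulrDr mulrCA zpm mulr0 add0r.
  by rewrite mulr_ge0 // sumr_ge0.
have h3 : form (z + zm) zm = form z zm + form zm zm.
  by rewrite !formE -big_split; apply: eq_bigr => t _; rewrite evD mulrDr.
have /form_eq0 zm_eq0 : 0 <= form zm zm by lra.
move=> t; have := congr1 (fun f : expo V => f t) zm_eq0; rewrite !ffunE.
by have [] := leP 0 (- z t); lra.
Qed.

Lemma solve_linear (A : V -> V -> rat) :
  (forall x, (forall t, \sum_w x w * A w t = 0) -> x = 0) ->
  forall y, exists x, forall t, \sum_w x w * A w t = y t.
Proof.
move=> inj y; pose M : 'M[rat]_#|V| := \matrix_(i, j) A (enum_val i) (enum_val j).
have ME (u : 'rV[rat]_#|V|) j :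
    (u *m M) 0 j = \sum_w ([ffun w => u 0 (enum_rank w)] : expo V) w * A w (enum_val j).
  rewrite !mxE [RHS](reindex _ (onW_bij _ (enum_val_bij V))) /=.
  by apply: eq_bigr => i _; rewrite !mxE ffunE enum_valK.
have Mu : M \in unitmx.
  rewrite -row_free_unit -kermx_eq0; apply/rowV0P => u /sub_kermxP uM.
  have x0 : [ffun w => u 0 (enum_rank w)] = 0 :> expo V.
    by apply: inj => t; rewrite -[t]enum_rankK -ME uM mxE.
  apply/rowP => j; have := congr1 (fun f : expo V => f (enum_val j)) x0.
  by rewrite !ffunE enum_valK mxE.
pose u := (\row_j y (enum_val j)) *m invmx M.
exists [ffun w => u 0 (enum_rank w)] => t; rewrite -[t]enum_rankK -ME.
by rewrite mulmxKV // mxE.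
Qed.

(** The Green function of the subgraph spanned by F. The linear system
    defining it is regular, as the form is definite on the vectors supported
    in F. *)
Lemma green_exists (F : {set V}) m : exists g : expo V,
  (forall t, t \notin F -> g t = 0) /\ forall t, t \in F -> ev g t = - (m == t)%:R.
Proof.
pose A w t : rat := if t \in F then (if w == t then (b t)%:~R else (e t w)%:R) else (w ==
  t)%:R.
have AE x t : \sum_w x w * A w t = if t \in F then ev x t else x t.
  rewrite /A (bigD1 t) //= eqxx; case: ifP => tF.
    rewrite /ev mulrC; congr (_ + _); rewrite [RHS]big_mkcond [RHS](bigD1 t) //= e_irr add0r.
    apply: eq_bigr => w weight; rewrite (negPf weight).
    by case: (e t w); rewrite ?mulr1 ?mulr0.
  by rewrite mulr1 big1 ?addr0 // => w weight; rewrite (negPf weight) mulr0.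
have [|g Hg] := @solve_linear A _ [ffun t => if t \in F then - (m == t)%:R else 0].
  move=> x Hx; apply: form_eq0; rewrite formE big1 // => t _.
  have := Hx t; rewrite AE; case: ifP => _ ->; first by rewrite mulr0.
  by rewrite mul0r.
by exists g; split=> t tF; have := Hg t; rewrite AE ffunE ?tF ?(negPf tF).
Qed.

Local Notation Ed := (dual_vec e b).

Lemma ev_dual v w : ev (Ed v) w = - (v == w)%:R.
Proof.
have [g [_ gE]] := green_exists [set: V] v.
rewrite -form_axis /dual_vec; case: xgetP => [x _ /= ->//|/(_ g)[]] /= t.
by rewrite form_axis gE // inE.
Qed.

Lemma expo_dualE x w : x w = - \sum_t ev x t * Ed w t.
Proof.
have h1 : form x (Ed w) = \sum_t ev x t * Ed w t.
  by rewrite formE; apply: eq_bigr => t _; rewrite mulrC.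
have h2 : form (Ed w) x = - x w.
  rewrite formE (bigD1 w) //= ev_dual eqxx mulr1n big1; first by ring.
  by move=> t tw; rewrite ev_dual eq_sym (negPf tw) oppr0 mulr0.
by rewrite -h1 formC h2 opprK.
Qed.

Lemma dualC v w : Ed v w = Ed w v.
Proof.
rewrite [LHS]expo_dualE (bigD1 v) //= ev_dual eqxx mulr1n big1 => [|t tv]; first by ring.
by rewrite ev_dual eq_sym (negPf tv) oppr0 mul0r.
Qed.

Lemma expo_dual x w : x w = - \sum_t ev x t * Ed t w.
Proof. by rewrite expo_dualE; congr (- _); apply: eq_bigr => t _; rewrite dualC. Qed.

Lemma dual_ge0 u v : 0 <= Ed u v.
Proof.
apply: (@max_principle set0) => [t|t _]; first by rewrite inE.
by rewrite ev_dual oppr_le0 ler0n.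
Qed.

Lemma nbr_sum_eq0 z t w : (forall w, 0 <= z w) -> z t = 0 -> ev z t <= 0 -> e t w -> z w = 0.
Proof.
move=> z0 zt; rewrite /ev zt mulr0 add0r => h tw.
have : z w <= \sum_(w | e t w) z w by rewrite (bigD1 w) //= lerDl sumr_ge0.
by have := z0 w; lra.
Qed.

(** A zero of a nonnegative function with nonpositive products with the E_t
    propagates to the neighbours, and so to the whole tree; at u the product
    would then be nonnegative instead of -1. *)
Lemma dual_gt0 u v : 0 < Ed u v.
Proof.
rewrite lt_def dual_ge0 andbT; apply/eqP => uv.
have: Ed u u = 0.
  have [_ _ /(_ v u) + _] := e_tree.
  move=> c; apply: (connect_ind (P := fun t => Ed u t = 0) c) => // t w ut tw.
  apply: nbr_sum_eq0 tw => // [w0|]; first exact: dual_ge0.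
  by rewrite ev_dual oppr_le0 ler0n.
move=> uu; have : 0 <= ev (Ed u) u.
  by rewrite /ev uu mulr0 add0r sumr_ge0 // => w _; apply: dual_ge0.
by rewrite ev_dual eqxx mulr1n; lra.
Qed.

Lemma ev_axis r t : ev (axis r 1) t = if t == r then (b r)%:~R else (e r t)%:R.
Proof.
rewrite /ev ffunE; case: eqP => [->|tr].
  rewrite mulr1 big1 ?addr0 // => w rw; rewrite ffunE.
  by case: eqP => // wr; rewrite wr e_irr in rw.
rewrite mulr0 add0r; have [rt|rt] := boolP (e r t).
  rewrite (bigD1 r) /=; last by rewrite e_sym.
  by rewrite ffunE eqxx big1 ?addr0 // => w /andP[_ wr]; rewrite ffunE (negPf wr).
rewrite big1 // => w tw; rewrite ffunE; case: eqP => // wr.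
by rewrite -wr e_sym tw in rt.
Qed.

Lemma ffun_sumE (I : Type) (s : seq I) (P : pred I) (F : I -> expo V) v :
  (\sum_(i <- s | P i) F i) v = \sum_(i <- s | P i) F i v.
Proof. by apply: (big_morph (fun x : expo V => x v)) => [x y|]; rewrite ffunE. Qed.

Lemma ffun_intE x (k : int) v : (x *~ k) v = x v * k%:~R.
Proof.
case: k => k; first by rewrite -pmulrn ffunMnE mulr_natr.
by rewrite NegzE mulrNz ffunE -pmulrn ffunMnE mulrNz mulrN mulr_natr.
Qed.

Lemma axis_dual r : axis r 1 = - (Ed r *~ b r) - \sum_(w | e r w) Ed w.
Proof.
apply/ffunP => v; rewrite !ffunE ffun_sumE ffun_intE.
have -> : (if v == r then 1 else 0 : rat) = axis r 1 v by rewrite ffunE.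
rewrite [LHS]expo_dual (bigD1 r) //= ev_axis eqxx opprD; congr (_ + _); first by ring.
congr (- _); rewrite [RHS]big_mkcond [RHS](bigD1 r) //= e_irr add0r.
apply: eq_bigr => w wr; rewrite ev_axis (negPf wr).
by case: (e r w); rewrite ?mul1r ?mul0r.
Qed.

(** Up to a positive factor, the coordinate along the projection of E_v^* of
    the projection of l to the span of E_v and E_w, in the basis formed by the
    projections of E_v^* and E_w^*. *)
Definition lam v w l : rat := l v * Ed w w - l w * Ed v w.

Lemma lamD v w x y : lam v w (x + y) = lam v w x + lam v w y.
Proof. by rewrite /lam !ffunE; ring. Qed.

Lemma lam_dual v w u : lam v w (Ed u) = ([ffun t => Ed u t * Ed w w - Ed w t * Ed u w] :
  expo V) v.
Proof. by rewrite ffunE /lam (dualC v w); ring. Qed.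

Lemma ev_lam u w t : ev [ffun t => Ed u t * Ed w w - Ed w t * Ed u w] t =
  - (u == t)%:R * Ed w w + (w == t)%:R * Ed u w.
Proof.
rewrite -[(u == t)%:R]opprK -[(w == t)%:R]opprK -!ev_dual /ev ffunE.
rewrite (eq_bigr (fun s => Ed u s * Ed w w + - Ed w s * Ed u w)) => [|s _]; last first.
  by rewrite ffunE mulNr.
by rewrite big_split /= -!mulr_suml sumrN; ring.
Qed.

(** As a function of v, lam v w (Ed u) vanishes at w and its products with the
    other E_t are nonpositive: the maximum principle applies. *)
Lemma lam_dual_ge0 v w u : 0 <= lam v w (Ed u).
Proof.
rewrite lam_dual; apply: (@max_principle [set w]) => t; rewrite inE.
  by move/eqP->; rewrite ffunE; nra.
by move=> tw; rewrite ev_lam [w == t]eq_sym (negPf tw); have := dual_gt0 w w; case: (u ==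
  t); rewrite ?mulr1n ?mulr0n; lra.
Qed.

Lemma lam_dual_gt0 v w : v != w -> 0 < lam v w (Ed v).
Proof.
move=> vw; rewrite lt_def lam_dual_ge0 andbT lam_dual; apply/eqP.
set z := [ffun t => _] => zv.
have z0 t : 0 <= z t.
  by have := lam_dual_ge0 t w v; rewrite lam_dual.
have : 0 <= ev z v by rewrite /ev zv mulr0 add0r sumr_ge0.
rewrite ev_lam eqxx [w == v]eq_sym (negPf vw) mulr1n mulr0n; have := dual_gt0 w w; lra.
Qed.

(** As a function of v, lam v w (Ed u) vanishes at w, and has product zero
    with E_t for t on the branch at w containing v; by definiteness it
    vanishes on the branch. In other words, u is seen from v through w only. *)
Lemma lam_dual_eq0 v w u : v != w -> u \notin branch e w (toward e w v) -> lam v w (Ed u) = 0.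
Proof.
move=> vw ub; rewrite lam_dual; set z := [ffun t => _].
have [ewv vb] := towardP e_tree vw; set B := branch _ _ _ in ub vb.
pose z' : expo V := [ffun t => if t \in B then z t else 0].
have zw : z w = 0 by rewrite ffunE; ring.
have wB : w \notin B.
  by apply/negP => /(branch_neq (e := e)); rewrite eqxx eq_sym (edge_neq e_tree ewv) => /(_
    isT).
suff z'0 : z' = 0.
  by have := congr1 (fun f : expo V => f v) z'0; rewrite ffunE vb [RHS]ffunE.
apply: form_eq0; rewrite formE big1 // => t _; rewrite {1}ffunE.
case: ifP => tB; last by rewrite mul0r.
have -> : ev z' t = ev z t.
  rewrite /ev ffunE tB; congr (_ + _); apply: eq_bigr => s ts; rewrite ffunE.
  case: ifP => // sB; have [->|sw] := eqVneq s w; first by rewrite zw.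
  have tw : t != w by apply: contraTneq tB => ->; rewrite (negPf wB).
  by rewrite (branch_edge tB tw sw ts) in sB.
rewrite ev_lam; have -> : (u == t) = false by apply/eqP => ut; rewrite ut tB in ub.
have -> : (w == t) = false by apply/eqP => weight; rewrite -weight (negPf wB) in tB.
by rewrite mulr0n oppr0 !mul0r addr0 mulr0.
Qed.

(** A weighted mean value property: the value at m in F is controlled by the
    values of (x, E_t) in F and by the values of x on the boundary of F. It is
    obtained by pairing x with the Green function of F at m. *)
Lemma mean_value (F : {set V}) m : m \in F -> exists g p : expo V,
  [/\ forall t, 0 <= g t, 0 < g m, forall t, 0 <= p t,
      forall t, t \notin F -> (forall t', t' \in F -> ~~ e t' t) -> p t = 0 &
      forall x, x m = \sum_(t in F) - ev x t * g t + \sum_(t | t \notin F) x t * p t].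
Proof.
move=> mF; have [g [gF gE]] := green_exists F m.
have g0 : forall t, 0 <= g t.
  apply: (@max_principle (~: F)) => t; rewrite inE; first by move=> tF; rewrite gF.
  by rewrite negbK => /gE ->; rewrite oppr_le0 ler0n.
pose p : expo V := [ffun t => if t \in F then 0 else ev g t].
exists g, p; split=> //.
- rewrite lt_def g0 andbT; apply/eqP => gm.
  have : 0 <= ev g m by rewrite /ev gm mulr0 add0r sumr_ge0.
  by rewrite gE // eqxx mulr1n; lra.
- move=> t; rewrite ffunE; case: ifP => // tF.
  by rewrite /ev gF ?tF // mulr0 add0r sumr_ge0.
- move=> t tF tn; rewrite ffunE (negPf tF) /ev gF // mulr0 add0r big1 // => w tw.
  apply: gF; apply/negP => /tn; by rewrite e_sym tw.
- move=> x; have := formC g x; rewrite !formE (bigID (mem F)) /= => h.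
  have e1 : \sum_(i in F) x i * ev g i = - x m.
    rewrite (bigD1 m) //= gE // eqxx mulr1n big1 ?addr0; first by ring.
    by move=> t /andP[tF tm]; rewrite gE // eq_sym (negPf tm) oppr0 mulr0.
  have e2 : \sum_t g t * ev x t = \sum_(t in F) g t * ev x t.
    rewrite [RHS]big_mkcond; apply: eq_bigr => t _; case: ifP => // tF.
    by rewrite gF ?tF // mul0r.
  rewrite e1 e2 in h.
  have -> : \sum_(t in F) - ev x t * g t = - \sum_(t in F) g t * ev x t.
    by rewrite -sumrN; apply: eq_bigr => t _; ring.
  have -> : \sum_(t | t \notin F) x t * p t = \sum_(t | t \notin F) x t * ev g t.
    by apply: eq_bigr => t tF; rewrite ffunE (negPf tF).
  lra.
Qed.

End Form.

(** * The discriminant group *)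

Section Discriminant.
Variables (V : finType) (e : rel V) (b : V -> int).
Hypothesis e_tree : is_tree e.
Hypothesis b_neg : negative_definite e b.
Implicit Types (x y z l : expo V) (u v w t m : V).

Local Notation Ed := (dual_vec e b).

Lemma clsE x y : (cls x == cls y) = (x - y \in @int_lattice V).
Proof. by rewrite /cls Quotient.idealrBE. Qed.

Lemma clsD x y : cls (x + y) = cls x + cls y.
Proof. by rewrite /cls raddfD. Qed.

Lemma clsN x : cls (- x) = - cls x.
Proof. by rewrite /cls raddfN. Qed.

Lemma cls0 : cls (0 : expo V) = 0.
Proof. by rewrite /cls raddf0. Qed.

Lemma cls_eq0 x : x \in @int_lattice V -> cls x = 0.
Proof. by move=> xL; apply/eqP; rewrite -cls0 clsE subr0. Qed.

Lemma cls_lattice x y : y \in @int_lattice V -> cls (x + y) = cls x.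
Proof. by move=> yL; rewrite clsD (cls_eq0 yL) addr0. Qed.

Lemma axis_lattice v : axis v 1 \in @int_lattice V.
Proof. by apply/forallP => w; rewrite ffunE; case: ifP; rewrite ?rpred0 ?rpred1. Qed.

Lemma dual_latticeP x : dual_lattice e b x <-> forall t, ev e b x t \is a Num.int.
Proof.
split=> [xd t|xev y /forallP yL]; first by rewrite -form_axis // xd // axis_lattice.
by rewrite formE //; apply: rpred_sum => t _; apply: rpredM.
Qed.

Lemma dual_latticeD x y : dual_lattice e b x -> dual_lattice e b y -> dual_lattice e b (x + y).
Proof. by rewrite !dual_latticeP => dx dy t; rewrite evD rpredD. Qed.

Lemma dual_latticeN x : dual_lattice e b x -> dual_lattice e b (- x).
Proof. by rewrite !dual_latticeP => dx t; rewrite evN rpredN. Qed.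

Lemma dual_lattice0 : dual_lattice e b 0.
Proof. by rewrite dual_latticeP => t; rewrite ev0 rpred0. Qed.

Lemma dual_lattice_mul x k : dual_lattice e b x -> dual_lattice e b (x *+ k).
Proof.
move=> dx; elim: k => [|k IH]; first by rewrite mulr0n; apply: dual_lattice0.
by rewrite mulrS; apply: dual_latticeD.
Qed.

Lemma dual_vec_lattice v : dual_lattice e b (Ed v).
Proof. by rewrite dual_latticeP => t; rewrite ev_dual // rpredN rpred_nat. Qed.

Lemma dual_denom : exists2 D : nat, (0 < D)%N &
  forall x, dual_lattice e b x -> forall w, x w * D%:R \is a Num.int.
Proof.
have [D D0 HD] := common_denom [seq Ed p.1 p.2 | p <- enum {: V * V}].
exists D => // x /dual_latticeP xd w; rewrite (expo_dual e_tree b_neg x) mulNr rpredN.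
rewrite mulr_suml rpred_sum // => t _; rewrite -mulrA rpredM //.
by apply: HD; apply/mapP; exists (t, w); rewrite ?mem_enum.
Qed.

(** The elements of L' are combinations of the E_t^*, whose coefficients only
    matter modulo a common denominator of their coordinates. *)
Lemma disc_group_finite : finite_set (disc_group e b).
Proof.
have [D D0 HD] := dual_denom.
have DL t (k : int) : Ed t *~ (k * D%:Z) \in @int_lattice V.
  apply/forallP => w; rewrite ffun_intE intrM [k%:~R * _]mulrC mulrA.
  by rewrite rpredM ?rpred_int // -pmulrn HD //; apply: dual_vec_lattice.
apply: (@sub_finite_set _ _ ((fun f : {ffun V -> 'I_D} => cls (\sum_t Ed t *+ f t)) @`
  setT)%classic);
  last by apply: finite_image; apply: finite_finset.
move=> _ [x /dual_latticeP xd <-].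
pose k t := - Num.floor (ev e b x t).
have xE : x = \sum_t Ed t *~ k t.
  apply/ffunP => w; rewrite ffun_sumE (expo_dual e_tree b_neg x) -sumrN.
  apply: eq_bigr => t _; rewrite ffun_intE /k rmorphN /= floorK ?xd //.
  by rewrite mulrN mulrC.
have Dz : (0 < D%:Z)%R by rewrite ltz_nat.
have rlt t : (`|(k t %% D%:Z)%Z| < D)%N.
  by rewrite -ltz_nat gez0_abs ?modz_ge0 ?ltz_pmod // gt_eqF.
exists [ffun t => Ordinal (rlt t)] => //.
apply/eqP; rewrite clsE xE -sumrB; apply: rpred_sum => t _; rewrite ffunE /=.
have -> : Ed t *+ `|(k t %% D%:Z)%Z| = Ed t *~ (k t %% D%:Z)%Z.
  by rewrite -[in RHS](gez0_abs (modz_ge0 (k t) _)) -?pmulrn // gt_eqF.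
rewrite -mulrzBr {2}(divz_eq (k t) D) opprD addrCA subrr addr0 mulrNz rpredN.
exact: DL.
Qed.

Lemma disc_groupD (g g' : rat_quot V) :
  disc_group e b g -> disc_group e b g' -> disc_group e b (g + g').
Proof.
move=> [x' dx <-] [y' dy <-]; exists (x' + y'); first exact: dual_latticeD.
exact: clsD.
Qed.

Lemma disc_groupN (g : rat_quot V) : disc_group e b g -> disc_group e b (- g).
Proof.
move=> [x' dx <-]; exists (- x'); first exact: dual_latticeN.
exact: clsN.
Qed.

Lemma disc_order_gt0 : (0 < disc_order e b)%N.
Proof.
rewrite /disc_order cardfs_gt0; apply/fset0Pn; exists 0.
rewrite in_fset_set ?inE; last exact: disc_group_finite.
by exists 0; [exact: dual_lattice0 | exact: cls0].
Qed.

(** The sum of all the elements of the group is invariant under translation by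
    g. *)
Lemma disc_order_mul g : disc_group e b g -> g *+ disc_order e b = 0.
Proof.
move=> gH; have fin := disc_group_finite.
have h : \sum_(s \in disc_group e b) s = \sum_(s \in disc_group e b) (s + g).
  apply: (reindex_fsbig (fun s => s + g) (disc_group e b)).
  split=> [s sH|s s' _ _ /addIr //|s sH]; first exact: disc_groupD.
  exists (s - g); last exact: subrK.
  by apply: disc_groupD => //; apply: disc_groupN.
have : \sum_(s \in disc_group e b) g = 0.
  apply: (addrI (\sum_(s \in disc_group e b) s)).
  by rewrite addr0 -fsbig_split // -h.
by rewrite fsbig_finite //= big_const_seq count_predT iter_addr_0.
Qed.

Lemma dual_order_lattice v : Ed v *+ disc_order e b \in @int_lattice V.
Proof.
rewrite -[_ *+ _]subr0 -clsE cls0.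
have -> : cls (Ed v *+ disc_order e b) = cls (Ed v) *+ disc_order e b.
  by elim: (disc_order e b) => [|k IH]; rewrite ?mulr0n ?cls0 // !mulrS clsD IH.
rewrite disc_order_mul //; exists (Ed v) => //; exact: dual_vec_lattice.
Qed.

End Discriminant.

(** * The coefficients of the zeta function *)

Lemma galg_mult (R : comNzRingType) (G : zmodType) (A : comNzRingType)
    (phi : galg R G -> A) :
  phi 0 = 0 -> (forall a b, phi (a + b) = phi a + phi b) ->
  (forall r x s y, phi (gmon r x * gmon s y) = phi (gmon r x) * phi (gmon s y)) ->
  forall a b, phi (a * b) = phi a * phi b.
Proof.
move=> phi0 phiD phiU a b; elim/galg_ind: a => [|a a' IH IH'|r x].
- by rewrite mul0r phi0 mul0r.
- by rewrite mulrDl !phiD IH IH' mulrDl.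
elim/galg_ind: b => [|b b' IH IH'|s y]; last exact: phiU.
- by rewrite mulr0 phi0 mulr0.
- by rewrite mulrDr !phiD IH IH' mulrDr.
Qed.

Lemma gcoef_gmon0 (R : comNzRingType) (G : zmodType) (a : galg R G) r x :
  gcoef (a * gmon r 0) x = gcoef a x * r.
Proof.
elim/galg_ind: a => [|a a' IH IH'|s y]; first by rewrite mul0r gcoef0 mul0r.
  by rewrite mulrDl !gcoefD IH IH' mulrDl.
by rewrite gmulUU' !gcoef_gmon addr0; case: eqP; rewrite ?mul0r.
Qed.

Section Zeta.
Variables (V : finType) (e : rel V) (b : V -> int).
Hypothesis e_tree : is_tree e.
Hypothesis b_neg : negative_definite e b.
Hypothesis nodes0 : nodes e != finset.set0.
Implicit Types (x y z l : expo V) (u v w t m : V) (a d : lpoly V).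

Local Notation Ed := (dual_vec e b).
Local Notation H := (disc_order e b).
Local Notation N := (nodes e).

Lemma mon0 : mon (0 : expo V) = 1.
Proof. by []. Qed.

Lemma monD x y : mon (x + y) = mon x * mon y.
Proof. by rewrite /mon gmulUU' mulr1. Qed.

Lemma monX x k : mon (x *+ k) = mon x ^+ k.
Proof. by elim: k => [|k IH]; rewrite ?mulr0n ?expr0 ?mon0 // mulrS exprS monD IH. Qed.

Definition emb_term (r : int) x : galg (ratfun V) (rat_quot V) :=
  gmon ((gmon r x)%:F : ratfun V) (cls x).

(** The embedding of the Laurent polynomials in the group algebra of L'/L that
    remembers the classes of the exponents. *)
Definition emb a : galg (ratfun V) (rat_quot V) :=
  \sum_(x <- gsupp a) emb_term (gcoef a x) x.

Lemma emb_term0 x : emb_term 0 x = 0.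
Proof. by rewrite /emb_term gmon0 tofrac0 gmon0. Qed.

Lemma embU r x : emb (gmon r x) = emb_term r x.
Proof. by apply: gsum_mon => y; apply: emb_term0. Qed.

Lemma embD a a' : emb (a + a') = emb a + emb a'.
Proof.
apply: gsum_add => [x|r s x]; first exact: emb_term0.
by rewrite /emb_term gmonD tofracD gmonD.
Qed.

Lemma emb0 : emb 0 = 0.
Proof. by rewrite /emb /gsupp msupp0 big_seq_fset0. Qed.

Lemma embM a a' : emb (a * a') = emb a * emb a'.
Proof.
apply: (galg_mult emb0 embD) => r x s y.
by rewrite gmulUU' !embU /emb_term gmulUU' -tofracM gmulUU' clsD.
Qed.

Lemma emb1 : emb 1 = 1.
Proof. by rewrite -[1 in LHS]/(gmon 1 0) embU /emb_term cls0 tofrac1. Qed.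

Lemma embX a k : emb (a ^+ k) = emb a ^+ k.
Proof. by elim: k => [|k IH]; rewrite ?expr0 ?emb1 // !exprS embM IH. Qed.

Lemma embN a : emb (- a) = - emb a.
Proof. by apply: (addrI (emb a)); rewrite -embD !subrr emb0. Qed.

Lemma emb_prod (I : Type) (s : seq I) (P : pred I) (F : I -> lpoly V) :
  emb (\prod_(i <- s | P i) F i) = \prod_(i <- s | P i) emb (F i).
Proof. by apply: big_morph; [exact: embM | exact: emb1]. Qed.

Definition cst (k : ratfun V) : galg (ratfun V) (rat_quot V) := gmon k 0.

Lemma cst1 : cst 1 = 1. Proof. by []. Qed.

Lemma cstM (k k' : ratfun V) : cst (k * k') = cst k * cst k'.
Proof. by rewrite /cst gmulUU' addr0. Qed.

Lemma emb_lattice n : n \in @int_lattice V -> emb (1 - mon n) = cst (1 - mon n)%:F.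
Proof.
move=> nL; rewrite embD embN emb1 -[mon n]/(gmon 1 n) embU /emb_term (cls_eq0 nL).
by rewrite tofracB tofrac1 /cst /gmon monalgUB.
Qed.

Definition part_term (h : rat_quot V) (r : int) x : lpoly V :=
  if cls x == h then gmon r x else 0.

Definition part (h : rat_quot V) a : lpoly V :=
  \sum_(x <- gsupp a) part_term h (gcoef a x) x.

Lemma part_term0 h x : part_term h 0 x = 0.
Proof. by rewrite /part_term gmon0; case: eqP. Qed.

Lemma partU h r x : part h (gmon r x) = part_term h r x.
Proof. by apply: gsum_mon => y; apply: part_term0. Qed.

Lemma partD h a a' : part h (a + a') = part h a + part h a'.
Proof.
apply: gsum_add => [x|r s x]; first exact: part_term0.
by rewrite /part_term gmonD; case: eqP; rewrite ?addr0.
Qed.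

Lemma part0 h : part h 0 = 0.
Proof. by rewrite /part /gsupp msupp0 big_seq_fset0. Qed.

Lemma gcoef_part h a y : gcoef (part h a) y = if cls y == h then gcoef a y else 0.
Proof.
elim/galg_ind: a => [|a a' IH IH'|r x]; first by rewrite part0 gcoef0; case: ifP.
  by rewrite partD !gcoefD IH IH'; case: ifP; rewrite ?addr0.
rewrite partU /part_term [in RHS]gcoef_gmon; have [<-|xy] := eqVneq x y.
  by case: ifP => _; rewrite ?gcoef0 // gcoef_gmon eqxx.
by rewrite mulr0n if_same; case: ifP => _; rewrite ?gcoef0 // gcoef_gmon (negPf xy).
Qed.

Lemma gcoef_emb a h : gcoef (emb a) h = (part h a)%:F.
Proof.
elim/galg_ind: a => [|a a' IH IH'|r x]; first by rewrite emb0 part0 gcoef0 tofrac0.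
  rewrite embD partD tofracD -IH -IH'; exact: gcoefD.
rewrite embU partU /emb_term /part_term gcoef_gmon.
by case: eqP; rewrite ?mulr0n ?tofrac0.
Qed.

Lemma gcoef_cst (g : galg (ratfun V) (rat_quot V)) k h : gcoef (g * cst k) h = gcoef g h * k.
Proof. exact: gcoef_gmon0. Qed.

Definition dual_binomial v : lpoly V := 1 - mon (Ed v).

Definition order_dual v : expo V := Ed v *+ H.

(** The cofactor that turns the denominator of an end into an element with
    trivial class. *)
Definition geom_sum v : lpoly V := \sum_(i < H) mon (Ed v *+ i).

Lemma dual_binomial_geom_sum v : dual_binomial v * geom_sum v = 1 - mon (order_dual v).
Proof.
rewrite /dual_binomial /geom_sum /order_dual monX -[RHS]opprB subrX1 -mulNr opprB; congr (_
  * _).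
by apply: eq_bigr => i _; rewrite monX.
Qed.

Lemma order_dual_gt0 u v : 0 < order_dual u v.
Proof. by rewrite ffunMnE mulrn_wgt0 ?disc_order_gt0 // dual_gt0. Qed.

Lemma order_dual_pos u : posN N (order_dual u).
Proof. by move=> v _; apply: order_dual_gt0. Qed.

Lemma dual_pos u : posN N (Ed u).
Proof. by move=> v _; apply: dual_gt0. Qed.

Definition weight v : int := (valency e v)%:Z - 2.

Definition numer v : lpoly V := if v \in ends e then geom_sum v else dual_binomial v ^+
  (valency e v - 2).

Definition numer_full : lpoly V := \prod_v numer v.

Definition denom_full : lpoly V := \prod_(u in ends e) (1 - mon (order_dual u)).

Lemma valency_gt0 v : (0 < valency e v)%N.
Proof.
have [m mN] := finset.set0Pn _ nodes0.
have [->|vm] := eqVneq v m; first by move: mN; rewrite inE; apply: leq_trans.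
have mv : m != v by rewrite eq_sym.
have [ev _] := towardP e_tree mv.
by rewrite /valency card_gt0; apply/finset.set0Pn; exists (toward e v m); rewrite inE.
Qed.

Lemma weight_end v : v \in ends e -> weight v = -1.
Proof. by rewrite inE /weight => /eqP ->. Qed.

Lemma weight_other v : v \notin ends e -> weight v = (valency e v - 2)%N.
Proof.
rewrite inE /weight => v1; rewrite subzn //.
by have := valency_gt0 v; case: (valency e v) v1 => [|[|]].
Qed.

Lemma denom_full_neq0 : denom_full != 0.
Proof. by apply/prodf_neq0 => u _; apply: (one_mon_neq0 nodes0) (order_dual_pos u). Qed.

Lemma dual_binomial_neq0 v : dual_binomial v != 0.
Proof. by apply: (one_mon_neq0 nodes0) (dual_pos v). Qed.

(** The denominator 1 - t^{n} with n = |H| E_u^* has trivial class, as n lies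
    in L, so it can be divided by in the coefficient ring. It is reached by
    multiplying the factor of an end u by a finite geometric sum. *)
Lemma zetaE : zeta e b = emb numer_full * cst (denom_full%:F)^-1.
Proof.
have -> : (denom_full%:F)^-1 = \prod_v (if v \in ends e then ((1 - mon (order_dual v))%:F :
  ratfun V)^-1 else 1).
  rewrite -big_mkcond /denom_full rmorph_prod /= -prodfV.
  by apply: eq_bigr => u _.
have -> : cst (\prod_v (if v \in ends e then ((1 - mon (order_dual v))%:F : ratfun V)^-1
  else 1)) =
   \prod_v cst (if v \in ends e then ((1 - mon (order_dual v))%:F)^-1 else 1).
  by apply: (big_morph cst); [exact: cstM | exact: cst1].
rewrite /numer_full emb_prod -big_split; apply: eq_bigr => v _ /=.
have -> : 1 - gmon ((mon (Ed v))%:F : ratfun V) (cls (Ed v)) = emb (dual_binomial v).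
  by rewrite embD embN emb1 -[mon (Ed v)]/(gmon 1 _) embU.
rewrite -/(weight v) /numer; case: ifP => vE.
  rewrite weight_end // exprN1.
  have n0 : (1 - mon (order_dual v))%:F != 0 :> ratfun V.
    by rewrite tofrac_neq0; apply: (one_mon_neq0 nodes0) (order_dual_pos v).
  have h : emb (dual_binomial v) * (emb (geom_sum v) * cst ((1 - mon (order_dual v))%:F)^-1)
    = 1.
    rewrite mulrA -embM dual_binomial_geom_sum emb_lattice; last exact: dual_order_lattice.
    by rewrite -cstM divff // cst1.
  by rewrite (mulr1_eq h).
by rewrite weight_other ?vE // cst1 mulr1 embX.
Qed.

Lemma f_fullE h : f_full e b h = (part h numer_full)%:F / denom_full%:F.
Proof. by rewrite /f_full zetaE gcoef_cst gcoef_emb. Qed.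

(** The sum of the f_h, in which the classes are forgotten; the classes of the
    exponents recover each f_h. *)
Definition zeta_sum : ratfun V := \prod_v ((dual_binomial v)%:F : ratfun V) ^ weight v.

Lemma zeta_sumE : zeta_sum = numer_full%:F / denom_full%:F.
Proof.
rewrite /numer_full /denom_full !rmorph_prod /= -prodfV [X in _ * X]big_mkcond -big_split.
apply: eq_bigr => v _ /=; rewrite /numer; case: ifP => vE.
  rewrite weight_end // exprN1 -dual_binomial_geom_sum tofracM invfM mulrCA mulfV ?mulr1 //.
  rewrite tofrac_neq0; apply: contraTneq (one_mon_neq0 nodes0 (order_dual_pos v)) => t0.
  by rewrite -dual_binomial_geom_sum t0 mulr0 eqxx.
by rewrite weight_other ?vE // mulr1 tofracXn.
Qed.

(** ** Setting the variables outside the nodes equal to 1 *)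

Local Notation pj := (proj N).

Lemma projD x y : pj (x + y) = pj x + pj y.
Proof. by apply/ffunP => v; rewrite !ffunE; case: ifP; rewrite ?addr0. Qed.

Lemma projE x v : v \in N -> pj x v = x v.
Proof. by move=> vN; rewrite ffunE vN. Qed.

Local Notation rp := (restrict_poly e).

Lemma restrict_polyU r x : rp (gmon r x) = gmon r (pj x).
Proof. by apply: (gsum_mon _ _ (F := fun r x => gmon r (pj x))) => y; rewrite gmon0. Qed.

Lemma restrict_polyD a a' : rp (a + a') = rp a + rp a'.
Proof.
apply: (gsum_add (F := fun r x => gmon r (pj x))) => [x|r s x]; first by rewrite gmon0.
by rewrite gmonD.
Qed.

Lemma restrict_poly0 : rp 0 = 0.
Proof. by rewrite /restrict_poly /gsupp msupp0 big_seq_fset0. Qed.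

Lemma restrict_polyM a a' : rp (a * a') = rp a * rp a'.
Proof.
apply: (galg_mult restrict_poly0 restrict_polyD) => r x s y.
by rewrite gmulUU' !restrict_polyU gmulUU' projD.
Qed.

Lemma restrict_poly1 : rp 1 = 1.
Proof.
rewrite -[1 in LHS]/(gmon 1 0) restrict_polyU; have -> : pj 0 = 0 by apply/ffunP => v;
  rewrite !ffunE if_same.
by [].
Qed.

Lemma restrict_polyN a : rp (- a) = - rp a.
Proof. by apply: (addrI (rp a)); rewrite -restrict_polyD !subrr restrict_poly0. Qed.

Lemma gsupp_restrict_poly a l : l \in gsupp (rp a) -> exists2 z, z \in gsupp a & l = pj z.
Proof.
rewrite /restrict_poly big_seq => /gsupp_sum[z za /gsupp_gmon ->].
by exists z.
Qed.

(** Setting variables to 1 is multiplicative, hence compatible with equality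
    of fractions. *)
Lemma restrictE a d : rp d != 0 -> Defs.restrict e (a%:F / d%:F) = (rp a)%:F / (rp d)%:F.
Proof.
move=> d0; have dn0 (c : lpoly V) : rp c != 0 -> c != 0 by apply: contraNneq => ->; rewrite
  restrict_poly0.
rewrite /Defs.restrict; case: xgetP => [g _ [a' [d' [d'0 E ->]]]|/(_ ((rp a)%:F / (rp
  d)%:F)) n].
  have aa := (frac_eq a a' (dn0 _ d0) (dn0 _ d'0)).1 E.
  by apply: (frac_eq (rp a') (rp a) d'0 d0).2; rewrite -!restrict_polyM aa.
by case: n; exists a, d.
Qed.

Definition order_dual_proj v : expo V := pj (order_dual v).

Lemma order_dual_proj_pos v : posN N (order_dual_proj v).
Proof. by move=> w wN; rewrite projE // order_dual_gt0. Qed.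

Lemma order_dual_projE u v : v \in N -> order_dual_proj u v = order_dual u v.
Proof. exact: projE. Qed.

Lemma restrict_poly_denom_full : rp denom_full = denom e b (ends e).
Proof.
rewrite /denom_full /denom (big_morph rp restrict_polyM restrict_poly1); apply: eq_bigr => u _.
by rewrite restrict_polyD restrict_polyN restrict_poly1 restrict_polyU.
Qed.

Lemma denom_neq0 (S : {set V}) : denom e b S != 0.
Proof. by apply/prodf_neq0 => u _; apply: (one_mon_neq0 nodes0) (order_dual_proj_pos u). Qed.

Definition numer_nodes h : lpoly V := rp (part h numer_full).

Lemma f_nodesE h : f_nodes e b h = (numer_nodes h)%:F / (denom e b (ends e))%:F.
Proof.
by rewrite /f_nodes f_fullE restrictE restrict_poly_denom_full ?denom_neq0.
Qed.

Lemma denom_geom (S : {set V}) :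
  ((denom e b S)%:F)^-1 = geom [seq order_dual_proj u | u <- enum S].
Proof.
rewrite /denom /geom rmorph_prod -prodfV big_map big_enum_cond /=.
by apply: eq_bigl => u; rewrite andbT.
Qed.

Lemma denom_full_geom : (denom_full%:F)^-1 = geom [seq order_dual u | u <- enum (ends e)].
Proof.
rewrite /denom_full /geom rmorph_prod -prodfV big_map big_enum_cond /=.
by apply: eq_bigl => u; rewrite andbT.
Qed.

Definition dual_cone x : Prop := exists k : V -> nat, x = \sum_v Ed v *+ k v.

Lemma dual_cone0 : dual_cone 0.
Proof. by exists (fun=> 0%N); rewrite big1. Qed.

Lemma dual_coneD x y : dual_cone x -> dual_cone y -> dual_cone (x + y).
Proof.
move=> [k ->] [k' ->]; exists (fun v => (k v + k' v)%N).
by rewrite -big_split; apply: eq_bigr => v _; rewrite mulrnDr.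
Qed.

Lemma dual_cone_dual v : dual_cone (Ed v).
Proof.
exists (fun w => (w == v)); rewrite (bigD1 v) //= eqxx mulr1n big1 ?addr0 // => w wv.
by rewrite (negPf wv) mulr0n.
Qed.

Lemma dual_cone_mul x k : dual_cone x -> dual_cone (x *+ k).
Proof.
move=> dx; elim: k => [|k IH]; first by rewrite mulr0n; apply: dual_cone0.
by rewrite mulrS; apply: dual_coneD.
Qed.

Definition dual_supp a : Prop := forall x, x \in gsupp a -> dual_cone x.

Lemma gsupp_mon x y : x \in gsupp (mon y) -> x = y.
Proof. exact: gsupp_gmon. Qed.

Lemma gsupp1 x : x \in gsupp (1 : lpoly V) -> x = 0.
Proof. exact: gsupp_gmon. Qed.

Lemma dual_suppM a a' : dual_supp a -> dual_supp a' -> dual_supp (a * a').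
Proof. by move=> da da' x /gsuppM[y [z [/da dy /da' dz ->]]]; apply: dual_coneD. Qed.

Lemma dual_supp1 : dual_supp 1.
Proof. by move=> x /gsupp1 ->; apply: dual_cone0. Qed.

Lemma dual_supp_prod (I : Type) (s : seq I) (P : pred I) (F : I -> lpoly V) :
  (forall i, P i -> dual_supp (F i)) -> dual_supp (\prod_(i <- s | P i) F i).
Proof.
by move=> dF; apply: (big_ind dual_supp) => //; [exact: dual_supp1 | exact: dual_suppM].
Qed.

Lemma dual_supp_numer_full : dual_supp numer_full.
Proof.
apply: dual_supp_prod => v _; rewrite /numer; case: ifP => _.
  move=> x /gsupp_sum[i _ /gsupp_mon ->].
  by apply/dual_cone_mul/dual_cone_dual.
elim: (_ - _)%N => [|k IH]; first by rewrite expr0; apply: dual_supp1.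
rewrite exprS; apply: dual_suppM IH => x /gsuppD[/gsupp1 ->|]; first exact: dual_cone0.
by rewrite gsuppN => /gsupp_mon ->; apply: dual_cone_dual.
Qed.

Lemma gsupp_part h a x : x \in gsupp (part h a) -> x \in gsupp a.
Proof.
by apply: contraTT; rewrite -!gcoef_eq0 gcoef_part => /eqP ->; rewrite if_same.
Qed.

Lemma numer_nodes_supp h l : l \in gsupp (numer_nodes h) -> exists2 z, dual_cone z & l = pj z.
Proof. by case/gsupp_restrict_poly => z /gsupp_part/dual_supp_numer_full dz ->; exists z. Qed.

Lemma dual_cone_lattice x : dual_cone x -> dual_lattice e b x.
Proof.
case=> k ->; elim/big_rec: _ => [|v y _ dy]; first exact: dual_lattice0.
by apply: dual_latticeD => //; apply/dual_lattice_mul/dual_vec_lattice.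
Qed.

Lemma dual_cone_ge0 x v : dual_cone x -> 0 <= x v.
Proof.
case=> k ->; rewrite ffun_sumE sumr_ge0 // => u _.
by rewrite ffunMnE mulrn_wge0 // dual_ge0.
Qed.

Lemma numer_nodes_laurent h : laurent e b (numer_nodes h).
Proof.
by move=> l /numer_nodes_supp[z dz ->]; exists z => //; apply: dual_cone_lattice.
Qed.

Lemma proj_dual_D x y : proj_dual e b x -> proj_dual e b y -> proj_dual e b (x + y).
Proof.
by move=> [x' dx <-] [y' dy <-]; exists (x' + y'); [exact: dual_latticeD | exact: projD].
Qed.

Lemma projN x : pj (- x) = - pj x.
Proof. by apply/ffunP => v; rewrite !ffunE; case: ifP; rewrite ?oppr0. Qed.

Lemma proj_dual_N x : proj_dual e b x -> proj_dual e b (- x).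
Proof.
by move=> [x' dx <-]; exists (- x'); [exact: dual_latticeN | exact: projN].
Qed.

Lemma proj_dual_0 : proj_dual e b 0.
Proof. by exists 0; [exact: dual_lattice0|apply/ffunP => v; rewrite !ffunE if_same]. Qed.

Lemma order_dual_proj_dual u : proj_dual e b (order_dual_proj u).
Proof. by exists (order_dual u) => //; apply/dual_lattice_mul/dual_vec_lattice. Qed.

Lemma f_nodes_expandable h : expandable N (f_nodes e b h).
Proof.
rewrite f_nodesE denom_geom; apply: (expandable_geoms nodes0).
  exact: expandable_poly.
by move=> n /mapP[u _ ->]; apply: order_dual_proj_pos.
Qed.

Lemma proj_dual_denom : exists2 D : nat, (0 < D)%N &
  forall x, proj_dual e b x -> forall w, x w * D%:R \is a Num.int.
Proof.
have [D D0 HD] := dual_denom e_tree b_neg; exists D => // _ [x /HD xD <-] w.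
by rewrite ffunE; case: ifP => // _; rewrite mul0r rpred0.
Qed.

(** On series with nonnegative exponents in a lattice, the sum of the
    exponents is a weight to which [act_torsion] applies; this gives
    uniqueness among the expansions defining [taylor]. *)
Lemma taylorE h : taylor e b (f_nodes e b h) = expansion N (f_nodes e b h).
Proof.
set f := f_nodes e b h; set c := expansion N f.
have fc : expan N f c by apply/(expansionP nodes0)/f_nodes_expandable.
have cK l : c l != 0 -> proj_dual e b l /\ forall v, 0 <= l v.
  rewrite /c /f f_nodesE denom_geom.
  apply: (@geoms_supp _ N nodes0 (fun l => proj_dual e b l /\ forall v, 0 <= l v)).
    move=> x xf; split; first exact: numer_nodes_laurent xf.
    case/numer_nodes_supp: xf => z dz -> v; rewrite ffunE.
    by case: ifP => // _; apply: dual_cone_ge0.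
  move=> n /mapP[u _ ->]; split=> [|x [px x0]]; first exact: order_dual_proj_pos.
  split; first by apply: proj_dual_D => //; apply: order_dual_proj_dual.
  move=> v; rewrite ffunE addr_ge0 // ffunE; case: ifP => // _.
  exact/ltW/order_dual_gt0.
have ft : is_taylor e b f c by split=> //; case: fc.
rewrite /taylor; case: xgetP => [c' _ [c'K [a' [d' [d'0 f' dc']]]]|/(_ c)[]//].
have [_ [a [d [d0 f1 dc]]]] := fc.
have /(frac_eq _ _ d0 d'0) aa : a%:F / d%:F = a'%:F / d'%:F :> ratfun V by rewrite -f1.
apply/funext => l; apply/esym/eqP; rewrite -subr_eq0; apply/eqP; move: l.
have [D D0 HD] := proj_dual_denom.
apply: (@act_torsion _ (fun x : expo V => \sum_v x v) _ (d * d')).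
- by move=> x y; rewrite -big_split; apply: eq_bigr => v _; rewrite ffunE.
- move=> B; have [M MB] := rat_archimedean (Num.max 0 B * D%:R) (@ltr01 rat).
  pose G (f : {ffun V -> 'I_M}) : expo V := [ffun v => (f v)%:R / D%:R].
  apply: (@sub_finite_set _ _ (G @` setT)%classic); last by apply: finite_image; apply:
    finite_finset.
  move=> l /= [cl lB].
  have {cl}[pl l0] : proj_dual e b l /\ forall v, 0 <= l v.
    have [c0|/cK//] := eqVneq (c l) 0; apply: c'K; apply: contraNneq cl => ->.
    by rewrite c0 subr0.
  have Dr : 0 < D%:R :> rat by rewrite ltr0n.
  have lv v : exists i : 'I_M, l v = i%:R / D%:R.
    have /natrP[k kE] : l v * D%:R \is a Num.nat.
      by rewrite natrEint HD //= mulr_ge0 // ltW.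
    have kM : (k < M)%N.
      rewrite -(ltr_nat rat) -kE; apply: le_lt_trans MB.
      rewrite ler_pM2r // le_max; apply/orP; right; apply: le_trans lB.
      by rewrite (bigD1 v) //= lerDl sumr_ge0.
    by exists (Ordinal kM); rewrite //= -kE mulfK // gt_eqF.
  have [g Hg] := choice lv.
  by exists [ffun v => g v] => //; apply/ffunP => v; rewrite !ffunE Hg.
- by rewrite mulf_neq0.
move=> x; rewrite act_serB.
rewrite {1}mulrC !actM (eq_act _ dc) (eq_act _ dc') -!gcoefM.
by rewrite mulrC aa mulrC subrr.
Qed.

End Zeta.

(** * Counting before the projection to the nodes *)

Section Pushforward.
Variables (V : finType) (e : rel V) (b : V -> int).
Hypothesis e_tree : is_tree e.
Hypothesis b_neg : negative_definite e b.
Hypothesis nodes0 : nodes e != finset.set0.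
Implicit Types (x y z l : expo V) (u v w t m : V) (a d : lpoly V) (c : expo V -> int).

Local Notation N := (nodes e).
Local Notation pj := (proj N).
Local Notation rp := (restrict_poly e).

Lemma expan_rep f c a d : expan N f c -> d != 0 -> f = a%:F / d%:F ->
  forall x, act d c x = gcoef a x.
Proof.
move=> [lc [a' [d' [d'0 E dc']]]] d0 E'.
have /(frac_eq _ _ d0 d'0) aa : a%:F / d%:F = a'%:F / d'%:F :> ratfun V by rewrite -E'.
have lf : lfin N (fun l => act d c l - gcoef a l).
  exact (lfinD (lfin_act d lc) (lfinN (lfin_poly a))).
move=> x; apply/eqP; rewrite -subr_eq0; apply/eqP; move: x.
apply: (lfin_torsion nodes0 lf d'0) => x.
by rewrite act_serB -actM mulrC actM (eq_act _ dc') -!gcoefM mulrC -aa mulrC subrr.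
Qed.

(** The series obtained by setting the variables outside the nodes to 1. *)
Definition push c l : int := csum [set y | pj y = l]%classic c.

Lemma fiber_bounded l : bounded N [set y | pj y = l]%classic.
Proof.
have [v vN] := finset.set0Pn _ nodes0; exists (l v + 1) => y /= <-; exists v => //.
by rewrite projE // ltrDl.
Qed.

Lemma preim_bounded (A : set (expo V)) : bounded N A -> bounded N [set y | A (pj y)]%classic.
Proof. by move=> [B HB]; exists B => y /HB[v vN]; rewrite projE //; exists v. Qed.

Lemma push_neq0 c l : push c l != 0 -> exists2 y, c y != 0 & pj y = l.
Proof.
move=> h; apply: contrapT => nex; case/eqP: h; apply: csum0 => y /= yl.
by apply/eqP/negPn/negP => cy; apply: nex; exists y.
Qed.

Lemma lfin_push c : lfin N c -> lfin N (push c).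
Proof.
move=> lc v vN B; apply: sub_finite_set (finite_image pj (lc v vN B)).
by move=> l /= [/push_neq0[y cy <-] lB]; exists y => //; split=> //; rewrite projE in lB.
Qed.

Lemma csum_push (A : set (expo V)) c : lfin N c -> bounded N A ->
  csum A (push c) = csum [set y | A (pj y)]%classic c.
Proof.
move=> lc bA; have [X HX] := bounded_fin lc (preim_bounded bA).
pose Y := [fset pj y | y in X]%fset.
have HY l : A l -> push c l != 0 -> l \in Y.
  move=> Al /push_neq0[y cy yl]; apply/imfsetP; exists y => //=.
  by apply: HX => //=; rewrite yl.
rewrite (csumE HY) (csumE HX) big_seq.
rewrite (eq_bigr (fun l => \sum_(y <- X) if pj y == l then (if `[< A (pj y) >] then c y else
  0) else 0)).
  rewrite -big_seq exchange_big /= big_seq [RHS]big_seq; apply: eq_bigr => y yX.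
  have yY : pj y \in Y by apply/imfsetP; exists y.
  rewrite (big_fsetD1 _ yY) /= eqxx big1_fset ?addr0 // => l.
  by rewrite in_fsetD1 eq_sym => /andP[/negPf ->].
move=> l _; have [Al|nAl] := asboolP (A l).
  rewrite /push (@csumE _ X); last by move=> y /= yl; apply: HX => /=; rewrite yl.
  apply: eq_bigr => y _; have [yl|yl] := eqVneq (pj y) l; first by rewrite !asboolT ?yl.
  by rewrite asboolF //; apply/eqP.
rewrite big1 // => y _; have [yl|//] := eqVneq (pj y) l.
by rewrite asboolF // yl.
Qed.

Lemma push_poly a l : push (gcoef a) l = gcoef (rp a) l.
Proof.
elim/galg_ind: a => [|a a' IH IH'|r x].
- by rewrite restrict_poly0 gcoef0; apply: csum0 => y _; rewrite gcoef0.
- rewrite restrict_polyD gcoefD -IH -IH' -(csumD (N := N)); last exact: fiber_bounded.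
  + by rewrite /push; congr csum; apply/funext => y; rewrite gcoefD.
  + exact: lfin_poly.
  + exact: lfin_poly.
- rewrite restrict_polyU gcoef_gmon /push (@csumE _ [fset x]%fset).
    rewrite big_seq_fset1 gcoef_gmon eqxx; have [<-|xl] := eqVneq (pj x) l.
      by rewrite asboolT.
    by rewrite asboolF //; apply/eqP.
  by move=> y _; rewrite in_fset1; apply: contraNT => yx; rewrite gcoef_gmon [x == y]eq_sym
    (negPf yx).
Qed.

Lemma push_act d c l : lfin N c -> act (rp d) (push c) l = push (act d c) l.
Proof.
move=> lc; elim/galg_ind: d => [|d d' IH IH'|r n].
- by rewrite restrict_poly0 act0; apply/esym/csum0 => y _; rewrite act0.
- rewrite restrict_polyD actD IH IH' -(csumD (N := N)); last exact: fiber_bounded.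
  + by rewrite /push; congr csum; apply/funext => y; rewrite actD.
  + exact: lfin_act.
  + exact: lfin_act.
- rewrite restrict_polyU act_gmon /push.
  rewrite (_ : act _ c = fun y => r * c (y - n)); last by apply/funext => y; rewrite act_gmon.
  rewrite [RHS](_ : _ = r * csum [set y | pj y = l]%classic (fun y => c (y - n))); last first.
    by rewrite /csum -mulr_fsumr.
  rewrite csum_shift; congr (_ * csum _ _); apply/seteqP; split=> y; rewrite /shift /= projD.
    by move=> ->; rewrite subrK.
  by move=> <-; rewrite addrK.
Qed.

Lemma zeta_sum_expandable : expandable N (zeta_sum e b).
Proof.
rewrite zeta_sumE // denom_full_geom; apply: (expandable_geoms nodes0).
  exact: expandable_poly.
by move=> n /mapP[u _ ->]; apply: order_dual_pos.
Qed.

Local Notation C := (expansion N (zeta_sum e b)).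

Lemma f_full_expan h : expan N (f_full e b h) (fun y => if cls y == h then C y else 0).
Proof.
have EC := expansionP nodes0 zeta_sum_expandable; have [lC _] := EC.
split; first by apply: lfin_sub lC => l; case: ifP => //; rewrite eqxx.
exists (part h (numer_full e b)), (denom_full e b); split; first exact: denom_full_neq0.
  exact: f_fullE.
move=> x; rewrite gcoef_part.
have <- := expan_rep EC (denom_full_neq0 e_tree b_neg nodes0) (zeta_sumE e_tree b_neg
  nodes0) x.
have dL y : y \in gsupp (denom_full e b) -> y \in @int_lattice V.
  rewrite /denom_full; move: y; apply: (big_ind (fun p : lpoly V => forall y, y \in gsupp p
    -> y \in @int_lattice V)).
  - by move=> y /gsupp1 ->; apply: rpred0.
  - by move=> p q pL qL y /gsuppM[y' [z [/pL ? /qL ? ->]]]; apply: rpredD.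
  - move=> u _ y /gsuppD[/gsupp1 ->|]; first exact: rpred0.
    by rewrite gsuppN => /gsupp_mon ->; apply: dual_order_lattice.
rewrite /act; case: ifP => xh.
  rewrite big_seq [RHS]big_seq; apply: eq_bigr => y /dL yL.
  by rewrite clsD clsN (cls_eq0 yL) subr0 xh.
rewrite big_seq big1 // => y /dL yL.
by rewrite clsD clsN (cls_eq0 yL) subr0 xh mulr0.
Qed.

Lemma f_nodes_expan h :
  expan N (f_nodes e b h) (push (fun y => if cls y == h then C y else 0)).
Proof.
have EC := f_full_expan h; have [lC _] := EC.
split; first exact: lfin_push.
exists (numer_nodes e b h), (denom e b (ends e)); split; first exact: denom_neq0.
  exact: f_nodesE.
move=> x; rewrite -restrict_poly_denom_full push_act // /numer_nodes -push_poly; congr push;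
  apply/funext => y.
by apply: (expan_rep EC); [exact: denom_full_neq0 | exact: f_fullE].
Qed.

(** A count can be made before setting variables to 1 and forgetting the
    classes, where the product formula in all variables is available. *)
Lemma cnt_f_nodes h (A : set (expo V)) : bounded N A ->
  cnt N A (f_nodes e b h) = cnt N [set y | A (pj y) /\ cls y = h]%classic (zeta_sum e b).
Proof.
move=> bA; have EC := f_nodes_expan h; have [lC _] := f_full_expan h.
rewrite /cnt (expansionE nodes0 EC) csum_push //.
rewrite -[in RHS](setIidl (A := [set y | A (pj y) /\ cls y = h]%classic) (B := [set y | A
  (pj y)]%classic)) => [|y []//].
rewrite /csum setIC fsbig_mkcondr; apply: eq_fsbigr => y /set_mem /= Ay.
case: ifP => [/eqP yh|yh]; first by rewrite mem_set.
by rewrite memNset // => -[_ /eqP]; rewrite yh.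
Qed.

End Pushforward.

(** * Cancellation of the poles of a branch *)

Section Branches.
Import mathcomp.boot.fintype mathcomp.boot.finset.
Variables (V : finType) (e : rel V) (b : V -> int).
Hypothesis e_tree : is_tree e.
Hypothesis b_neg : negative_definite e b.
Hypothesis nodes0 : nodes e != set0.
Implicit Types (x y z l : expo V) (u v w t m r c : V) (a d p : lpoly V) (f g : ratfun V).
Implicit Types (B S T : {set V}).

Local Notation Ed := (dual_vec e b).
Local Notation N := (nodes e).
Local Notation dual_binomial := (dual_binomial e b).
Local Notation weight := (weight e).

Let e_sym : symmetric e. Proof. by case: e_tree. Qed.

Lemma branch_prod (M : comNzRingType) (F : V -> M) m r : e m r ->
  \prod_(v in branch e m r) F v =
  F r * \prod_(c | e r c && (c != m)) \prod_(v in branch e r c) F v.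
Proof.
move=> mr; rewrite (bigD1 r) ?mem_branch_self //=; congr (_ * _).
have rm : e r m by rewrite e_sym.
have brE v : (v \in branch e m r) && (v != r) = (v != r) && (toward e r v != m).
  have [->|vr] := eqVneq v r; rewrite ?andbF //= andbT branch_compl // in_setC.
  by rewrite (branch_toward e_tree _ rm) vr.
rewrite (partition_big (toward e r) (fun c => e r c && (c != m))) /=.
  apply: eq_bigr => c /andP[rc cm]; apply: eq_bigl => v.
  rewrite brE (branch_toward e_tree _ rc); have [->|_] := eqVneq (toward e r v) c; first by
    rewrite cm !andbT.
  by rewrite !andbF.
move=> v; rewrite brE => /andP[vr nm]; rewrite nm andbT.
by case: (towardP e_tree vr).
Qed.

Lemma tree_prod (M : comNzRingType) (F : V -> M) m :
  \prod_v F v = F m * \prod_(c | e m c) \prod_(v in branch e m c) F v.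
Proof.
rewrite (bigD1 m) //=; congr (_ * _).
rewrite (partition_big (toward e m) (fun c => e m c)) /=.
  apply: eq_bigr => c mc; apply: eq_bigl => v.
  by rewrite (branch_toward e_tree _ mc).
by move=> v vm; case: (towardP e_tree vm).
Qed.

Definition dual_binomials : lpoly V := \prod_v dual_binomial v.

Lemma dual_binomials_neq0 : (dual_binomials%:F : ratfun V) != 0.
Proof. by rewrite tofrac_neq0; apply/prodf_neq0 => v _; apply: dual_binomial_neq0. Qed.

Lemma dual_binomialF_neq0 v : ((dual_binomial v)%:F : ratfun V) != 0.
Proof. by rewrite tofrac_neq0; apply: dual_binomial_neq0. Qed.

(** The ring of fractions whose denominators are products of the factors 1 -
    t^{E_v^*}: all the functions below are in it, so that they have
    expansions. *)
Definition dfrac f : Prop := exists a (k : nat), f * dual_binomials%:F ^+ k = a%:F.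

Lemma dfrac_poly a : dfrac a%:F.
Proof. by exists a, 0%N; rewrite expr0 mulr1. Qed.

Lemma dfracD f g : dfrac f -> dfrac g -> dfrac (f + g).
Proof.
move=> [a [k fa]] [a' [k' ga]]; exists (a * dual_binomials ^+ k' + a' * dual_binomials ^+
  k), (k + k')%N.
by rewrite tofracD !tofracM !tofracXn -fa -ga exprD; ring.
Qed.

Lemma dfracM f g : dfrac f -> dfrac g -> dfrac (f * g).
Proof.
move=> [a [k fa]] [a' [k' ga]]; exists (a * a'), (k + k')%N.
by rewrite tofracM -fa -ga exprD mulrACA.
Qed.

Lemma dfrac_inv v : dfrac ((dual_binomial v)%:F)^-1.
Proof.
exists (\prod_(w | w != v) dual_binomial w), 1%N; rewrite expr1 /dual_binomials (bigD1 v)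
  //= tofracM.
by rewrite mulKf // dual_binomialF_neq0.
Qed.

Lemma dfrac1 : dfrac 1. Proof. by rewrite -tofrac1; apply: dfrac_poly. Qed.

Lemma dfrac0 : dfrac 0. Proof. by rewrite -tofrac0; apply: dfrac_poly. Qed.

Lemma dfrac_prod (I : Type) (s : seq I) (P : pred I) (F : I -> ratfun V) :
  (forall i, P i -> dfrac (F i)) -> dfrac (\prod_(i <- s | P i) F i).
Proof. by move=> sF; apply: (big_ind dfrac) => //; [exact: dfrac1 | exact: dfracM]. Qed.

Lemma dfracX f k : dfrac f -> dfrac (f ^+ k).
Proof. by move=> sf; elim: k => [|k IH]; rewrite ?expr0 ?exprS; [exact: dfrac1 | exact:
  dfracM]. Qed.

Lemma dfrac_expandable f : dfrac f -> expandable N f.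
Proof.
move=> [a [k fa]]; have -> : f = a%:F * (dual_binomials%:F ^+ k)^-1.
  by rewrite -fa mulfK // expf_neq0 // dual_binomials_neq0.
have -> : (dual_binomials%:F ^+ k)^-1 = geom (flatten (nseq k [seq Ed v | v <- enum V])) :>
  ratfun V.
  elim: k {fa} => [|k IH]; first by rewrite expr0 invr1 /geom big_nil.
  rewrite exprS invfM IH /= /geom big_cat /=; congr (_ * _).
  rewrite big_map big_enum /= /dual_binomials rmorph_prod /= -prodfV.
  by apply: eq_bigr.
apply: (expandable_geoms nodes0); first exact: expandable_poly.
move=> n; elim: k {fa} => // k IH; rewrite /= mem_cat => /orP[/mapP[v _ ->]|/IH //].
exact: dual_pos.
Qed.

Definition partial_zeta B : ratfun V := \prod_(v in B) (dual_binomial v)%:F ^ weight v.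

Lemma weight_ge v : -1 <= weight v.
Proof.
have [vE|vE] := boolP (v \in ends e); first by rewrite weight_end.
by rewrite weight_other.
Qed.

Lemma dfrac_pow v (k : int) : -1 <= k -> dfrac ((dual_binomial v)%:F ^ k).
Proof.
case: k => k; first by move=> _; rewrite -exprnP; apply/dfracX/dfrac_poly.
by case: k => // _; rewrite NegzE exprN1; apply: dfrac_inv.
Qed.

Lemma dfrac_partial_zeta B : dfrac (partial_zeta B).
Proof. by apply: dfrac_prod => v _; apply: dfrac_pow (weight_ge v). Qed.

(** Congruence modulo the elements 1 - t^{E_v}, v in T, that is, after setting
    these t^{E_v} equal to 1. *)
Definition cong T f g : Prop := exists s : V -> ratfun V,
  (forall v, dfrac (s v)) /\ f = g + \sum_(v in T) (1 - mon (axis v 1))%:F * s v.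

Lemma cong_refl T f : cong T f f.
Proof.
exists (fun=> 0); split=> [v|]; first exact: dfrac0.
by rewrite big1 ?addr0 // => v _; rewrite mulr0.
Qed.

Lemma cong_mono T T' f g : T \subset T' -> cong T f g -> cong T' f g.
Proof.
move=> TT' [s [sS ->]]; exists (fun v => if v \in T then s v else 0); split.
  by move=> v; case: ifP => // _; apply: dfrac0.
congr (_ + _); rewrite [LHS]big_mkcond [RHS]big_mkcond; apply: eq_bigr => v _.
have [vT|vT] := boolP (v \in T); first by rewrite (subsetP TT').
by rewrite mulr0 if_same.
Qed.

Lemma congD T f f' g g' : cong T f g -> cong T f' g' -> cong T (f + f') (g + g').
Proof.
move=> [s [sS ->]] [s' [sS' ->]]; exists (fun v => s v + s' v); split.
  by move=> v; apply: dfracD.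
rewrite addrACA -big_split; congr (_ + _); apply: eq_bigr => v _.
by rewrite mulrDr.
Qed.

Lemma congM T f f' g g' : dfrac f' -> dfrac g -> cong T f g -> cong T f' g' ->
  cong T (f * f') (g * g').
Proof.
move=> Sf' Sg [s [sS Ef]] [s' [sS' Ef']].
exists (fun v => s v * f' + g * s' v); split.
  by move=> v; apply: dfracD; apply: dfracM.
rewrite Ef mulrDl {1}Ef' mulrDr -addrA; congr (_ + _).
rewrite mulr_sumr mulr_suml -big_split; apply: eq_bigr => v _ /=.
by ring.
Qed.

Lemma cong_prod T (I : Type) (s : seq I) (P : pred I) (F G : I -> ratfun V) :
  (forall i, P i -> [/\ dfrac (F i), dfrac (G i) & cong T (F i) (G i)]) ->
  cong T (\prod_(i <- s | P i) F i) (\prod_(i <- s | P i) G i).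
Proof.
move=> FG; elim: s => [|i s IHs]; first by rewrite !big_nil; apply: cong_refl.
rewrite !big_cons; case: ifP => // Pi; have [SFi SGi FGi] := FG i Pi.
by apply: congM => //; apply: dfrac_prod => j /FG[].
Qed.

Definition poly_mod T f : Prop := exists p, cong T f p%:F.

Lemma poly_mod_poly T p : poly_mod T p%:F.
Proof. by exists p; apply: cong_refl. Qed.

Lemma poly_modM T p f : dfrac f -> poly_mod T f -> poly_mod T (p%:F * f).
Proof.
move=> Sf [q fq]; exists (p * q); rewrite tofracM.
by apply: congM => //; [exact: dfrac_poly | exact: cong_refl].
Qed.

Lemma poly_modD T f g : poly_mod T f -> poly_mod T g -> poly_mod T (f + g).
Proof. by move=> [p fp] [q gq]; exists (p + q); rewrite tofracD; apply: congD. Qed.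

Lemma poly_mod_mono T T' f : T \subset T' -> poly_mod T f -> poly_mod T' f.
Proof. by move=> TT' [p fp]; exists p; apply: cong_mono fp. Qed.

Lemma poly_mod_mul T f g : dfrac f -> dfrac g -> poly_mod T f -> poly_mod T g -> poly_mod T
  (f * g).
Proof.
move=> Sf Sg [p fp] [q gq]; exists (p * q); rewrite tofracM.
by apply: congM => //; apply: dfrac_poly.
Qed.

Lemma poly_mod_prod T (I : Type) (s : seq I) (P : pred I) (F : I -> ratfun V) :
  (forall i, P i -> dfrac (F i) /\ poly_mod T (F i)) -> poly_mod T (\prod_(i <- s | P i) F i).
Proof.
move=> sF; elim: s => [|i s IHs].
  by rewrite big_nil -tofrac1; apply: poly_mod_poly.
rewrite big_cons; case: ifP => // Pi; have [Si Poli] := sF i Pi.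
by apply: poly_mod_mul => //; apply: dfrac_prod => j /sF[].
Qed.

(** Because 1 - t^{x+y} = (1 - t^x) + t^x (1 - t^y), the exponents x for which
    1 - t^x cancels the poles of f modulo T form a subgroup. *)
Lemma poly_mod_subgroupD T f x y : dfrac f -> poly_mod T ((1 - mon x)%:F * f) ->
  poly_mod T ((1 - mon y)%:F * f) -> poly_mod T ((1 - mon (x + y))%:F * f).
Proof.
move=> Sf Px Py.
have -> : (1 - mon (x + y))%:F * f = (1 - mon x)%:F * f + (mon x)%:F * ((1 - mon y)%:F * f).
  rewrite mulrA -tofracM -mulrDl -tofracD monD; congr (_%:F * _).
  by rewrite mulrBr mulr1 addrA subrK.
by apply: poly_modD => //; apply: poly_modM => //; apply: dfracM => //; apply: dfrac_poly.
Qed.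

Lemma poly_mod_subgroupN T f x : dfrac f -> poly_mod T ((1 - mon x)%:F * f) ->
  poly_mod T ((1 - mon (- x))%:F * f).
Proof.
move=> Sf Px.
have -> : (1 - mon (- x))%:F * f = (- mon (- x))%:F * ((1 - mon x)%:F * f).
  rewrite mulrA -tofracM; congr (_%:F * _).
  by rewrite mulrBr mulr1 mulNr -monD addNr mon0 opprK addrC.
by apply: poly_modM => //; apply: dfracM => //; apply: dfrac_poly.
Qed.

Lemma poly_mod_subgroup0 T f : poly_mod T ((1 - mon 0)%:F * f).
Proof. by rewrite mon0 subrr tofrac0 mul0r -tofrac0; apply: poly_mod_poly. Qed.

Lemma poly_mod_subgroup_mul T f x (k : int) : dfrac f -> poly_mod T ((1 - mon x)%:F * f) ->
  poly_mod T ((1 - mon (x *~ k))%:F * f).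
Proof.
move=> Sf Px; have natk n : poly_mod T ((1 - mon (x *+ n))%:F * f).
  elim: n => [|n IH]; first by rewrite mulr0n; apply: poly_mod_subgroup0.
  by rewrite mulrS; apply: poly_mod_subgroupD.
case: k => k; first by rewrite -pmulrn; apply: natk.
by rewrite NegzE mulrNz -pmulrn; apply/poly_mod_subgroupN/natk.
Qed.

Lemma poly_mod_axis T f v : dfrac f -> v \in T -> poly_mod T ((1 - mon (axis v 1))%:F * f).
Proof.
move=> Sf vT; exists 0, (fun w => if w == v then f else 0); split.
  by move=> w; case: ifP => // _; apply: dfrac0.
rewrite tofrac0 add0r (bigD1 v) //= eqxx big1 ?addr0 // => w /andP[_ /negPf ->].
by rewrite mulr0.
Qed.

Lemma valency_children m r : e m r -> (#|[set c | e r c & c != m]| + 1)%N = valency e r.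
Proof.
move=> mr; rewrite /valency [RHS](cardsD1 m) inE e_sym mr addnC; congr (_ + _)%N.
by apply: eq_card => c; rewrite !inE andbC.
Qed.

(** Only the powers of 1 - t^{E_m^*} prevent a branch at m from being a
    Laurent polynomial after its own variables are set to 1. For the factor at
    r, the exponent at r is one less than the number of children, so one more
    factor gives each child what the induction requires. The factors at the
    children are dealt with in the same way, and E_m^* is a combination of
    E_r, E_r^* and the E_c^* of the children. *)
Lemma poly_mod_branch m r : e m r ->
  poly_mod (branch e m r) ((dual_binomial m)%:F * partial_zeta (branch e m r)) /\ poly_mod
    (branch e m r) ((dual_binomial r)%:F * partial_zeta (branch e m r)).
Proof.
move: m r; apply: (branch_ind e_tree) => m r mr IH.
set T := branch e m r; have ST := dfrac_partial_zeta T.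
pose ch := [set c | e r c & c != m].
have IHc c : c \in ch -> [/\ dfrac (partial_zeta (branch e r c)), dfrac ((dual_binomial
  r)%:F * partial_zeta (branch e r c)),
    poly_mod T ((dual_binomial r)%:F * partial_zeta (branch e r c)) & poly_mod T
      ((dual_binomial c)%:F * partial_zeta (branch e r c))].
  rewrite inE => /andP[rc cm]; have [P1 P2] := IH c rc cm.
  have sub := branch_sub e_tree mr rc cm.
  split; [exact: dfrac_partial_zeta | exact: dfracM (dfrac_poly _) (dfrac_partial_zeta _) |
    exact: poly_mod_mono P1 | exact: poly_mod_mono P2].
have FE : partial_zeta T = (dual_binomial r)%:F ^ weight r * \prod_(c in ch) partial_zeta
  (branch e r c).
  rewrite /partial_zeta (branch_prod _ mr); congr (_ * _); apply: eq_bigl => c.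
  by rewrite inE.
have wtr : weight r = #|ch|%:Z - 1.
  by rewrite /weight -(valency_children mr) PoszD -[2 in LHS]/(1 + 1 : int) opprD addrA addrK.
have pr : poly_mod T ((dual_binomial r)%:F * partial_zeta T).
  rewrite FE mulrA -{1}[(dual_binomial r)%:F]expr1z -expfzDr ?dual_binomialF_neq0 // wtr
    addrC subrK.
  rewrite -exprnP -prodr_const -big_split; apply: poly_mod_prod => c /IHc[] //.
split; last exact: pr.
have Sc c : c \in ch -> poly_mod T ((1 - mon (Ed c))%:F * partial_zeta T).
  move=> cc; have -> : (1 - mon (Ed c))%:F * partial_zeta T =
      ((dual_binomial c)%:F * partial_zeta (branch e r c)) * \prod_(c' in ch :\ c)
        ((dual_binomial r)%:F * partial_zeta (branch e r c')).
    rewrite FE wtr (cardsD1 c) cc PoszD addrAC subrr add0r -exprnP.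
    rewrite (big_setD1 c) //= [in RHS]big_split /= prodr_const /dual_binomial.
    by ring.
  have [Sf _ _ Pc] := IHc c cc; apply: poly_mod_mul => //; first exact: dfracM (dfrac_poly
    _) _.
    by apply: dfrac_prod => c'; rewrite inE => /andP[_ /IHc[]].
  by apply: poly_mod_prod => c'; rewrite inE => /andP[_ /IHc[]].
rewrite /dual_binomial; have rT : r \in T by apply: mem_branch_self.
(* The expression of E_r by E_r^* and the E_w^* of its neighbours, solved for
   E_m^*. *)
have -> : Ed m = - axis r 1 + (- (Ed r *~ b r) + - \sum_(c in ch) Ed c).
  have -> : axis r 1 = - (Ed r *~ b r) - (Ed m + \sum_(c in ch) Ed c).
    rewrite (axis_dual e_tree b_neg); congr (_ - _); rewrite (bigD1 m) /=; last by rewrite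
      e_sym.
    by congr (_ + _); apply: eq_bigl => c; rewrite inE.
  by rewrite !opprD !opprK; set X := _ *~ _; set Y := \sum_(_ in _) _; rewrite addrACA subrr
    add0r addrK.
apply: (poly_mod_subgroupD ST); first exact: (poly_mod_subgroupN ST (poly_mod_axis ST rT)).
apply: (poly_mod_subgroupD ST); first exact: (poly_mod_subgroupN ST (poly_mod_subgroup_mul _
  ST pr)).
apply: (poly_mod_subgroupN ST).
apply: (big_ind (fun x => poly_mod T ((1 - mon x)%:F * partial_zeta T))); last exact: Sc.
  exact: poly_mod_subgroup0.
by move=> x y; apply: (poly_mod_subgroupD ST).
Qed.

End Branches.

(** * Separated sets of nodes *)

Section Front.
Import mathcomp.boot.fintype mathcomp.boot.finset.
Variables (V : finType) (e : rel V) (b : V -> int).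
Hypothesis e_tree : is_tree e.
Hypothesis b_neg : negative_definite e b.
Hypothesis nodes0 : nodes e != set0.
Implicit Types (x y z l : expo V) (u v w t m r c : V) (a d p : lpoly V) (f g : ratfun V).
Implicit Types (B S T : {set V}).

Local Notation Ed := (dual_vec e b).
Local Notation N := (nodes e).
Local Notation dual_binomial := (dual_binomial e b).
Local Notation weight := (weight e).
Local Notation partial_zeta := (partial_zeta e b).
Local Notation cong := (cong e b).

Let e_sym : symmetric e. Proof. by case: e_tree. Qed.

(** The part B of the branch lies behind S as seen from m, and only B keeps
    its poles. The last condition says that one enters B only through S. *)
Definition front S T m r : Prop := exists p B,
  [/\ B \subset branch e m r, cong T (partial_zeta (branch e m r)) (p%:F * partial_zeta B),
    r \in B -> r \in S &
      forall t t', t \in branch e m r -> t \notin B -> e t t' ->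
        [\/ (t' \in branch e m r) && (t' \notin B), t' = m | t' \in S]].

Definition meets S m r : bool := [exists s, (s \in S) && (s \in branch e m r)].

Lemma meetsP S m r : reflect (exists2 s, s \in S & s \in branch e m r) (meets S m r).
Proof.
by apply: (iffP existsP) => [[s /andP[]]|[s sS sb]]; exists s => //; apply/andP.
Qed.

(** With the exponent #|ch| - j at r, one factor is available for each of the
    branches that S does not meet, and cancels its poles. *)
Lemma front_combine S T m0 r (ch : {set V}) j :
  (forall v, v \notin S -> v != m0 -> v \in T) ->
  (forall c, c \in ch -> e r c /\ m0 \notin branch e r c) ->
  (forall c, c \in ch -> meets S r c -> front S T r c) ->
  (j <= #|[set c in ch | meets S r c]|)%N ->
  exists p B, [/\ forall v, v \in B -> exists2 c, c \in ch & v \in branch e r c,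
    cong T ((dual_binomial r)%:F ^ (#|ch|%:Z - j%:Z) * \prod_(c in ch) partial_zeta (branch
      e r c)) (p%:F * partial_zeta B),
    forall c, c \in ch -> c \in B -> c \in S &
    forall c t t', c \in ch -> t \in branch e r c -> t \notin B -> e t t' ->
        [\/ (t' \in branch e r c) && (t' \notin B), t' = r | t' \in S]].
Proof.
move=> HT Hch IH; set chS := [set c in ch | meets S r c] => jk.
have /choice[pB HpB] c : exists q : lpoly V * {set V}, c \in chS ->
   [/\ q.2 \subset branch e r c, cong T (partial_zeta (branch e r c)) (q.1%:F * partial_zeta
     q.2), c \in q.2 -> c \in S &
      forall t t', t \in branch e r c -> t \notin q.2 -> e t t' ->
        [\/ (t' \in branch e r c) && (t' \notin q.2), t' = r | t' \in S]].
  have [|cn] := boolP (c \in chS); last by exists (0, set0).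
  rewrite inE => /andP[cc cS]; have [p [B [h1 h2 h3 h4]]] := IH c cc cS.
  by exists (p, B).
have /choice[q Hq] c : exists q : lpoly V, c \in ch :\: chS -> cong T ((dual_binomial r)%:F
  * partial_zeta (branch e r c)) q%:F.
  have [|cn] := boolP (c \in ch :\: chS); last by exists 0.
  rewrite in_setD inE negb_and => /andP[+ cc]; rewrite cc /= => cS.
  have [rc m0c] := Hch c cc; have [[p Hp] _] := poly_mod_branch e_tree b_neg nodes0 rc.
  exists p => _; apply: cong_mono Hp; apply/subsetP => v vc; apply: HT.
    by apply: contraNN cS => vS; apply/meetsP; exists v.
  by apply: contraNneq m0c => <-.
pose B := \bigcup_(c in chS) (pB c).2.
have chSP c : c \in chS -> [/\ c \in ch, e r c & (pB c).2 \subset branch e r c].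
  move=> cS; have [sub _ _ _] := HpB c cS; move: cS; rewrite inE => /andP[cc _].
  by have [rc _] := Hch c cc.
have BP c v : c \in chS -> v \in branch e r c -> (v \in B) = (v \in (pB c).2).
  move=> cS vc; apply/bigcupP/idP => [[c' cS' vc']|vc']; last by exists c.
  have [[_ rc _] [_ rc' /subsetP sub']] := (chSP c cS, chSP c' cS').
  by have -> : c = c' by apply: (branch_eq e_tree rc rc' vc (sub' _ vc')).
have BPn c v : c \in ch -> c \notin chS -> v \in branch e r c -> v \notin B.
  move=> cc cS vc; apply/bigcupP => -[c' cS' vc'].
  have [[rc _] [_ rc' /subsetP sub']] := (Hch c cc, chSP c' cS').
  by move: cS; rewrite (branch_eq e_tree rc rc' vc (sub' _ vc')) cS'.
have FBB : partial_zeta B = \prod_(c in chS) partial_zeta (pB c).2.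
  rewrite /partial_zeta (partition_big (toward e r) (fun c => c \in chS)) /=.
    apply: eq_bigr => c cS; have [cc rc /subsetP sub] := chSP c cS.
    apply: eq_bigl => v; apply/andP/idP => [[/bigcupP[c' cS' vc'] /eqP nv]|vc].
      have [cc' rc' /subsetP sub'] := chSP c' cS'.
      by have <- : c' = c; rewrite // -nv; apply/esym/toward_eq => //; apply: sub'.
    split; first by apply/bigcupP; exists c.
    by apply/eqP/toward_eq => //; apply: sub.
  move=> v /bigcupP[c cS vc]; have [cc rc /subsetP sub] := chSP c cS.
  by rewrite (toward_eq e_tree rc (sub _ vc)).
exists (dual_binomial r ^+ (#|chS| - j) * \prod_(c in chS) (pB c).1 * \prod_(c in ch :\:
  chS) q c), B.
split.
- move=> v /bigcupP[c cS vc]; have [cc rc /subsetP sub] := chSP c cS.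
  by exists c => //; apply: sub.
- have subS : chS \subset ch by apply/subsetP => c; rewrite inE => /andP[].
  have cardS : (#|ch| = #|chS| + #|ch :\: chS|)%N by rewrite -(cardsID chS ch) (setIidPr subS).
  have wtE : #|ch|%:Z - j%:Z = (#|chS| - j)%N%:Z + #|ch :\: chS|%:Z.
    by rewrite cardS PoszD -subzn // addrAC.
  have nz := dual_binomialF_neq0 e_tree b_neg nodes0 r.
  have -> : (dual_binomial r)%:F ^ (#|ch|%:Z - j%:Z) * \prod_(c in ch) partial_zeta (branch
    e r c) =
     (dual_binomial r ^+ (#|chS| - j))%:F * \prod_(c in chS) partial_zeta (branch e r c) *
     \prod_(c in ch :\: chS) ((dual_binomial r)%:F * partial_zeta (branch e r c)).
    rewrite wtE expfzDr // -!exprnP tofracXn big_split /= prodr_const.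
    by rewrite (big_setID chS) /= (setIidPr subS); ring.
  have -> : (dual_binomial r ^+ (#|chS| - j) * \prod_(c in chS) (pB c).1 * \prod_(c in ch
    :\: chS) q c)%:F * partial_zeta B =
     (dual_binomial r ^+ (#|chS| - j))%:F * \prod_(c in chS) ((pB c).1%:F * partial_zeta (pB
       c).2) *
     \prod_(c in ch :\: chS) (q c)%:F.
    by rewrite !tofracM FBB big_split /= !rmorph_prod /=; ring.
  have dfracFB := dfrac_partial_zeta e_tree b_neg nodes0.
  have dfrac1' : dfrac e b (\prod_(c in chS) ((pB c).1%:F * partial_zeta (pB c).2)).
    by apply: dfrac_prod => c _; apply: dfracM; [exact: dfrac_poly | exact: dfracFB].
  have dfrac2' : dfrac e b (\prod_(c in ch :\: chS) ((dual_binomial r)%:F * partial_zeta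
    (branch e r c))).
    by apply: dfrac_prod => c _; apply: dfracM; [exact: dfrac_poly | exact: dfracFB].
  have dfrac3' : dfrac e b (\prod_(c in chS) partial_zeta (branch e r c)).
    by apply: dfrac_prod => c _; apply: dfracFB.
  apply: (congM dfrac2'); first by apply: dfracM dfrac1'; apply: dfrac_poly.
    apply: (congM dfrac3'); [exact: dfrac_poly | exact: cong_refl |].
    apply: cong_prod => c cS; have [_ h _ _] := HpB c cS; split; [exact: dfracFB| |exact: h].
    by apply: dfracM; [exact: dfrac_poly | exact: dfracFB].
  apply: cong_prod => c cS; split; last exact: Hq.
    by apply: dfracM; [exact: dfrac_poly | exact: dfracFB].
  exact: dfrac_poly.
- move=> c cc cB; have [cS|cS] := boolP (c \in chS).
    by have [_ _ h _] := HpB c cS; apply: h; rewrite -(BP c c cS) // mem_branch_self.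
  by have := BPn c c cc cS (mem_branch_self _ _ _); rewrite cB.
- move=> c t t' cc tc tB tt'; have [rc m0c] := Hch c cc.
  have [cS|cS] := boolP (c \in chS).
    rewrite (BP c t cS tc) in tB; have [_ _ _ h] := HpB c cS.
    case: (h t t' tc tB tt') => [/andP[tc' tB']|->|tS']; [|by apply: Or32|by apply: Or33].
    by apply: Or31; rewrite tc' (BP c t' cS tc').
  have [->|tr] := eqVneq t' r; first by apply: Or32.
  apply: Or31; have tr0 : t != r by apply: branch_neq tc; rewrite eq_sym (edge_neq e_tree rc).
  have tc' : t' \in branch e r c by apply: branch_edge tt'.
  by rewrite tc' (BPn c).
Qed.

(** An element of S at r closes the branch. Otherwise the exponent at r is one
    less than the number of children, and S meets at least one of their
    branches. *)
Lemma front_branch S T m0 m r : (forall v, v \notin S -> v != m0 -> v \in T) ->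
  e m r -> m0 \notin branch e m r -> meets S m r -> front S T m r.
Proof.
move=> HT; move: m r; apply: (branch_ind e_tree) => m r mr IH m0n mS.
have [rS|rS] := boolP (r \in S).
  exists 1, (branch e m r); split=> //.
    by rewrite tofrac1 mul1r; apply: cong_refl.
  by move=> t t' ->.
pose ch := [set c | e r c & c != m].
have chP c : c \in ch -> [/\ e r c, c != m & branch e r c \subset branch e m r].
  by rewrite inE => /andP[rc cm]; split=> //; apply: branch_sub.
have Hch c : c \in ch -> e r c /\ m0 \notin branch e r c.
  by case/chP => rc _ /subsetP sub; split=> //; apply: contraNN m0n => /sub.
have IHc c : c \in ch -> meets S r c -> front S T r c.
  by move=> cc; have [rc cm _] := chP c cc; have [_ m0c] := Hch c cc; apply: IH.
have j1 : (1 <= #|[set c in ch | meets S r c]|)%N.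
  rewrite card_gt0; apply/set0Pn; have /meetsP[s sS sb] := mS.
  have sr : s != r by apply: contraNneq rS => <-.
  have [ers sn] := towardP e_tree sr; exists (toward e r s); rewrite !inE ers /=;
    apply/andP; split.
    move: sb; rewrite branch_compl // in_setC (branch_toward e_tree); last by rewrite e_sym.
    by rewrite sr.
  by apply/meetsP; exists s.
have [p [B [BP cB BS Bt]]] := front_combine HT Hch IHc j1.
exists p, B; split.
- by apply/subsetP => v /BP[c /chP[_ _ /subsetP sub]]; apply: sub.
- suff -> : partial_zeta (branch e m r) = (dual_binomial r)%:F ^ (#|ch|%:Z - 1%:Z) *
  \prod_(c in ch) partial_zeta (branch e r c) by [].
  have wtr : weight r = #|ch|%:Z - 1%:Z.
    by rewrite /weight -(valency_children e_tree mr) PoszD -[2 in LHS]/(1 + 1 : int) opprD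
      addrA addrK.
  rewrite -wtr [LHS](branch_prod e_tree _ mr); congr (_ * _).
  by apply: eq_bigl => c; rewrite inE.
- move=> rB; have [c /chP[rc _ _] /branch_neq] := BP r rB.
  by rewrite eqxx eq_sym (edge_neq e_tree rc) => /(_ isT).
- have rB : r \notin B.
    apply/negP => rB; have [c /chP[rc _ _] /branch_neq] := BP r rB.
    by rewrite eqxx eq_sym (edge_neq e_tree rc) => /(_ isT).
  have rbr : (r \in branch e m r) && (r \notin B) by rewrite mem_branch_self rB.
  move=> t t' tm tB tt'; have [tr|tr] := eqVneq t r.
    have [tm'|tm'] := eqVneq t' m; first by apply: Or32.
    have cc : t' \in ch by rewrite inE tm' -tr tt'.
    have [tB'|tB'] := boolP (t' \in B); first by apply: Or33; apply: BS.
    apply: Or31; rewrite andbT; have [_ _ /subsetP sub] := chP _ cc.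
    by apply/sub/mem_branch_self.
  have [ert tn] := towardP e_tree tr.
  have cc : toward e r t \in ch.
    rewrite inE ert /=; move: tm; rewrite branch_compl // in_setC (branch_toward e_tree);
      last by rewrite e_sym.
    by rewrite tr.
  case: (Bt _ t t' cc tn tB tt') => [/andP[tc' tB']|->|tS']; [|by apply: Or31|by apply: Or33].
  by apply: Or31; rewrite tB' andbT; have [_ _ /subsetP sub] := chP _ cc; apply: sub.
Qed.

(** At m the exponent is two less than the number of branches, and S meets at
    least two of them. *)
Lemma front_root S T m : (forall v, v \notin S -> v != m -> v \in T) ->
  (exists s1 s2, [/\ s1 \in S, s2 \in S, s1 != m, s2 != m & toward e m s1 != toward e m s2]) ->
  exists p B, [/\ m \notin B, cong T (zeta_sum e b) (p%:F * partial_zeta B) &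
     forall t t', t \notin B -> e t t' -> t' \in B -> t' \in S].
Proof.
move=> HT [s1 [s2 [s1S s2S s1m s2m ss]]]; pose ch := [set c | e m c].
have nm c : c \in ch -> m \notin branch e m c.
  rewrite inE => mc; apply/negP => /branch_neq.
  by rewrite eqxx eq_sym (edge_neq e_tree mc) => /(_ isT).
have Hch c : c \in ch -> e m c /\ m \notin branch e m c.
  by move=> cc; split; [move: cc; rewrite inE | exact: nm].
have IHc c : c \in ch -> meets S m c -> front S T m c.
  by move=> /Hch[mc mn]; apply: front_branch HT mc mn.
have [[e1 b1] [e2 b2]] := (towardP e_tree s1m, towardP e_tree s2m).
have j2 : (2 <= #|[set c in ch | meets S m c]|)%N.
  have -> : 2%N = #|[set toward e m s1; toward e m s2]| by rewrite cards2 ss.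
  apply: subset_leq_card; apply/subsetP => c; rewrite !inE => /orP[] /eqP ->.
    by rewrite e1; apply/meetsP; exists s1.
  by rewrite e2; apply/meetsP; exists s2.
have [p [B [BP cB BS Bt]]] := front_combine HT Hch IHc j2.
exists p, B; split.
- by apply/negP => /BP[c /nm/negPf ->].
- suff -> : zeta_sum e b = (dual_binomial m)%:F ^ (#|ch|%:Z - 2%:Z) * \prod_(c in ch)
  partial_zeta (branch e m c) by [].
  rewrite /zeta_sum [LHS](tree_prod e_tree _ m); congr (_ * _).
  by apply: eq_bigl => c; rewrite inE.
- move=> t t' tB tt' tB'; have [tm|tm] := eqVneq t m.
    by apply: BS => //; rewrite inE -tm.
  have [emt tn] := towardP e_tree tm.
  have cc : toward e m t \in ch by rewrite inE.
  case: (Bt _ t t' cc tn tB tt') => [/andP[_]|tm'|//]; first by rewrite tB'.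
  by move: tB'; rewrite tm' => /BP[c /nm/negPf ->].
Qed.

End Front.

(** * Counting over unions of half-spaces *)

Section Deep.
Import mathcomp.boot.fintype mathcomp.boot.finset.
Variables (R : realType) (V : finType) (e : rel V) (b : V -> int).
Hypothesis e_tree : is_tree e.
Hypothesis b_neg : negative_definite e b.
Hypothesis nodes0 : nodes e != set0.
Implicit Types (x y z l : expo V) (u v w t m r c : V) (a d p : lpoly V) (f g : ratfun V).
Implicit Types (A B S T : {set V}) (L : R) (h : rat_quot V).

Local Notation Ed := (dual_vec e b).
Local Notation N := (nodes e).
Local Notation partial_zeta := (partial_zeta e b).
Local Notation ev := (ev e b).

(** The projections to the nodes of the elements of the translate of the cone
    by L times the sum of the E_u^*. *)
Definition deep L x : Prop := exists2 xi : V -> R, forall u, L <= xi u &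
  forall v, v \in N -> ratr (x v) = \sum_u xi u * ratr (Ed u v).

Lemma deep_mono L L' x : L <= L' -> deep L' x -> deep L x.
Proof. by move=> LL' [xi xiL Hx]; exists xi => // u; apply: le_trans (xiL u). Qed.

(** The two terms of the factor 1 - t^{E_v} count the same on a set invariant
    under E_v. *)
Lemma cnt_shift_axis (A : set (expo V)) v f : dfrac e b f -> bounded N A ->
  (forall y, A (y + axis v 1) <-> A y) -> cnt N A ((1 - mon (axis v 1))%:F * f) = 0.
Proof.
move=> Sf bA Ash; have ef := dfrac_expandable e_tree b_neg nodes0 Sf.
have -> : (1 - mon (axis v 1))%:F * f = f - (gmon 1 (axis v 1) : lpoly V)%:F * f.
  by rewrite tofracB tofrac1 mulrBl mul1r.
rewrite cntB //; last exact: expandableM.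
rewrite cnt_mon // mul1r (_ : shift _ _ = A) ?subrr //.
by apply/seteqP; split=> y /Ash.
Qed.

Lemma cong_cnt T f g (A : set (expo V)) : cong e b T f g -> dfrac e b g -> bounded N A ->
  (forall v y, v \in T -> A (y + axis v 1) <-> A y) -> cnt N A f = cnt N A g.
Proof.
move=> [s [sS ->]] Sg bA HA.
have Ss v : dfrac e b ((1 - mon (axis v 1))%:F * s v) by apply: dfracM (sS v); apply:
  dfrac_poly.
have Es v := dfrac_expandable e_tree b_neg nodes0 (Ss v).
rewrite cntD //; last by apply: expandable_sum => v _; apply: Es.
  rewrite cnt_sum //; rewrite big1 ?addr0 // => v vT.
  by apply: cnt_shift_axis => // y; apply: HA.
exact: dfrac_expandable Sg.
Qed.

Definition partial_numer B : lpoly V := \prod_(v in B :\: ends e) dual_binomial e b v ^+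
  (valency e v - 2).

Lemma partial_zeta_geom B : partial_zeta B = (partial_numer B)%:F * geom [seq Ed u | u <-
  enum (B :&: ends e)].
Proof.
rewrite /partial_zeta (bigID (fun v => v \in ends e)) /= mulrC /partial_numer rmorph_prod;
  congr (_ * _).
  rewrite /= (eq_bigl (fun v => v \in B :\: ends e)); last first.
    by move=> v; rewrite in_setD andbC.
  by apply: eq_bigr => v; rewrite in_setD => /andP[vE _]; rewrite weight_other // tofracXn.
rewrite /geom big_map big_enum /= (eq_bigl (fun v => v \in B :&: ends e)); last first.
  by move=> v; rewrite in_setI.
by apply: eq_bigr => v; rewrite in_setI => /andP[_ vE]; rewrite weight_end // exprN1.
Qed.

Lemma seq_bound (s : seq (expo V)) (F : V -> expo V -> rat) :
  exists B : rat, forall l, l \in s -> forall t, - B <= F t l.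
Proof.
elim: s => [|l s [B HB]]; first by exists 0.
exists (Num.max B (\sum_t `|F t l|)) => l'; rewrite inE => /predU1P[->|/HB h] t; last first.
  by apply: le_trans _ (h t); rewrite lerN2 le_max lexx.
have : - F t l <= \sum_t `|F t l|.
  by rewrite (bigD1 t) //= ler_wpDr ?sumr_ge0 // -normrN ler_norm.
rewrite lerNl => h; apply: le_trans _ h; by rewrite lerN2 le_max lexx orbT.
Qed.

(** If m separates two elements of S, then the terms small at S and not small
    at m cancel: after the cancellation in the branches that S does not meet,
    the remaining terms contradict the maximum principle. *)
Lemma separated_zero S m : S \subset N -> m \in N -> m \notin S ->
  (exists s1 s2, [/\ s1 \in S, s2 \in S, s1 != m, s2 != m & toward e m s1 != toward e m s2]) ->
  exists L, forall x h, deep L x ->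
    cnt N [set y : expo V | [/\ forall s, s \in S -> y s < x s, x m <= y m & cls y =
      h]]%classic
      (zeta_sum e b) = 0.
Proof.
move=> SN mN mS sep; pose T := ~: (m |: S).
have HT v : v \notin S -> v != m -> v \in T.
  by move=> vS vm; rewrite in_setC in_setU1 negb_or vm.
have [p [B [mB cB Bt]]] := front_root e_tree b_neg nodes0 HT sep.
have [s1 [_ [s1S _ _ _ _]]] := sep.
have mB' : m \in ~: B by rewrite in_setC.
have [g [pr [g0 gm pr0 prn mv]]] := mean_value e_tree b_neg mB'.
have [beta Hbeta] := seq_bound (enum_fset (gsupp (p * partial_numer B))) (fun t l => ev l t).
(* The denominators add vectors E_u^* with u in B, orthogonal to E_t for t
   outside B: beta bounds (y, E_t) from below for all exponents y, not only
   those of the numerator. *)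
exists (ratr beta + 1) => x h [xi xiL Hx].
set A := [set y | _]%classic.
have bA : bounded N A.
  exists (x s1) => y [h1 _ _]; exists s1; first exact: (subsetP SN).
  exact: h1.
have dfracB : dfrac e b (p%:F * partial_zeta B).
  by apply: dfracM; [exact: dfrac_poly | exact: dfrac_partial_zeta].
rewrite (cong_cnt cB dfracB bA); last first.
  move=> v y; rewrite in_setC in_setU1 negb_or => /andP[vm vS]; rewrite /A /=.
  have ym : (y + axis v 1) m = y m by rewrite !ffunE eq_sym (negPf vm) addr0.
  have ys s : s \in S -> (y + axis v 1) s = y s.
    by move=> sS; rewrite !ffunE; case: eqP => [sv|]; rewrite ?addr0 //; rewrite -sv sS in vS.
  rewrite ym (cls_lattice _ (axis_lattice v)); split=> -[h1 h2 h3]; split=> // s sS.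
    by rewrite -ys // h1.
  by rewrite ys // h1.
apply: csum0 => y [yS ym _]; apply/eqP/negPn/negP => cy.
have yK : forall t, t \notin B -> - beta <= ev y t.
  move: cy; rewrite partial_zeta_geom mulrA -tofracM.
  apply: (@geoms_supp _ N nodes0 (fun y => forall t, t \notin B -> - beta <= ev y t)).
    by move=> l lp t _; apply: Hbeta.
  move=> n /mapP[u]; rewrite mem_enum in_setI => /andP[uB _] ->; split.
    exact: dual_pos.
  move=> l Hl t tB; rewrite evD ev_dual //; have [ut|_] := eqVneq u t.
    by rewrite -ut uB in tB.
  by rewrite mulr0n oppr0 addr0 Hl.
pose rr : rat -> R := ratr.
have mvx : rr (x m) = \sum_(t in ~: B) xi t * rr (g t) + \sum_(t | t \notin ~: B) (\sum_u xi
  u * rr (Ed u t)) * rr (pr t).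
  rewrite /rr Hx // (eq_bigr (fun u => \sum_(t in ~: B) (xi u * rr (u == t)%:R) * rr (g t) +
      \sum_(t | t \notin ~: B) (xi u * rr (Ed u t)) * rr (pr t))); last first.
    move=> u _; rewrite [X in ratr X]mv rmorphD !rmorph_sum /= mulrDr !mulr_sumr.
    congr (_ + _); apply: eq_bigr => t _; rewrite rmorphM /= ?ev_dual // mulrA //.
    by rewrite opprK.
  rewrite big_split /= [X in X + _]exchange_big [X in _ + X]exchange_big /=; congr (_ + _).
    apply: eq_bigr => t _; rewrite (bigD1 t) //= eqxx /rr rmorph1 mulr1 big1 ?addr0 // => u ut.
    by rewrite (negPf ut) rmorph0 mulr0 mul0r.
  by apply: eq_bigr => t _; rewrite mulr_suml.
have mvy : rr (y m) = \sum_(t in ~: B) - rr (ev y t) * rr (g t) + \sum_(t | t \notin ~: B)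
  rr (y t) * rr (pr t).
  rewrite /rr mv rmorphD !rmorph_sum /=; congr (_ + _); apply: eq_bigr => t _.
    by rewrite rmorphM rmorphN.
  by rewrite rmorphM.
have : rr (x m) <= rr (y m) by rewrite /rr ler_rat.
apply/negP; rewrite -ltNge mvx mvy.
have rg t : 0 <= rr (g t) by rewrite /rr ler0q.
have rp t : 0 <= rr (pr t) by rewrite /rr ler0q.
have xiev t : t \notin B -> 1 <= xi t + rr (ev y t).
  move=> tB; have := xiL t; have : rr (- beta) <= rr (ev y t) by rewrite /rr ler_rat yK.
  by rewrite /rr rmorphN /=; lra.
apply: ltr_leD.
  rewrite -subr_gt0 -sumrB (bigD1 m) ?in_setC //=; apply: ltr_wpDr.
    apply: sumr_ge0 => t /andP[]; rewrite in_setC => tB _; rewrite -mulrBl opprK.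
    by apply: mulr_ge0 => //; have := xiev t tB; lra.
  rewrite -mulrBl opprK; apply: mulr_gt0; first by have := xiev m mB; lra.
  by rewrite /rr ltr0q.
apply: ler_sum => t; rewrite in_setC negbK => tB.
have [pt|pt] := eqVneq (pr t) 0; first by rewrite pt /rr rmorph0 !mulr0.
have tS : t \in S.
  have [t' t'B tt'] : exists2 t', t' \in ~: B & e t' t.
    apply: contrapT => nex; case/eqP: pt; apply: prn; first by rewrite in_setC negbK.
    by move=> t' t'B; apply/negP => tt'; apply: nex; exists t'.
  by apply: (Bt t') tt' tB; rewrite in_setC in t'B.
apply: ler_wpM2r => //; rewrite -Hx ?(subsetP SN) // /rr ler_rat.
exact/ltW/yS.
Qed.

End Deep.

Section Union.
Import mathcomp.boot.fintype mathcomp.boot.finset.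
Variables (R : realType) (V : finType) (e : rel V) (b : V -> int).
Hypothesis e_tree : is_tree e.
Hypothesis b_neg : negative_definite e b.
Variable rho : V.
Hypothesis rhoN : rho \in nodes e.
Implicit Types (x y z l : expo V) (u v w t m : V) (A S : {set V}) (L : R) (h : rat_quot V).

Local Notation N := (nodes e).
Local Notation parent := (parent e rho).
Local Notation deep := (@deep R V e b).

Let nodes0 : nodes e != set0. Proof. by apply/set0Pn; exists rho. Qed.

Definition all_small S x h : set (expo V) :=
  [set y : expo V | (forall s, s \in S -> y s < x s) /\ cls y = h]%classic.

Definition some_small S x h : set (expo V) :=
  [set y : expo V | (exists2 s, s \in S & y s < x s) /\ cls y = h]%classic.

Local Notation C := (expansion N (zeta_sum e b)).

Let lC : lfin N C.
Proof. exact/lfin_expansion/zeta_sum_expandable. Qed.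

Lemma all_small_bounded S x h s : s \in S -> s \in N -> bounded N (all_small S x h).
Proof. by move=> sS sN; exists (x s) => y [Hy _]; exists s => //; apply: Hy. Qed.

Lemma some_small_bounded S x h : S \subset N -> bounded N (some_small S x h).
Proof.
move=> SN; exists (\sum_v `|x v|) => y [[s sS ys] _]; exists s.
  exact: (subsetP SN).
apply: lt_le_trans ys _; rewrite (bigD1 s) //= ler_wpDr ?sumr_ge0 //.
exact: ler_norm.
Qed.

(** Inclusion-exclusion over the tree: a term small at the new node w and at
    an older node other than the parent m of w is small at m, or cancels. *)
Lemma union_count : exists L, forall x h, deep L x ->
  cnt N (some_small N x h) (zeta_sum e b) =
  \sum_(v in N) cnt N (all_small [set v] x h) (zeta_sum e b)
  - \sum_(w in N :\ rho) cnt N (all_small [set w; parent w] x h) (zeta_sum e b).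
Proof.
pose P A := exists L, forall x h, deep L x ->
  cnt N (some_small A x h) (zeta_sum e b) =
  \sum_(v in A) cnt N (all_small [set v] x h) (zeta_sum e b)
  - \sum_(w in A :\ rho) cnt N (all_small [set w; parent w] x h) (zeta_sum e b).
apply: (orb_ind e_tree rhoN (P := P)).
  exists 0 => x h _; rewrite big_set1 setDv big_set0 subr0; congr csum.
  apply/seteqP; split=> y [Hy yh]; split=> //.
    by case: Hy => s; rewrite inE => /eqP -> ys t; rewrite inE => /eqP ->.
  by exists rho; rewrite ?inE //; apply: Hy; rewrite inE.
move=> A w [L0 IH] AN wN wA wr rA mA uw nsep; set m := parent w in mA uw nsep.
have mN : m \in N by apply: (subsetP AN).
have wm : w != m by apply: contraNneq wA => ->.
pose X S x h := [set y : expo V | [/\ forall s, s \in w |: S -> y s < x s, x m <= y m & cls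
  y = h]]%classic.
have /choice[LS HLS] S : exists L, S \subset A :\ m -> S != set0 ->
    forall x h, deep L x -> cnt N (X S x h) (zeta_sum e b) = 0.
  have [SA|nSA] := boolP (S \subset A :\ m); last by exists 0.
  have [->|/set0Pn[s sS]] := eqVneq S set0; first by exists 0.
  have SA' t : t \in S -> (t != m) && (t \in A) by move=> /(subsetP SA); rewrite !inE.
  have [|||L HL] := @separated_zero R V e b e_tree b_neg nodes0 (w |: S) m _ mN _ _.
  - by apply/subsetP => t; rewrite inE => /orP[/set1P -> //|/SA'/andP[_ /(subsetP AN)]].
  - by rewrite !inE negb_or eq_sym wm; apply/negP => /SA'; rewrite eqxx.
  - have /andP[sm sA] := SA' s sS; exists w, s; split=> //; rewrite ?inE ?eqxx ?sS ?orbT //.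
    exact: nsep.
  by exists L.
pose L := `|L0| + \sum_S `|LS S|; exists L => x h dx.
have dx0 : deep L0 x.
  apply: deep_mono dx; rewrite /L (le_trans (ler_norm _)) // lerDl sumr_ge0 //.
have dxS S : deep (LS S) x.
  apply: deep_mono dx; rewrite /L (le_trans (ler_norm _)) // (bigD1 S) //=.
  by rewrite addrCA lerDl addr_ge0 // sumr_ge0.
have Xb S : bounded N (X S x h).
  by exists (x w) => y [Hy _ _]; exists w => //; apply: Hy; rewrite !inE eqxx.
(* By inclusion-exclusion, the terms small at w and at some node of s, but not
   at m, have sum zero as well. *)
have Xl (s : seq V) : {subset s <= A :\ m} -> forall S, S \subset A :\ m ->
   csum (X S x h `&` [set y | exists2 v, v \in s & y v < x v])%classic C = 0.
  elim: s => [|v s IHs] sA S SA.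
    by apply: csum0 => y [_ [v]]; rewrite in_nil.
  have vA : v \in A :\ m by apply: sA; rewrite mem_head.
  have sA' : {subset s <= A :\ m} by move=> t ts; apply: sA; rewrite inE ts orbT.
  have vSA : v |: S \subset A :\ m by rewrite subUset sub1set vA.
  have e1 : (X S x h `&` [set y | exists2 v0, v0 \in v :: s & y v0 < x v0] =
     X (v |: S) x h `|` (X S x h `&` [set y | exists2 v, v \in s & y v < x v]))%classic.
    apply/seteqP; split=> y.
      move=> [[h1 h2 h3] [v0]]; rewrite inE => /predU1P[->|v0s] yv; last first.
        by right; split=> //; exists v0.
      left; split=> // t; rewrite !inE => /or3P[/eqP ->|/eqP -> //|tS].
        by apply: h1; rewrite !inE eqxx.
      by apply: h1; rewrite !inE tS orbT.
    move=> [[h1 h2 h3]|[Xy [v0 v0s yv]]]; last first.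
      by split=> //; exists v0 => //; rewrite inE v0s orbT.
    split; last by exists v; rewrite ?mem_head //; apply: h1; rewrite !inE eqxx orbT.
    split=> // t; rewrite !inE => tS; apply: h1; rewrite !inE.
    by case/orP: tS => ->; rewrite ?orbT.
  have e2 : (X (v |: S) x h `&` (X S x h `&` [set y | exists2 v, v \in s & y v < x v]) =
     X (v |: S) x h `&` [set y | exists2 v, v \in s & y v < x v])%classic.
    apply/seteqP; split=> y; first by move=> [h1 [_ h2]].
    move=> [[h1 h2 h3] h4]; split=> //; split=> //; split=> // t.
    by rewrite !inE => tS; apply: h1; rewrite !inE; case/orP: tS => ->; rewrite ?orbT.
  rewrite e1 (csumU lC) //; last by apply: bounded_sub (Xb S) => y [].
  rewrite e2 !IHs // addr0 subr0; apply: (HLS (v |: S) vSA _ x h (dxS _)).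
  by apply/set0Pn; exists v; rewrite !inE eqxx.
have w1 : w \in [set w] by rewrite inE.
have bw := all_small_bounded x h w1 wN.
have bA : bounded N (some_small A x h) by apply: some_small_bounded.
have eU : some_small (w |: A) x h = (some_small A x h `|` all_small [set w] x h)%classic.
  apply/seteqP; split=> y.
    move=> [[v]]; rewrite !inE => /orP[/eqP ->|vA] yv yh; last by left; split=> //; exists v.
    by right; split=> // t; rewrite inE => /eqP ->.
  move=> [[[v vA yv] yh]|[Hy yh]]; split=> //; first by exists v; rewrite // !inE vA orbT.
  by exists w; rewrite ?inE ?eqxx //; apply: Hy; rewrite inE.
rewrite /cnt eU (csumU lC) // -/(cnt N _ _) IH //.
have eI : csum (some_small A x h `&` all_small [set w] x h)%classic C =
    cnt N (all_small [set w; m] x h) (zeta_sum e b).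
  rewrite (csumD1 [set y : expo V | y m < x m]%classic lC); last first.
    by apply: bounded_sub bA => y [].
  rewrite [X in _ + X](_ : _ = 0) ?addr0.
    congr csum; apply/seteqP; split=> y.
      move=> [[_ [Hy yh]] ym]; split=> // t; rewrite !inE => /orP[/eqP ->|/eqP ->] //.
      by apply: Hy; rewrite inE.
    move=> [Hy yh]; have ym : y m < x m by apply: Hy; rewrite !inE eqxx orbT.
    split=> //; split; split=> //; first by exists m.
    by move=> t; rewrite inE => /eqP ->; apply: Hy; rewrite !inE eqxx.
  rewrite -(Xl (enum (A :\ m)) _ set0) ?sub0set //; last by move=> t; rewrite mem_enum.
  congr csum; apply/seteqP; split=> y.
    move=> [[[[v vA yv] _] [Hy yh]] /negP]; rewrite -leNgt => ym; split.
      by split=> // t; rewrite setU0; apply: Hy.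
    exists v => //; rewrite mem_enum !inE vA andbT; apply: contraTneq yv => ->.
    by rewrite -leNgt.
  move=> [[Hy ym yh] [v]]; rewrite mem_enum !inE => /andP[vm vA] yv; split.
    split; first by split=> //; exists v.
    by split=> // t tw; apply: Hy; rewrite setU0.
  by apply/negP; rewrite -leNgt.
rewrite eI (big_setU1 w) //=.
have -> : (w |: A) :\ rho = w |: (A :\ rho).
  apply/setP => t; rewrite !inE; have [->|//] := eqVneq t w; by rewrite wr.
rewrite (big_setU1 w) /=; last by rewrite !inE negb_and wA orbT.
by rewrite /cnt -/m; ring.
Qed.

End Union.

(** * Polynomial counting functions *)

Section PolyFun.
Variable R : realType.
Implicit Types (F G : int -> int -> R) (a b : int).

(** Polynomial functions of two integers; as an inductive predicate, they are
    closed under substitution by structural induction. *)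
Inductive polyfun : (int -> int -> R) -> Prop :=
| polyfun_const k : polyfun (fun _ _ => k)
| polyfun_fst : polyfun (fun a _ => a%:~R)
| polyfun_snd : polyfun (fun _ b => b%:~R)
| polyfun_add F G : polyfun F -> polyfun G -> polyfun (fun a b => F a b + G a b)
| polyfun_mul F G : polyfun F -> polyfun G -> polyfun (fun a b => F a b * G a b).

Lemma polyfun_subst F (A B : int -> int -> int) : polyfun F ->
  polyfun (fun a b => (A a b)%:~R) -> polyfun (fun a b => (B a b)%:~R) ->
  polyfun (fun a b => F (A a b) (B a b)).
Proof.
move=> pF pA pB; elim: pF => //= {F} [k|F G _ pF _ pG|F G _ pF _ pG].
- exact: polyfun_const.
- exact: polyfun_add.
- exact: polyfun_mul.
Qed.

Lemma polyfun_sum (n : nat) (F : nat -> int -> int -> R) :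
  (forall i, polyfun (F i)) -> polyfun (fun a b => \sum_(i < n) F i a b).
Proof.
move=> pF; elim: n => [|n IH].
  rewrite (_ : (fun _ _ => _) = fun _ _ => 0); first exact: polyfun_const.
  by apply/funext => a; apply/funext => b; rewrite big_ord0.
rewrite (_ : (fun _ _ => _) = fun a b => \sum_(i < n) F i a b + F n a b).
  exact: polyfun_add.
by apply/funext => a; apply/funext => b; rewrite big_ord_recr.
Qed.

Lemma polyfun_horner_fst (p : {poly R}) : polyfun (fun a _ => p.[a%:~R]).
Proof.
elim/poly_ind: p => [|p k IH].
  rewrite (_ : (fun _ _ => _) = fun _ _ => 0); first exact: polyfun_const.
  by apply/funext => a; apply/funext => b; rewrite horner0.
rewrite (_ : (fun _ _ => _) = fun a b : int => p.[a%:~R] * a%:~R + k).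
  exact: (polyfun_add (polyfun_mul IH polyfun_fst) (polyfun_const k)).
by apply/funext => a; apply/funext => b; rewrite hornerMXaddC.
Qed.

Lemma polyfun_horner_snd (p : {poly R}) : polyfun (fun _ b => p.[b%:~R]).
Proof.
exact: (polyfun_subst (polyfun_horner_fst p) polyfun_snd polyfun_fst).
Qed.

Lemma polyfun_bipoly F : polyfun F ->
  exists p : {poly {poly R}}, forall a b, F a b = (p.[b%:~R%:P]).[a%:~R].
Proof.
elim=> {F} [k|||F G _ [p pE] _ [q qE]|F G _ [p pE] _ [q qE]].
- by exists k%:P%:P => a b; rewrite !hornerC.
- by exists 'X%:P => a b; rewrite hornerC hornerX.
- by exists 'X => a b; rewrite hornerX hornerC.
- by exists (p + q) => a b; rewrite !hornerD pE qE.
- by exists (p * q) => a b; rewrite !hornerM pE qE.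
Qed.

(** Falling factorials behave under differences as powers under derivation. *)
Lemma antidifference (p : {poly R}) :
  exists P : {poly R}, forall x, P.[x] - P.[x - 1] = p.[x].
Proof.
pose ff n : {poly R} := \prod_(i <- iota 0 n) ('X - (i%:R)%:P).
have ffS n x : (ff n.+1).[x] = (ff n).[x] * (x - n%:R).
  by rewrite /ff -addn1 iotaD big_cat big_seq1 hornerM !hornerE.
have ffx n x : (ff n.+1).[x] = x * (ff n).[x - 1].
  elim: n x => [|n IH] x; first by rewrite ffS /ff !big_nil !hornerE mulr0n subr0.
  by rewrite ffS IH ffS -addn1 natrD; ring.
have diff n x : (ff n.+1).[x + 1] - (ff n.+1).[x] = n.+1%:R * (ff n).[x].
  by rewrite ffx addrK ffS -addn1 natrD; ring.
suff: forall n (q : {poly R}), (size q <= n)%N -> exists P : {poly R}, forall x, P.[x + 1] -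
  P.[x] = q.[x].
  move=> /(_ _ _ (leqnn (size p)))[P HP]; exists (P \Po ('X + 1)) => x.
  by rewrite !horner_comp !hornerE subrK HP.
elim=> [|n IH] q.
  rewrite leqn0 size_poly_eq0 => /eqP ->; exists 0 => x.
  by rewrite !horner0 subrr.
move=> sq; pose q' := q - q`_n *: ff n.
have sff : size (ff n) = n.+1 by rewrite size_prod_XsubC size_iota.
have mff : (ff n)`_n = 1.
  have /monicP : ff n \is monic by apply: monic_prod_XsubC.
  by rewrite lead_coefE sff.
have [|P HP] := IH q'.
  apply/leq_sizeP => i ni; rewrite coefB coefZ.
  have [->|ni'] := eqVneq i n; first by rewrite mff mulr1 subrr.
  have {}ni' : (n < i)%N by rewrite ltn_neqAle eq_sym ni' ni.
  have sfi : (size (ff n) <= i)%N by rewrite sff.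
  by rewrite (nth_default 0 (leq_trans sq ni')) (nth_default 0 sfi) mulr0 subr0.
exists (P + (q`_n / n.+1%:R) *: ff n.+1) => x.
have n0 : n.+1%:R != 0 :> R by rewrite pnatr_eq0.
have e0 : P.[x + 1] - P.[x] = q.[x] - q`_n * (ff n).[x] by rewrite HP /q' hornerD hornerN
  hornerZ.
have e1 := diff n x; rewrite !hornerD !hornerZ.
have -> : q.[x] = P.[x + 1] - P.[x] + q`_n * (ff n).[x] by lra.
have -> : (ff n).[x] = ((ff n.+1).[x + 1] - (ff n.+1).[x]) / n.+1%:R by rewrite e1 mulrC mulKf.
by ring.
Qed.

Lemma polyfun_antidifference F : polyfun F ->
  exists2 G, polyfun G & forall a b, G a b - G a (b - 1) = F a b.
Proof.
case/polyfun_bipoly => p pE.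
have /choice[S HS] i := antidifference 'X^i.
exists (fun a b => \sum_(i < size p) (p`_i).[a%:~R] * (S i).[b%:~R]).
  apply: (polyfun_sum _ (F := fun i a b => (p`_i).[a%:~R] * (S i).[b%:~R])) => i; apply:
    polyfun_mul.
    exact: polyfun_horner_fst.
  exact: polyfun_horner_snd.
move=> a b; rewrite -sumrB pE (horner_coef p) horner_sum; apply: eq_bigr => i _.
by rewrite -mulrBr rmorphB /= HS !hornerE.
Qed.

(** A sum of values of a polynomial is polynomial, and the recursion can be
    read in both directions from the known zero at J: the range of validity
    gains one step downwards. In the counts below, this step is what reaches
    the origin. *)
Lemma polyfun_step G0 (K J : int) : polyfun G0 -> K <= J ->
  exists2 G1, polyfun G1 & forall F0 F1,
    (forall a b, 0 <= a -> F1 a b - F1 a (b - 1) = F0 a b) ->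
    (forall a b, 0 <= a -> K < b -> F0 a b = G0 a b) ->
    (forall a, 0 <= a -> F1 a J = 0) ->
    forall a b, 0 <= a -> K - 1 < b -> F1 a b = G1 a b.
Proof.
move=> pG0 KJ; have [G pG HG] := polyfun_antidifference pG0.
pose G1 a b := G a b + (-1) * G a J; exists G1.
  apply: polyfun_add => //; apply: polyfun_mul; first exact: polyfun_const.
  by apply: (polyfun_subst pG); [exact: polyfun_fst | exact: polyfun_const].
move=> F0 F1 HF HF0 FJ a b a0 Kb.
have stepF c : K < c -> F1 a c - G1 a c = F1 a (c - 1) - G1 a (c - 1).
  move=> Kc; have := HF a c a0; have := HF0 a c a0 Kc; have := HG a c.
  by rewrite /G1; lra.
have up (n : nat) : F1 a (J + n%:Z) - G1 a (J + n%:Z) = 0.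
  elim: n => [|n IH]; first by rewrite addr0 /G1 FJ //; ring.
  rewrite stepF; last by lia.
  by rewrite -[n.+1]addn1 PoszD addrA addrK.
have down (n : nat) : K <= J - n%:Z -> F1 a (J - n%:Z) - G1 a (J - n%:Z) = 0.
  elim: n => [|n IH] Kn; first by rewrite subr0 /G1 FJ //; ring.
  rewrite -IH; last by lia.
  rewrite [RHS]stepF; last by lia.
  by rewrite -[n.+1]addn1 PoszD opprD addrA.
apply/eqP; rewrite -subr_eq0; apply/eqP.
have [Jb|bJ] := leP J b.
  have -> : b = J + `|b - J|%N%:Z by rewrite gez0_abs; lia.
  exact: up.
have -> : b = J - `|J - b|%N%:Z by rewrite gez0_abs; lia.
by apply: down; rewrite gez0_abs; lia.
Qed.

End PolyFun.

Section PolyCount.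
Variables (R : realType) (V : finType) (N : {set V}).
Hypothesis N0 : N != finset.set0.
Implicit Types (x y z l n : expo V) (f : ratfun V) (A : set (expo V)).

Definition additive_fun (mu : expo V -> rat) : Prop := {morph mu : x y / x + y}.

Lemma additive_funM mu x k : additive_fun mu -> mu (x *+ k) = mu x *+ k.
Proof.
move=> muD; have mu0 : mu 0 = 0 by apply: (addrI (mu 0)); rewrite -muD !addr0.
by elim: k => [|k IH]; rewrite ?mulr0n // !mulrS muD IH.
Qed.

(** Multiplying by 1 - t^n turns a count over A into its difference with the
    count over a translate of A. *)
Lemma count_step A A' f n : expandable N f -> posN N n -> bounded N A ->
  (forall l, A (l + n) <-> A' l) ->
  cnt N A (f / (1 - mon n)%:F) - cnt N A' (f / (1 - mon n)%:F) = cnt N A f.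
Proof.
move=> ef pn bA AA'; rewrite -(cnt_geom N0 ef pn bA); congr (_ - cnt _ _ _).
by apply/seteqP; split=> l /AA'.
Qed.

Lemma geom_cons n s : geom (n :: s) = ((1 - mon n)%:F)^-1 * geom s.
Proof. by rewrite /geom big_cons. Qed.

Lemma mon_geom_expandable a s : {in s, forall n, posN N n} -> expandable N (a%:F * geom s).
Proof. by move=> ps; apply: expandable_geoms => //; apply: expandable_poly. Qed.

Lemma lt_floor (q : rat) (k : int) : (Num.floor q < k) = (q < k%:~R).
Proof. by rewrite floor_lt_int. Qed.

Section Directions.
Variables (mu : expo V -> rat) (nu : rat) (z : expo V).
Hypotheses (muD : additive_fun mu) (nu0 : 0 < nu).

(** Each geometric series adds a summation. The count vanishes at the level of
    floor (mu z / nu), which provides the initial value, and each summation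
    extends the polynomial formula by one unit below. The invariant condition
    P0 makes room for a second direction. *)
Lemma count_one_direction (s : seq (expo V)) :
  {in s, forall n, posN N n /\ mu n = nu} ->
  exists2 G : int -> int -> R, polyfun G & forall (P0 : set (expo V)),
    (forall n l, n \in s -> P0 (l + n) <-> P0 l) -> P0 z ->
    (forall B, bounded N [set l | P0 l /\ mu l < B]%classic) ->
    forall X : int, Num.floor (mu z / nu) - (size s)%:Z < X ->
    (cnt N [set l | P0 l /\ mu l < X%:~R * nu]%classic ((mon z)%:F * geom s))%:~R = G 0 X.
Proof.
elim: s => [|n s IHs] Hs.
  exists (fun _ _ => 1); first exact: polyfun_const.
  move=> P0 _ P0z bP X; rewrite subr0 => zX.
  rewrite /geom big_nil mulr1 cnt_poly // csum_poly; last first.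
    move=> l /gsupp_mon ->; split=> //; move: zX; rewrite lt_floor.
    by rewrite ltr_pdivrMr.
  by rewrite /eval_one (gsum_mon _ _ (F := fun r _ => r)).
have Hs' : {in s, forall n, posN N n /\ mu n = nu}.
  by move=> m ms; apply: Hs; rewrite inE ms orbT.
have [G0 pG0' HG0] := IHs Hs'; set J := Num.floor (mu z / nu).
have pG0 : polyfun (fun _ b => G0 0 b).
  by apply: (polyfun_subst pG0'); [exact: (polyfun_const (0 : int)%:~R) | exact: polyfun_snd].
have KJ : J - (size s)%:Z <= J by rewrite gerBl.
have [G1 pG1 HG1] := polyfun_step pG0 KJ.
exists (fun a b => G1 0 b).
  by apply: (polyfun_subst pG1); [exact: (polyfun_const (0 : int)%:~R) | exact: polyfun_snd].
move=> P0 P0s P0z bP X; have [pn mun] := Hs n (mem_head _ _).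
pose A X := [set l | P0 l /\ mu l < X%:~R * nu]%classic.
pose F1 (_ X : int) : R := (cnt N (A X) ((mon z)%:F * geom (n :: s)))%:~R.
pose F0 (_ X : int) : R := (cnt N (A X) ((mon z)%:F * geom s))%:~R.
have P0s' m l : m \in s -> P0 (l + m) <-> P0 l by move=> ms; apply: P0s; rewrite inE ms orbT.
rewrite /= -addn1 PoszD opprD addrA => zX.
apply: (HG1 F0 F1) => // [a Y _|a Y _ KY|a _].
- rewrite /F1 /F0 geom_cons -rmorphB /= mulrCA mulrC; congr (_%:~R).
  apply: count_step; [by apply: mon_geom_expandable => m /Hs'[] | exact: pn | exact: bP |].
  move=> l; rewrite /A /= P0s ?mem_head // muD mun rmorphB /= mulrBl mul1r.
  by split=> -[? h]; split=> //; move: h; lra.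
- by rewrite /F0 HG0.
- rewrite /F1 /cnt csum0 // => l [_ lJ]; apply/eqP/negPn/negP => cl.
  have JE : J%:~R * nu <= mu z by rewrite -ler_pdivlMr // floor_le.
  suff : mu z <= mu l by rewrite leNgt (lt_le_trans lJ).
  move: cl; apply: (geoms_supp N0 (K := fun l => mu z <= mu l)); first by move=> y
    /gsupp_mon ->.
  move=> m /Hs[pm mum]; split=> // y zy.
  by rewrite muD mum (le_trans zy) // lerDl ltW.
Qed.

Variables (lam : expo V -> rat) (nu' : rat) (rho : nat).
Hypotheses (lamD : additive_fun lam) (nu'0 : 0 < nu').

(** The directions of s come first: lam is constant along them. In the
    coordinates (a, b) a direction of s' moves b alone, so its geometric
    series is a summation over b with parameter a. *)
Lemma count_two_directions (s s' : seq (expo V)) :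
  {in s, forall n, [/\ posN N n, mu n = nu & lam n = 0]} ->
  {in s', forall n, [/\ posN N n, mu n = rho%:R * nu & lam n = nu']} ->
  (forall B B', bounded N [set l | lam l < B' /\ mu l < B]%classic) ->
  mu z - rho%:R * nu * (lam z / nu') < (size s)%:R * nu ->
  exists2 G : int -> int -> R, polyfun G & forall a b : int, 0 <= a ->
    Num.floor (lam z / nu') - (size s')%:Z < b ->
    (cnt N [set l | lam l < b%:~R * nu' /\ mu l < (a + rho%:Z * b)%:~R * nu]%classic
      ((mon z)%:F * geom s * geom s'))%:~R = G a b.
Proof.
move=> Hs Hs' bdd zk; elim: s' Hs' => [|n s' IHs] Hs'.
  have [|G pG HG] := @count_one_direction s; first by move=> n /Hs[].
  exists (fun a b => G 0 (a + rho%:Z * b)).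
    apply: (polyfun_subst pG); first exact: (polyfun_const (0 : int)%:~R).
    rewrite (_ : (fun _ _ => _) = fun a b : int => a%:~R + rho%:R * b%:~R).
      apply: polyfun_add (polyfun_fst _) _; apply: polyfun_mul (polyfun_snd _).
      exact: polyfun_const.
    by apply/funext => a; apply/funext => b; rewrite rmorphD rmorphM.
  move=> a b a0; rewrite subr0 lt_floor => zb.
  rewrite /geom big_nil mulr1 -/(geom s).
  apply: (HG [set l | lam l < b%:~R * nu']%classic).
  - by move=> m l /Hs[_ _ lm]; rewrite /= lamD lm addr0.
  - by move: zb; rewrite ltr_pdivrMr.
  - by move=> B; apply: bdd.
  - rewrite ltrBlDr lt_floor ltr_pdivrMr //; apply: lt_le_trans (_ : rho%:R * nu * (lam z /
    nu') + (size s)%:R * nu <= _).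
      by move: zk; lra.
    rewrite rmorphD rmorphD rmorphM /= -pmulrn -[X in _ <= (_ + X%:R) * _]/(size s).
    rewrite [X in _ <= X]mulrDl lerD2r.
    have a0' : 0 <= a%:~R :> rat by rewrite ler0z.
    apply: le_trans (_ : rho%:R * nu * b%:~R <= _).
      by apply: ler_wpM2l; [rewrite mulr_ge0 // ltW | rewrite ltW].
    by rewrite mulrDl mulrAC lerDr mulr_ge0 // ltW.
have Hs'' : {in s', forall n, [/\ posN N n, mu n = rho%:R * nu & lam n = nu']}.
  by move=> m ms; apply: Hs'; rewrite inE ms orbT.
have [G0 pG0 HG0] := IHs Hs''; set J := Num.floor (lam z / nu').
have KJ : J - (size s')%:Z <= J by rewrite gerBl.
have [G1 pG1 HG1] := polyfun_step pG0 KJ; exists G1 => // a b a0.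
have [pn mun lamn] := Hs' n (mem_head _ _).
pose A (a b : int) := [set l | lam l < b%:~R * nu' /\ mu l < (a + rho%:Z * b)%:~R *
  nu]%classic.
pose F1 a b : R := (cnt N (A a b) ((mon z)%:F * geom s * geom (n :: s')))%:~R.
pose F0 a b : R := (cnt N (A a b) ((mon z)%:F * geom s * geom s'))%:~R.
have eF : expandable N ((mon z)%:F * geom s * geom s').
  rewrite -mulrA; have -> : geom s * geom s' = geom (s ++ s') by rewrite /geom big_cat.
  by apply: mon_geom_expandable => m; rewrite mem_cat => /orP[/Hs[]|/Hs''[]].
rewrite /= -addn1 PoszD opprD addrA => zb.
apply: (HG1 F0 F1 _ _ _ a b a0 zb) => [a' b' _|a' b' a0' Kb|a' _].
- rewrite /F1 /F0 geom_cons -rmorphB /= mulrCA mulrC; congr (_%:~R).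
  apply: count_step; [exact: eF | exact: pn | exact: bdd |].
  move=> l; rewrite /A /= muD mun lamD lamn !(rmorphB, rmorphD, rmorphM) /=.
  by split=> -[h1 h2]; split; move: h1 h2; rewrite -?pmulrn; lra.
- by rewrite /F0 HG0.
- rewrite /F1 /cnt csum0 // => l [lJ _]; apply/eqP/negPn/negP => cl.
  have JE : J%:~R * nu' <= lam z by rewrite -ler_pdivlMr // floor_le.
  suff : lam z <= lam l by rewrite leNgt (lt_le_trans lJ).
  move: cl; rewrite -mulrA (_ : geom s * geom (n :: s') = geom (s ++ n :: s')); last first.
    by rewrite /geom big_cat.
  apply: (geoms_supp N0 (K := fun l => lam z <= lam l)); first by move=> y /gsupp_mon ->.
  move=> m; rewrite mem_cat => /orP[/Hs[pm _ lm]|/Hs'[pm _ lm]]; split=> // y zy;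
    by rewrite lamD lm ?addr0 // (le_trans zy) // lerDl ltW.
Qed.

End Directions.

End PolyCount.

(** * Quasipolynomials on the deep part of the cone *)

Section Good.
Import -(notations) mpoly.
Variables (R : realType) (V : finType) (e : rel V) (b : V -> int).
Hypothesis nodes0 : nodes e != finset.set0.
Implicit Types (x y z l n : expo V) (u v w : V) (L : R) (F G : expo V -> R).

Local Notation Ed := (dual_vec e b).
Local Notation N := (nodes e).
Local Notation deep := (@deep R V e b).

Definition coords x (i : 'I_#|V|) : R := ratr (x (enum_val i)).

Definition mpfun F : Prop := exists p : mpoly.mpoly #|V| R,
  forall x, F x = mpoly.meval (coords x) p.

Lemma mpfun_const k : mpfun (fun=> k).
Proof. by exists (mpoly.mpolyC #|V| k) => x; rewrite mpoly.mevalC. Qed.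

Lemma mpfunD F G : mpfun F -> mpfun G -> mpfun (fun x => F x + G x).
Proof. by move=> [p Fp] [q Gq]; exists (p + q) => x; rewrite mpoly.mevalD Fp Gq. Qed.

Lemma mpfunM F G : mpfun F -> mpfun G -> mpfun (fun x => F x * G x).
Proof. by move=> [p Fp] [q Gq]; exists (p * q) => x; rewrite mpoly.mevalM Fp Gq. Qed.

Lemma mpfun_coord v : mpfun (fun x => ratr (x v)).
Proof.
exists (mpoly.mpolyX R (mpoly.mnm1 (enum_rank v))) => x.
by rewrite mpoly.mevalXU /coords enum_rankK.
Qed.

Lemma mpfun_sum (I : Type) (s : seq I) (P : pred I) (F : I -> expo V -> R) :
  (forall i, mpfun (F i)) -> mpfun (fun x => \sum_(i <- s | P i) F i x).
Proof.
move=> mF; elim: s => [|i s IHs].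
  rewrite (_ : (fun x => _) = fun=> 0); first exact: mpfun_const.
  by apply/funext => x; rewrite big_nil.
case Pi : (P i).
  rewrite (_ : (fun x => _) = fun x => F i x + \sum_(i <- s | P i) F i x); first exact: mpfunD.
  by apply/funext => x; rewrite big_cons Pi.
rewrite (_ : (fun x => _) = fun x => \sum_(i <- s | P i) F i x) //.
by apply/funext => x; rewrite big_cons Pi.
Qed.

Lemma polyfun_mpfun (G : int -> int -> R) (A B : expo V -> R) : polyfun G ->
  mpfun A -> mpfun B -> exists2 H, mpfun H &
    forall x (i j : int), A x = i%:~R -> B x = j%:~R -> H x = G i j.
Proof.
move=> pG mA mB; elim: pG => {G} [k|||F G _ [H1 m1 E1] _ [H2 m2 E2]|F G _ [H1 m1 E1] _ [H2
  m2 E2]].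
- by exists (fun=> k) => //; apply: mpfun_const.
- by exists A.
- by exists B.
- exists (fun x => H1 x + H2 x); first exact: mpfunD.
  by move=> x i j Ai Bj; rewrite (E1 x i j) // (E2 x i j).
- exists (fun x => H1 x * H2 x); first exact: mpfunM.
  by move=> x i j Ai Bj; rewrite (E1 x i j) // (E2 x i j).
Qed.

Definition linear_fun (mu : expo V -> rat) : Prop :=
  exists c : V -> rat, forall x, mu x = \sum_(v in N) c v * x v.

Lemma linear_additive mu : linear_fun mu -> additive_fun mu.
Proof.
move=> [c cE] x y; rewrite !cE -big_split; apply: eq_bigr => v _.
by rewrite ffunE mulrDr.
Qed.

Lemma linear_fun0 mu : linear_fun mu -> mu 0 = 0.
Proof. by move=> [c cE]; rewrite cE big1 // => v _; rewrite ffunE mulr0. Qed.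

Lemma linear_coord v : v \in N -> linear_fun (fun x => x v).
Proof.
move=> vN; exists (fun w => (w == v)%:R) => x.
rewrite (bigD1 v) //= eqxx mul1r big1 ?addr0 // => w /andP[_ /negPf ->].
by rewrite mul0r.
Qed.

Lemma linear_funD mu mu' : linear_fun mu -> linear_fun mu' -> linear_fun (fun x => mu x +
  mu' x).
Proof.
move=> [c cE] [c' cE']; exists (fun v => c v + c' v) => x.
by rewrite cE cE' -big_split; apply: eq_bigr => v _; rewrite mulrDl.
Qed.

Lemma linear_funZ k mu : linear_fun mu -> linear_fun (fun x => k * mu x).
Proof.
move=> [c cE]; exists (fun v => k * c v) => x; rewrite cE mulr_sumr.
by apply: eq_bigr => v _; rewrite mulrA.
Qed.

Lemma linear_mpfun mu : linear_fun mu -> mpfun (fun x => ratr (mu x)).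
Proof.
move=> [c cE]; rewrite (_ : (fun x => _) = fun x => \sum_(v in N) ratr (c v) * ratr (x v)).
  by apply: mpfun_sum => v; apply: mpfunM; [exact: mpfun_const | exact: mpfun_coord].
by apply/funext => x; rewrite cE rmorph_sum; apply: eq_bigr => v _; rewrite rmorphM.
Qed.

Definition divisible (K : nat) x : Prop := forall v, v \in N -> x v / K%:R \is a Num.int.

Lemma divisible_mull (K K' : nat) x : (0 < K')%N -> divisible (K * K') x -> divisible K x.
Proof.
move=> K0 xd v vN; have := xd v vN; rewrite natrM invfM => h.
have -> : x v / K%:R = x v * (K%:R^-1 * K'%:R^-1) * K'%:R.
  by rewrite -!mulrA mulVf ?mulr1 // pnatr_eq0 -lt0n.
by rewrite rpredM // rpred_nat.
Qed.

Lemma linear_divisible mu : linear_fun mu -> exists2 K : nat, (0 < K)%N &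
  forall x, divisible K x -> mu x \is a Num.int.
Proof.
move=> [c cE]; have [K K0 HK] := common_denom [seq c v | v <- enum V].
exists K => // x xd; rewrite cE rpred_sum // => v vN.
have -> : c v * x v = (c v * K%:R) * (x v / K%:R).
  by rewrite mulrACA divff ?mulr1 // pnatr_eq0 -lt0n.
rewrite rpredM // ?xd //; apply: HK; apply/mapP; exists v => //; exact: mem_enum.
Qed.

Lemma deep_linear mu L x : linear_fun mu -> deep L x -> exists2 xi : V -> R,
  forall u, L <= xi u & ratr (mu x) = \sum_u xi u * ratr (mu (Ed u)).
Proof.
move=> [c cE] [xi xiL Hx]; exists xi => //; rewrite cE rmorph_sum.
rewrite (eq_bigr (fun v => \sum_u xi u * ratr (c v * Ed u v))).
  rewrite exchange_big; apply: eq_bigr => u _ /=.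
  by rewrite cE rmorph_sum mulr_sumr.
move=> v vN; rewrite rmorphM /= Hx // mulr_sumr; apply: eq_bigr => u _.
by rewrite rmorphM /= mulrCA.
Qed.

Lemma deep_ge0 mu x : linear_fun mu -> (forall u, 0 <= mu (Ed u)) -> deep 0 x -> 0 <= mu x.
Proof.
move=> lmu mu0 /(deep_linear lmu)[xi xi0 E]; rewrite -(ler0q R) E.
by apply: sumr_ge0 => u _; rewrite mulr_ge0 // ler0q.
Qed.

(** The bound L is determined by E_{u0}^* alone, the others contributing
    nonnegative terms. *)
Lemma deep_large mu u0 (M : rat) : linear_fun mu -> (forall u, 0 <= mu (Ed u)) ->
  0 < mu (Ed u0) -> exists2 L, 0 <= L & forall x, deep L x -> M < mu x.
Proof.
move=> lmu mu0 mu1; have c0 : 0 <= (`|M| + 1) / mu (Ed u0).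
  by rewrite divr_ge0 ?(ltW mu1) // addr_ge0.
exists (ratr ((`|M| + 1) / mu (Ed u0))); first by rewrite ler0q.
move=> x /(deep_linear lmu)[xi xiL E]; rewrite -(ltr_rat R) E.
have xi0 u : 0 <= xi u.
  by apply: le_trans (xiL u); rewrite ler0q.
rewrite (bigD1 u0) //=; apply: ltr_wpDr.
  by apply: sumr_ge0 => u _; rewrite mulr_ge0 // ler0q.
apply: lt_le_trans (_ : ratr (`|M| + 1) <= _).
  by rewrite ltr_rat (le_lt_trans (ler_norm M)) // ltrDl.
have -> : ratr (`|M| + 1) = ratr ((`|M| + 1) / mu (Ed u0)) * ratr (mu (Ed u0)) :> R.
  by rewrite -rmorphM /= divfK // gt_eqF.
by apply: ler_wpM2r => //; rewrite ler0q ltW.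
Qed.

(** Only a sublattice matters for a periodic constant; the elements whose
    coordinates at the nodes are multiples of K serve for every function at
    hand, as they allow passing to a common multiple. *)
Definition good F (k : R) : Prop := exists L (K : nat) G,
  [/\ (0 < K)%N, mpfun G, G 0 = k & forall x, deep L x -> divisible K x -> F x = G x].

Lemma good_const k : good (fun=> k) k.
Proof. by exists 0, 1%N, (fun=> k); split=> //; apply: mpfun_const. Qed.

Lemma good_eq F F' k : (exists L, forall x, deep L x -> F x = F' x) -> good F' k -> good F k.
Proof.
move=> [L HL] [L' [K [G [K0 mG G0 HG]]]]; exists (Num.max L L'), K, G; split=> // x dx xK.
rewrite HL ?HG //; apply: deep_mono dx; by rewrite le_max lexx ?orbT.
Qed.

Lemma goodD F F' k k' : good F k -> good F' k' -> good (fun x => F x + F' x) (k + k').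
Proof.
move=> [L [K [G [K0 mG G0 HG]]]] [L' [K' [G' [K0' mG' G0' HG']]]].
exists (Num.max L L'), (K * K')%N, (fun x => G x + G' x); split.
- by rewrite muln_gt0 K0.
- exact: mpfunD.
- by rewrite G0 G0'.
- move=> x dx xK; rewrite (HG x) ?(HG' x) //.
  + by apply: deep_mono dx; rewrite le_max lexx orbT.
  + by rewrite mulnC in xK; apply: divisible_mull K0 xK.
  + by apply: deep_mono dx; rewrite le_max lexx.
  + exact: divisible_mull K0' xK.
Qed.

Lemma goodZ F k c : good F k -> good (fun x => c * F x) (c * k).
Proof.
move=> [L [K [G [K0 mG G0 HG]]]]; exists L, K, (fun x => c * G x); split=> //.
- by apply: mpfunM => //; apply: mpfun_const.
- by rewrite G0.
- by move=> x dx xK; rewrite HG.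
Qed.

Lemma good_sum (I : eqType) (s : seq I) (P : pred I) (F : I -> expo V -> R) (k : I -> R) :
  (forall i, i \in s -> P i -> good (F i) (k i)) ->
  good (fun x => \sum_(i <- s | P i) F i x) (\sum_(i <- s | P i) k i).
Proof.
elim: s => [|i s IHs] gF.
  rewrite (_ : (fun x => _) = fun=> 0); first by rewrite big_nil; exact: good_const.
  by apply/funext => x; rewrite big_nil.
have gs : good (fun x => \sum_(i <- s | P i) F i x) (\sum_(i <- s | P i) k i).
  by apply: IHs => j js; apply: gF; rewrite inE js orbT.
rewrite (_ : (fun x => _) = fun x => (if P i then F i x else 0) + \sum_(i <- s | P i) F i
  x); last first.
  by apply/funext => x; rewrite big_cons; case: ifP; rewrite ?add0r.
rewrite big_cons; case: ifP => Pi.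
  by apply: goodD gs; apply: gF; rewrite ?mem_head.
by rewrite -[\sum_(_ <- _ | _) _]add0r; apply: goodD gs; apply: good_const.
Qed.

Lemma cnt_sum_mon (A : set (expo V)) p f : expandable N f -> bounded N A ->
  cnt N A (p%:F * f) = \sum_(z <- gsupp p) gcoef p z * cnt N A ((mon z)%:F * f).
Proof.
move=> ef bA; rewrite cntM //; apply: eq_bigr => z _.
by rewrite cnt_mon // mul1r.
Qed.

(** On a sublattice the coordinates (a, b) of x are integers, and nonnegative
    when x is in the cone. The bounds on p put the origin within the range of
    the polynomial formula, where the count is empty because lam is
    nonnegative on all exponents. *)
Lemma good_geom_two (lam mu : expo V -> rat) (nu nu' : rat) (rho : nat) (s s' : seq (expo
  V)) p :
  linear_fun lam -> linear_fun mu -> 0 < nu -> 0 < nu' ->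
  {in s, forall n, [/\ posN N n, mu n = nu & lam n = 0]} ->
  {in s', forall n, [/\ posN N n, mu n = rho%:R * nu & lam n = nu']} ->
  (forall B B', bounded N [set l | lam l < B' /\ mu l < B]%classic) ->
  (forall u, 0 <= lam (Ed u)) ->
  (forall u, 0 <= mu (Ed u) - rho%:R * nu * (lam (Ed u) / nu')) ->
  (forall z, z \in gsupp p -> 0 <= lam z < (size s')%:R * nu' /\
     mu z - rho%:R * nu * (lam z / nu') < (size s)%:R * nu) ->
  good (fun x => (cnt N [set l | lam l < lam x /\ mu l < mu x]%classic
         (p%:F * (geom s * geom s')))%:~R) 0.
Proof.
move=> llam lmu nu0 nu'0 Hs Hs' bdd lam0 kap0 Hp.
have lamD := linear_additive llam; have muD := linear_additive lmu.
pose kap x := mu x + (- (rho%:R * nu / nu')) * lam x.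
have lkap : linear_fun kap by apply: linear_funD => //; apply: linear_funZ.
have kapE x : kap x = mu x - rho%:R * nu * (lam x / nu') by rewrite /kap; ring.
have gE : geom s * geom s' = 1%:F * geom (s ++ s') :> ratfun V.
  by rewrite tofrac1 mul1r /geom big_cat.
have eg : expandable N (geom s * geom s').
  rewrite gE; apply: (mon_geom_expandable nodes0) => n.
  by rewrite mem_cat => /orP[/Hs[]|/Hs'[]].
rewrite (_ : (fun x => _) = fun x => \sum_(z <- gsupp p) (gcoef p z)%:~R *
    (cnt N [set l | lam l < lam x /\ mu l < mu x]%classic ((mon z)%:F * (geom s * geom
      s')))%:~R); last first.
  apply/funext => x; rewrite cnt_sum_mon // rmorph_sum; apply: eq_bigr => z _.
  by rewrite rmorphM.
have e0 : \sum_(z <- gsupp p) (gcoef p z)%:~R * 0 = 0 :> R by rewrite big1 // => z _;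
  rewrite mulr0.
rewrite -[X in good _ X]e0.
apply: (good_sum (F := fun z x => (gcoef p z)%:~R *
    (cnt N [set l | lam l < lam x /\ mu l < mu x]%classic ((mon z)%:F * (geom s * geom
      s')))%:~R)
  (k := fun z => (gcoef p z)%:~R * 0)) => z zp _; apply: goodZ.
have [/andP[lz0 lz1] kz] := Hp z zp.
have [G pG HG] := count_two_directions R nodes0 muD nu0 lamD nu'0 Hs Hs' bdd kz.
have mA : mpfun (fun x => ratr (kap x / nu)).
  rewrite (_ : (fun x => _) = fun x => ratr (nu^-1 * kap x)); first by
    apply/linear_mpfun/linear_funZ.
  by apply/funext => x; rewrite mulrC.
have mB : mpfun (fun x => ratr (lam x / nu')).
  rewrite (_ : (fun x => _) = fun x => ratr (nu'^-1 * lam x)); first by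
    apply/linear_mpfun/linear_funZ.
  by apply/funext => x; rewrite mulrC.
have [H mH HE] := polyfun_mpfun pG mA mB.
have [K1 K10 HK1] := linear_divisible (linear_funZ nu^-1 lkap).
have [K2 K20 HK2] := linear_divisible (linear_funZ nu'^-1 llam).
have fl : Num.floor (lam z / nu') - (size s')%:Z < 0.
  by rewrite subr_lt0 lt_floor -pmulrn ltr_pdivrMr.
exists 0, (K1 * K2)%N, H; split=> //; first by rewrite muln_gt0 K10.
  rewrite (HE 0 0 0) ?linear_fun0 ?mul0r ?rmorph0 //.
  rewrite -HG // rmorph0 !mul0r mulr0 add0r rmorph0 mul0r.
  rewrite /cnt csum0 // => l [l0 _]; apply/eqP/negPn/negP => cl.
  suff : 0 <= lam l by rewrite leNgt l0.
  move: cl; rewrite -mulrA gE tofrac1 mul1r.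
  apply: (geoms_supp nodes0 (K := fun l => 0 <= lam l)); first by move=> y /gsupp_mon ->.
  move=> m; rewrite mem_cat => /orP[/Hs[pm _ lm]|/Hs'[pm _ lm]]; split=> // y zy;
    by rewrite lamD lm ?addr0 // addr_ge0 // ltW.
move=> x dx xK.
have /intrP[a aE] : nu^-1 * kap x \is a Num.int by apply: HK1; apply: (divisible_mull K20).
have /intrP[c cE] : nu'^-1 * lam x \is a Num.int.
  by apply: HK2; apply: (divisible_mull K10); rewrite mulnC.
have a0 : 0 <= a.
  rewrite -(ler0z rat) -aE mulr_ge0 ?invr_ge0 ?(ltW nu0) //.
  by apply: (deep_ge0 lkap _ dx) => u; rewrite kapE.
have c0 : 0 <= c.
  by rewrite -(ler0z rat) -cE mulr_ge0 ?invr_ge0 ?(ltW nu'0) //; apply: (deep_ge0 llam _ dx).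
rewrite (HE x a c); [|by rewrite mulrC aE ratr_int|by rewrite mulrC cE ratr_int].
rewrite -HG //; last exact: lt_le_trans c0.
have e1 : c%:~R * nu' = lam x by rewrite -cE mulrAC mulVf ?mul1r // gt_eqF.
have e2 : (a + rho%:Z * c)%:~R * nu = mu x.
  rewrite rmorphD rmorphM /= -aE -cE -pmulrn mulrDl mulrAC mulVf ?gt_eqF // mul1r kapE.
  by ring.
by rewrite e1 e2 mulrA.
Qed.

(** As for two directions, with one coordinate. *)
Lemma good_geom_one (mu : expo V -> rat) (nu : rat) (s : seq (expo V)) p :
  linear_fun mu -> 0 < nu -> {in s, forall n, posN N n /\ mu n = nu} ->
  (forall B, bounded N [set l | mu l < B]%classic) ->
  (forall u, 0 <= mu (Ed u)) ->
  (forall z, z \in gsupp p -> 0 <= mu z < (size s)%:R * nu) ->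
  good (fun x => (cnt N [set l | mu l < mu x]%classic (p%:F * geom s))%:~R) 0.
Proof.
move=> lmu nu0 Hs bdd mu0 Hp; have muD := linear_additive lmu.
have eg : expandable N (geom s).
  by rewrite -[geom s]mul1r -tofrac1; apply: (mon_geom_expandable nodes0) => n /Hs[].
rewrite (_ : (fun x => _) = fun x => \sum_(z <- gsupp p) (gcoef p z)%:~R *
    (cnt N [set l | mu l < mu x]%classic ((mon z)%:F * geom s))%:~R); last first.
  apply/funext => x; rewrite cnt_sum_mon // rmorph_sum; apply: eq_bigr => z _.
  by rewrite rmorphM.
have e0 : \sum_(z <- gsupp p) (gcoef p z)%:~R * 0 = 0 :> R by rewrite big1 // => z _;
  rewrite mulr0.
rewrite -[X in good _ X]e0.
apply: (good_sum (F := fun z x => (gcoef p z)%:~R *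
    (cnt N [set l | mu l < mu x]%classic ((mon z)%:F * geom s))%:~R)
  (k := fun z => (gcoef p z)%:~R * 0)) => z zp _; apply: goodZ; have /andP[mz0 mz1] := Hp z zp.
have [G pG HG] := count_one_direction R nodes0 z muD nu0 Hs.
have mA : mpfun (fun x => ratr (mu x / nu)).
  rewrite (_ : (fun x => _) = fun x => ratr (nu^-1 * mu x)); first by
    apply/linear_mpfun/linear_funZ.
  by apply/funext => x; rewrite mulrC.
have [H mH HE] := polyfun_mpfun pG (mpfun_const 0) mA.
have [K K0 HK] := linear_divisible (linear_funZ nu^-1 lmu).
have fl : Num.floor (mu z / nu) - (size s)%:Z < 0.
  by rewrite subr_lt0 lt_floor -pmulrn ltr_pdivrMr.
have HG' (X : int) : Num.floor (mu z / nu) - (size s)%:Z < X ->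
    (cnt N [set l | mu l < X%:~R * nu]%classic ((mon z)%:F * geom s))%:~R = G 0 X.
  move=> zX; rewrite -(HG setT) //; last by move=> B; apply: bounded_sub (bdd B) => l [].
  congr (cnt _ _ _)%:~R; apply/seteqP; split=> l //=; by case.
exists 0, K, H; split=> //.
  rewrite (HE 0 0 0) ?linear_fun0 ?mul0r ?rmorph0 // -HG' // rmorph0 mul0r.
  rewrite /cnt csum0 // => l l0; apply/eqP/negPn/negP => cl.
  suff : 0 <= mu l by rewrite leNgt l0.
  move: cl; apply: (geoms_supp nodes0 (K := fun l => 0 <= mu l)); first by move=> y
    /gsupp_mon ->.
  move=> m /Hs[pm mm]; split=> // y zy; by rewrite muD mm addr_ge0 // ltW.
move=> x dx xK; have /intrP[a aE] := HK x xK.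
have a0 : 0 <= a.
  by rewrite -(ler0z rat) -aE mulr_ge0 ?invr_ge0 ?(ltW nu0) //; apply: (deep_ge0 lmu _ dx).
rewrite (HE x 0 a) //; last by rewrite mulrC aE ratr_int.
rewrite -HG'; last exact: lt_le_trans a0.
by have -> : a%:~R * nu = mu x by rewrite -aE mulrAC mulVf ?mul1r // gt_eqF.
Qed.

Lemma inv_cofactor (F : fieldType) (p q r : F) : r != 0 -> p * q = r -> p^-1 = q / r.
Proof.
move=> r0 pq; have p0 : p != 0 by apply: contraNneq r0 => p0; rewrite -pq p0 mul0r.
by rewrite -pq invfM mulrCA divff ?mulr1 //; apply: contraNneq r0 => q0; rewrite -pq q0 mulr0.
Qed.

(** Replacing a direction n by its multiple k n costs a numerator with
    exponents from 0 to (k - 1) n. *)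
Lemma geom_scale (s : seq (expo V * nat)) :
  {in s, forall q, posN N q.1 /\ (0 < q.2)%N} ->
  exists2 p : lpoly V, geom [seq q.1 | q <- s] = p%:F * geom [seq q.1 *+ q.2 | q <- s] &
    forall z, z \in gsupp p -> forall mu, linear_fun mu -> {in s, forall q, 0 <= mu q.1} ->
      0 <= mu z <= \sum_(q <- s) (mu (q.1 *+ q.2) - mu q.1).
Proof.
elim: s => [|[n k] s IHs] Hs.
  exists 1; first by rewrite tofrac1 mul1r.
  by move=> z /gsupp1 -> mu lmu _; rewrite linear_fun0 // big_nil lexx.
have [|p pE Hp] := IHs; first by move=> q qs; apply: Hs; rewrite inE qs orbT.
have [/= pn k0] := Hs _ (mem_head _ _).
exists ((\sum_(i < k) mon (n *+ i)) * p).
  rewrite /= !geom_cons pE tofracM mulrACA; congr (_ * _).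
  have pk : posN N (n *+ k) by move=> v vN; rewrite ffunMnE mulrn_wgt0 ?pn.
  have nk : (1 - mon (n *+ k))%:F != 0 :> ratfun V by rewrite tofrac_neq0 (one_mon_neq0
    nodes0).
  apply: inv_cofactor nk _; rewrite -tofracM; congr (_%:F).
  rewrite monX -[RHS]opprB subrX1 -mulNr opprB; congr (_ * _).
  by apply: eq_bigr => i _; rewrite monX.
move=> z /gsuppM[y [y' [/gsupp_sum[i _ /gsupp_mon ->] /Hp h ->]]] mu lmu Hmu.
have muD := linear_additive lmu.
have /andP[h1 h2] : 0 <= mu y' <= \sum_(q <- s) (mu (q.1 *+ q.2) - mu q.1).
  by apply: h => // q qs; apply: Hmu; rewrite inE qs orbT.
have n0 : 0 <= mu n by apply: (Hmu (n, k)); rewrite mem_head.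
rewrite big_cons /= muD !additive_funM // addr_ge0 ?mulrn_wge0 //= lerD //.
rewrite lerBrDr -mulrSr; apply: ler_wpMn2l => //; exact: ltn_ord.
Qed.

End Good.

(** * The counting functions of one and two nodes *)

Section Parts.
Import mathcomp.boot.fintype mathcomp.boot.finset.
Variables (R : realType) (V : finType) (e : rel V) (b : V -> int).
Hypothesis e_tree : is_tree e.
Hypothesis b_neg : negative_definite e b.
Hypothesis nodes0 : nodes e != set0.
Implicit Types (x y z l n : expo V) (u v w : V) (S : {set V}) (p : lpoly V).

Local Notation Ed := (dual_vec e b).
Local Notation N := (nodes e).
Local Notation np := (order_dual_proj e b).
Local Notation deep := (@deep R V e b).
Local Notation good := (@good R V e b).
Local Notation linear_fun := (@linear_fun V e).
Local Notation denom := (denom e b).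

Lemma common_multiple (s : seq rat) : exists2 k : nat, (0 < k)%N &
  forall q, q \in s -> 0 <= q -> exists j : nat, q * k%:R = j%:R.
Proof.
have [k k0 Hk] := common_denom s; exists k => // q qs q0.
by apply/natrP; rewrite natrEint Hk // mulr_ge0.
Qed.

(** The directions of a product of geometric series become equal for phi after
    multiplication by suitable m_u, and the common value can be taken
    divisible enough to clear further denominators. *)
Lemma rescale (phi : V -> rat) (S : {set V}) (s : seq rat) :
  (forall u, u \in S -> 0 < phi u) ->
  exists nu (m : V -> nat), [/\ 0 < nu, forall u, u \in S -> (0 < m u)%N /\ phi u * (m u)%:R
    = nu &
    forall q, q \in s -> 0 <= q -> exists j : nat, q * nu = j%:R].
Proof.
move=> phi0; have [k k0 Hk] := common_multiple ([seq (phi u)^-1 | u <- enum S] ++ s).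
have /choice[m Hm] u : exists j : nat, u \in S -> (phi u)^-1 * k%:R = j%:R.
  have [uS|uS] := boolP (u \in S); last by exists 0%N.
  have [||j jE] := Hk (phi u)^-1; last by exists j.
    by rewrite mem_cat; apply/orP; left; apply/mapP; exists u; rewrite ?mem_enum.
  by rewrite invr_ge0 ltW ?phi0.
have kr : 0 < k%:R :> rat by rewrite ltr0n.
exists k%:R, m; split=> // [u uS|q qs q0].
  rewrite -Hm // mulVKf ?gt_eqF ?phi0 //; split=> //.
  by rewrite -(ltr0n rat) -Hm // mulr_gt0 ?invr_gt0 ?phi0.
by apply: Hk => //; rewrite mem_cat qs orbT.
Qed.

Lemma geom_scale_denom S (m : V -> nat) : (forall u, u \in S -> (0 < m u)%N) ->
  exists2 q : lpoly V, ((denom S)%:F)^-1 = q%:F * geom [seq np u *+ m u | u <- enum S] &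
    forall z, z \in gsupp q -> forall mu, linear_fun mu ->
      (forall u, u \in S -> 0 <= mu (np u)) ->
      0 <= mu z <= \sum_(u in S) (mu (np u *+ m u) - mu (np u)).
Proof.
move=> m0; have [|q qE Hq] := @geom_scale V e nodes0 [seq (np u, m u) | u <- enum S].
  move=> _ /mapP[u uS ->] /=; split; first exact: order_dual_proj_pos.
  by apply: m0; rewrite mem_enum in uS.
exists q; first by rewrite denom_geom; rewrite -!map_comp in qE; exact: qE.
move=> z zq mu lmu mu0; have := Hq z zq mu lmu; rewrite big_map big_enum; apply.
by move=> _ /mapP[u uS ->] /=; apply: mu0; rewrite mem_enum in uS.
Qed.

Lemma scaled_size S (m : V -> nat) : size [seq np u *+ m u | u <- enum S] = #|S|.
Proof. by rewrite size_map -cardE. Qed.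

Lemma sum_scaled S (m : V -> nat) (mu : expo V -> rat) nu : linear_fun mu ->
  (forall u, u \in S -> (0 < m u)%N /\ mu (np u) * (m u)%:R = nu) ->
  \sum_(u in S) (mu (np u *+ m u) - mu (np u)) = #|S|%:R * nu - \sum_(u in S) mu (np u).
Proof.
move=> lmu Hm; rewrite sumrB; congr (_ - _); rewrite -sum1_card natr_sum mulr_suml.
apply: eq_bigr => u uS; rewrite additive_funM; last exact: linear_additive lmu.
by have [_ <-] := Hm u uS; rewrite mul1r mulr_natr.
Qed.

Lemma scaled_pos S (m : V -> nat) n : (forall u, u \in S -> (0 < m u)%N) ->
  n \in [seq np u *+ m u | u <- enum S] ->
  exists u, [/\ u \in S, n = np u *+ m u & posN N n].
Proof.
move=> m0 /mapP[u]; rewrite mem_enum => uS ->; exists u; split=> // v vN.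
by rewrite ffunMnE mulrn_wgt0 ?m0 // order_dual_proj_pos.
Qed.

(** The directions are first rescaled to a common value nu of mu. This
    enlarges the numerator, and its bound becomes the one under which the
    polynomial formula holds down to the origin. *)
Lemma good_denom_one S (mu : expo V -> rat) p : linear_fun mu ->
  (forall u, u \in S -> 0 < mu (np u)) ->
  (forall B, bounded N [set l | mu l < B]%classic) ->
  (forall u, 0 <= mu (Ed u)) ->
  (forall z, z \in gsupp p -> 0 <= mu z < \sum_(u in S) mu (np u)) ->
  good (fun x => (cnt N [set l | mu l < mu x]%classic (p%:F / (denom S)%:F))%:~R) 0.
Proof.
move=> lmu muS bdd mu0 Hp; have [nu [m [nu0 Hm _]]] := rescale [::] muS.
have m0 u : u \in S -> (0 < m u)%N by case/Hm.
have [q qE Hq] := geom_scale_denom m0.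
have -> : p%:F / (denom S)%:F = (p * q)%:F * geom [seq np u *+ m u | u <- enum S].
  by rewrite qE tofracM; ring.
apply: (good_geom_one R nodes0 lmu nu0) => //.
  move=> n /(scaled_pos m0)[u [uS -> pn]]; split=> //.
  by rewrite additive_funM; [rewrite -mulr_natr; case: (Hm u uS)|exact: linear_additive lmu].
move=> z /gsuppM[y [y' [/Hp/andP[h1 h2] /Hq h ->]]].
have /andP[h3 h4] := h mu lmu (fun u uS => ltW (muS u uS)).
rewrite (sum_scaled lmu Hm) in h4; rewrite scaled_size (linear_additive lmu).
by apply/andP; split; lra.
Qed.

(** The combination mu - tau lam vanishes on S' and is equal to mu on S, so
    that the numerators introduced by the two rescalings can be bounded
    separately. *)
Lemma good_denom_two S S' (lam mu : expo V -> rat) (tau : rat) p : linear_fun lam ->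
  linear_fun mu ->
  0 <= tau -> (forall u, u \in S -> lam (np u) = 0 /\ 0 < mu (np u)) ->
  (forall u, u \in S' -> 0 < lam (np u) /\ mu (np u) = tau * lam (np u)) ->
  (forall B B', bounded N [set l | lam l < B' /\ mu l < B]%classic) ->
  (forall u, 0 <= lam (Ed u)) -> (forall u, 0 <= mu (Ed u) - tau * lam (Ed u)) ->
  (forall z, z \in gsupp p -> 0 <= lam z < \sum_(u in S') lam (np u) /\
      mu z - tau * lam z < \sum_(u in S) mu (np u)) ->
  good (fun x => (cnt N [set l | lam l < lam x /\ mu l < mu x]%classic
      (p%:F / ((denom S)%:F * (denom S')%:F)))%:~R) 0.
Proof.
move=> llam lmu tau0 HS HS' bdd lam0 kap0 Hp.
have lamD := linear_additive llam; have muD := linear_additive lmu.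
pose kap x := mu x + (- tau) * lam x.
have lkap : linear_fun kap := linear_funD lmu (linear_funZ (- tau) llam).
have kapE x : kap x = mu x - tau * lam x by rewrite /kap; ring.
have [nu [m [nu0 Hm _]]] := rescale [::] (fun u uS => (HS u uS).2).
(* Clearing the denominator of tau / nu makes mu a natural multiple of nu on
   the rescaled directions of S'. *)
have [nu' [m' [nu'0 Hm' Hrho]]] := rescale [:: tau / nu] (fun u uS => (HS' u uS).1).
have [rho rhoE] : exists j : nat, tau / nu * nu' = j%:R.
  by apply: Hrho; rewrite ?mem_head // divr_ge0 // ltW.
have tauE (t : rat) : tau * t = rho%:R * nu * (t / nu').
  by rewrite -rhoE; field; rewrite !gt_eqF.
have m0 u : u \in S -> (0 < m u)%N by case/Hm.
have m'0 u : u \in S' -> (0 < m' u)%N by case/Hm'.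
have [q qE Hq] := geom_scale_denom m0; have [q' q'E Hq'] := geom_scale_denom m'0.
have -> : p%:F / ((denom S)%:F * (denom S')%:F) = (p * (q * q'))%:F *
    (geom [seq np u *+ m u | u <- enum S] * geom [seq np u *+ m' u | u <- enum S']).
  by rewrite invfM qE q'E !tofracM; ring.
apply: (good_geom_two R nodes0 llam lmu nu0 nu'0 (rho := rho)) => //.
- move=> n /(scaled_pos m0)[u [uS -> pn]]; have [l0 _] := HS u uS; split=> //.
    by rewrite additive_funM // -mulr_natr; case: (Hm u uS).
  by rewrite additive_funM // l0 mul0rn.
- move=> n /(scaled_pos m'0)[u [uS -> pn]]; have [l0 mE] := HS' u uS; split=> //.
    have [_ h] := Hm' u uS; rewrite additive_funM // mE -mulrnAr -[lam _ *+ _]mulr_natr h tauE.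
    by rewrite divff ?mulr1 // gt_eqF.
  by rewrite additive_funM // -mulr_natr; case: (Hm' u uS).
- by move=> u; rewrite -tauE.
move=> z /gsuppM[y [y' [/Hp[/andP[h1 h2] h3] /gsuppM[t [t' [/Hq h /Hq' h' ->]]] ->]]].
rewrite !scaled_size -tauE -kapE.
have lamS u : u \in S -> 0 <= lam (np u) by move=> /HS[-> _].
have lamS' u : u \in S' -> 0 <= lam (np u) by move=> /HS'[/ltW].
have kapS u : u \in S -> kap (np u) = mu (np u) by move=> /HS[l0 _]; rewrite kapE l0 mulr0
  subr0.
have kapS' u : u \in S' -> kap (np u) = 0 by move=> /HS'[_ mE]; rewrite kapE mE subrr.
have kapS0 u : u \in S -> 0 <= kap (np u) by move=> uS; rewrite kapS //; case: (HS u uS) =>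
  _ /ltW.
have kapS'0 u : u \in S' -> 0 <= kap (np u) by move=> uS; rewrite kapS'.
have /andP[a1 a2] := h lam llam lamS; have /andP[a3 a4] := h kap lkap kapS0.
have /andP[a5 a6] := h' lam llam lamS'; have /andP[a7 a8] := h' kap lkap kapS'0.
have b2 : \sum_(u in S) (lam (np u *+ m u) - lam (np u)) = 0.
  by apply: big1 => u /HS[l0 _]; rewrite additive_funM // l0 mul0rn subrr.
have b4 : \sum_(u in S) (kap (np u *+ m u) - kap (np u)) = #|S|%:R * nu - \sum_(u in S) mu
  (np u).
  rewrite (sum_scaled (nu := nu) lkap) => [|u uS]; last by rewrite kapS //; apply: Hm.
  by congr (_ - _); apply: eq_bigr.
have b6 := sum_scaled llam Hm'.
have b8 : \sum_(u in S') (kap (np u *+ m' u) - kap (np u)) = 0.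
  apply: big1 => u /kapS' k0; rewrite additive_funM ?k0 ?mul0rn ?subrr //.
  exact: linear_additive lkap.
have kapD := linear_additive lkap.
rewrite b2 in a2; rewrite b4 in a4; rewrite b6 in a6; rewrite b8 in a8.
rewrite -kapE in h3; rewrite !lamD !kapD.
by split; [apply/andP; split; lra | lra].
Qed.

Lemma seq_upper (s : seq (expo V)) (mu : expo V -> rat) :
  exists M : rat, forall l, l \in s -> mu l <= M.
Proof.
elim: s => [|l s [M HM]]; first by exists 0.
exists (Num.max M (mu l)) => l'; rewrite inE => /predU1P[->|/HM h].
  by rewrite le_max lexx orbT.
by rewrite le_max h.
Qed.

(** Deep in the cone every exponent of p is counted. *)
Lemma good_poly (mu : expo V -> rat) u0 (A : expo V -> set (expo V)) p :
  linear_fun mu -> (forall u, 0 <= mu (Ed u)) -> 0 < mu (Ed u0) ->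
  (forall x l, mu l < mu x -> A x l) ->
  good (fun x => (cnt N (A x) p%:F)%:~R) (eval_one p)%:~R.
Proof.
move=> lmu mu0 mu1 HA; have [M HM] := seq_upper (gsupp p) mu.
have [L L0 HL] := deep_large R M lmu mu0 mu1.
apply: (good_eq (F' := fun=> (eval_one p)%:~R)); last exact: good_const.
exists L => x /HL Mx; rewrite cnt_poly // csum_poly // => l lp.
by apply: HA; apply: le_lt_trans Mx; apply: HM.
Qed.

Lemma half_bounded v B : v \in N -> bounded N [set l : expo V | l v < B]%classic.
Proof. by move=> vN; exists B => l; exists v. Qed.

Lemma frac_expandable p S : expandable N (p%:F / (denom S)%:F).
Proof.
rewrite denom_geom; apply: (mon_geom_expandable nodes0) => n /mapP[u _ ->].
exact: order_dual_proj_pos.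
Qed.

Lemma frac2_expandable p S S' : expandable N (p%:F / ((denom S)%:F * (denom S')%:F)).
Proof.
rewrite invfM !denom_geom.
have -> : geom [seq np u | u <- enum S] * geom [seq np u | u <- enum S'] =
   geom ([seq np u | u <- enum S] ++ [seq np u | u <- enum S']) by rewrite /geom big_cat.
apply: (mon_geom_expandable nodes0) => n; rewrite mem_cat => /orP[] /mapP[u _ ->]; exact:
  order_dual_proj_pos.
Qed.

(** A linear function positive on the directions of a box takes on it values
    below the sum of its values on the directions, as the coefficients are
    less than 1 and there is at least one direction. *)
Lemma box_sum (I : {set V}) S x (c : V -> rat) : in_box e b I S x ->
  (exists u, u \in S) -> I \subset N ->
  (forall u, u \in S -> 0 < \sum_(i in I) c i * np u i) ->
  0 <= \sum_(i in I) c i * x i < \sum_(u in S) \sum_(i in I) c i * np u i.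
Proof.
move=> [a a01 xE] [u0 u0S] IN c0.
have -> : \sum_(i in I) c i * x i = \sum_(u in S) a u * \sum_(i in I) c i * np u i.
  rewrite (eq_bigr (fun i => \sum_(u in S) a u * (c i * np u i))) => [|i iI].
    by rewrite exchange_big; apply: eq_bigr => u _; rewrite mulr_sumr.
  rewrite xE // mulr_sumr; apply: eq_bigr => u _.
  by rewrite order_dual_projE ?(subsetP IN) // /order_dual; ring.
apply/andP; split.
  by apply: sumr_ge0 => u uS; have /andP[a0 _] := a01 u; rewrite mulr_ge0 // ltW ?c0.
rewrite (bigD1 u0) // [X in _ < X](bigD1 u0) //=; apply: ltr_leD.
  by have /andP[_ a1] := a01 u0; rewrite gtr_pMl ?c0.
apply: ler_sum => u /andP[uS _]; have /andP[_ a1] := a01 u.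
by rewrite ger_pMl ?c0 // ltW.
Qed.

(** The polynomial part contributes its value at 1, and the box condition
    makes the fraction contribute 0. *)
Lemma good_part1 f v P : v \in N -> (exists u, u \in ends e) -> is_poly_part1 e b f v P ->
  good (fun x => (cnt N [set l | l v < x v]%classic f)%:~R) (eval_one P)%:~R.
Proof.
move=> vN ends0 [P' [_ -> _ HP']].
rewrite (_ : (fun x => _) = fun x => (cnt N [set l | l v < x v]%classic P%:F)%:~R +
   (cnt N [set l | l v < x v]%classic (P'%:F / (denom (ends e))%:F))%:~R); last first.
  apply/funext => x; rewrite cntD ?rmorphD //; last exact: half_bounded.
    exact: expandable_poly.
  exact: frac_expandable.
rewrite -[(eval_one P)%:~R]addr0; have lv := linear_coord vN.
have Ed0 u : 0 <= Ed u v by apply: dual_ge0.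
have npv u : np u v = \sum_(i in [set v]) 1 * np u i by rewrite big_set1 mul1r.
apply: goodD; first by apply: (@good_poly (fun x => x v) v) => //; apply: dual_gt0.
apply: (@good_denom_one (ends e) (fun x => x v)) => //.
- by move=> u _; rewrite order_dual_projE // order_dual_gt0.
- by move=> B; apply: half_bounded.
move=> z zP'; have vN' : [set v] \subset N by rewrite sub1set.
have := box_sum (c := fun=> 1) (HP' z zP') ends0 vN'; rewrite big_set1 mul1r.
rewrite (eq_bigr (fun u => np u v)) => [|u _]; last by rewrite -npv.
by apply=> u _; rewrite -npv order_dual_projE // order_dual_gt0.
Qed.

Lemma box_zero (I : {set V}) S x (c : V -> rat) : in_box e b I S x -> I \subset N ->
  (forall u, u \in S -> \sum_(i in I) c i * np u i = 0) -> \sum_(i in I) c i * x i = 0.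
Proof.
move=> [a _ xE] IN c0; rewrite (eq_bigr (fun i => \sum_(u in S) a u * (c i * np u i))) =>
  [|i iI].
  rewrite exchange_big; apply: big1 => u uS; by rewrite -mulr_sumr c0 ?mulr0.
by rewrite xE // mulr_sumr; apply: eq_bigr => u _; rewrite order_dual_projE ?(subsetP IN) //
  /order_dual; ring.
Qed.

Section Edge.
Variables (v w : V).
Hypotheses (vN : v \in N) (wN : w \in N) (vw : v != w).

Local Notation Ev := (subtree_ends e v w).
Local Notation Ew := (subtree_ends e w v).
Local Notation la := (lam e b v w).
Local Notation lb := (lam e b w v).
Local Notation gvv := (Ed v v).
Local Notation gww := (Ed w w).
Local Notation gvw := (Ed v w).
Local Notation I := [set v; w].

Lemma pair_sub : I \subset N.
Proof. by apply/subsetP => i; rewrite in_set2 => /orP[] /eqP ->. Qed.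

Lemma lam_coord : exists c : V -> rat, forall x, la x = \sum_(i in I) c i * x i.
Proof.
exists (fun u => (u == v)%:R * gww - (u == w)%:R * gvw) => x; rewrite /lam.
rewrite big_setU1 ?inE //= big_set1 !eqxx (negPf vw) eq_sym (negPf vw) mulr1n mulr0n.
by ring.
Qed.

Lemma lam_linear : linear_fun la.
Proof.
exists (fun u => (u == v)%:R * gww - (u == w)%:R * gvw) => x; rewrite /lam.
rewrite (bigD1 v) //= (bigD1 w) /=; last by rewrite wN eq_sym.
rewrite !eqxx (negPf vw) eq_sym (negPf vw) big1 => [|u /andP[/andP[_ /negPf uv] /negPf uw]].
  by rewrite mulr1n mulr0n; ring.
by rewrite uv uw mulr0n; ring.
Qed.

Lemma lam_order_dual_proj u : la (np u) = la (Ed u) *+ disc_order e b.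
Proof. by rewrite /lam !order_dual_projE // !ffunMnE !mulrnAl mulrnBl. Qed.

Lemma lam_far u : u \in Ew -> la (np u) = 0.
Proof.
rewrite inE => /andP[_]; rewrite subtreeE // 1?eq_sym // in_setC => ub.
by rewrite lam_order_dual_proj lam_dual_eq0 // mul0rn.
Qed.

Lemma det_gt0 : 0 < gvv * gww - gvw * gvw.
Proof. by have := lam_dual_gt0 e_tree b_neg vw; rewrite /lam. Qed.

Lemma order_dual_proj_gt0 u t : t \in N -> 0 < np u t.
Proof. by move=> tN; rewrite order_dual_projE // order_dual_gt0. Qed.

Lemma box_lam_far y : in_box e b I Ew y -> la y = 0.
Proof.
have [c cE] := lam_coord; move=> /box_zero h; rewrite cE; apply: h; first exact: pair_sub.
by move=> u uE; rewrite -cE lam_far.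
Qed.

End Edge.

Section Pair.
Variables (v w : V).
Hypotheses (vN : v \in N) (wN : w \in N) (vw : v != w).

Local Notation Ev := (subtree_ends e v w).
Local Notation Ew := (subtree_ends e w v).
Local Notation la := (lam e b v w).
Local Notation lb := (lam e b w v).
Local Notation gvv := (Ed v v).
Local Notation gww := (Ed w w).
Local Notation gvw := (Ed v w).
Local Notation I := [set v; w].
Local Notation det := (gvv * gww - gvw * gvw).

Let wv : w != v. Proof. by rewrite eq_sym. Qed.

Lemma laE x : la x = x v * gww - x w * gvw. Proof. by []. Qed.

Lemma lbE x : lb x = x w * gvv - x v * gvw.
Proof. by rewrite /lam (dualC e_tree b_neg w v). Qed.

Lemma lb_near u : u \in Ev -> lb (np u) = 0.
Proof. exact: lam_far. Qed.

Lemma la_near u : u \in Ev -> 0 < la (np u).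
Proof.
move=> /lb_near; rewrite lbE laE => h; have d0 := det_gt0 vw.
have v0 := order_dual_proj_gt0 u vN; have g0 : 0 < gvv by apply: dual_gt0.
rewrite -(pmulr_lgt0 _ g0).
have -> : (np u v * gww - np u w * gvw) * gvv = np u v * det - gvw * (np u w * gvv - np u v
  * gvw).
  by ring.
by rewrite h mulr0 subr0 mulr_gt0.
Qed.

Lemma pair_coordw x : x w = gww / det * lb x + gvw / det * la x.
Proof. by rewrite lbE laE; field; rewrite gt_eqF ?(det_gt0 vw). Qed.

Lemma pair_coordv x : x v = gvw / det * lb x + gvv / det * la x.
Proof. by rewrite lbE laE; field; rewrite gt_eqF ?(det_gt0 vw). Qed.

Lemma tau_ge0 (t : V) : 0 <= Ed t w / det.
Proof. by rewrite divr_ge0 ?dual_ge0 ?(ltW (det_gt0 vw)). Qed.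

Lemma box_far y : in_box e b I Ew y -> la y = 0.
Proof. exact: box_lam_far. Qed.

Lemma box_near y : in_box e b I Ev y -> (exists u, u \in Ev) ->
  0 <= la y < \sum_(u in Ev) la (np u).
Proof.
have [c cE] := lam_coord vw; move=> yb ex.
have := box_sum (c := c) yb ex (pair_sub vN wN); rewrite -cE.
rewrite (eq_bigr (fun u => la (np u))) => [|u _]; last by rewrite -cE.
by apply=> u uE; rewrite -cE la_near.
Qed.

(** The function lb is constant along the directions of the denominator, hence
    bounded on the exponents. For x deep they satisfy lb l < lb x, and then
    the inequality at v implies the one at w: a single direction remains. *)
Lemma good_edge_side P1 : (exists u, u \in Ev) ->
  (forall z, z \in gsupp P1 -> exists2 q : rat, q <= 0 & in_box e b I Ev (z - axis v q)) ->
  good (fun x => (cnt N [set l | l v < x v \/ l w < x w]%classic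
     (P1%:F / (denom Ev)%:F))%:~R) 0.
Proof.
move=> ex HP1; have [M HM] := seq_upper (gsupp P1) lb.
have llb : linear_fun lb by apply: lam_linear.
have lb0 u : 0 <= lb (Ed u) by apply: lam_dual_ge0.
have lb1 : 0 < lb (Ed w) by apply: lam_dual_gt0.
have [L L0 HL] := deep_large R M llb lb0 lb1.
have suppM l : expansion N (P1%:F / (denom Ev)%:F) l != 0 -> lb l <= M.
  rewrite denom_geom; apply: (geoms_supp nodes0 (K := fun l => lb l <= M)); first exact: HM.
  move=> n /mapP[u]; rewrite mem_enum => uE ->; split; first exact: order_dual_proj_pos.
  by move=> y yM; rewrite lamD lb_near ?addr0.
apply: (good_eq (F' := fun x => (cnt N [set l | l w < x w]%classic
     (P1%:F / (denom Ev)%:F))%:~R)).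
  exists L => x /HL Mx; congr (_%:~R); apply: eq_csum => l /suppM lM /=.
  split=> [[lv|//]|]; last by right.
  have : lb l < lb x by apply: le_lt_trans Mx.
  rewrite !lbE => h; have g0 : 0 < gvv by apply: dual_gt0.
  have g1 : 0 <= gvw by apply: dual_ge0.
  by rewrite -(ltr_pM2r g0); nra.
apply: (@good_denom_one Ev (fun x => x w)) => //; first exact: linear_coord.
- by move=> u _; apply: order_dual_proj_gt0.
- by move=> B; apply: half_bounded.
- by move=> u; apply: dual_ge0.
move=> z /HP1[q _ zb].
have := box_sum (c := fun i => (i == w)%:R) zb ex (pair_sub vN wN).
have cE y : \sum_(i in I) (i == w)%:R * y i = y w.
  by rewrite big_setU1 ?inE //= big_set1 (negPf vw) eqxx mul0r mul1r add0r.
rewrite cE (eq_bigr (fun u => np u w)) => [|u _]; last by rewrite cE.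
have -> : (z - axis v q) w = z w by rewrite !ffunE (negPf wv) subr0.
by apply=> u _; rewrite cE; apply: order_dual_proj_gt0.
Qed.

Lemma corner_bounds z y : in_box e b I Ev y -> in_box e b [set w; v] Ew (z - y) ->
  (exists u, u \in Ev) ->
  0 <= la z < \sum_(u in Ev) la (np u).
Proof.
move=> yb zb ex; have -> : la z = la y; last exact: box_near.
rewrite -[z in LHS](subrK y) lamD box_far ?add0r //.
by rewrite [I]setUC.
Qed.

End Pair.

Section PairCount.
Variables (v w : V).
Hypotheses (vN : v \in N) (wN : w \in N) (vw : v != w).

Local Notation Ev := (subtree_ends e v w).
Local Notation Ew := (subtree_ends e w v).
Local Notation la := (lam e b v w).
Local Notation lb := (lam e b w v).
Local Notation gvv := (Ed v v).
Local Notation gww := (Ed w w).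
Local Notation gvw := (Ed v w).
Local Notation det := (gvv * gww - gvw * gvw).

Let wv : w != v. Proof. by rewrite eq_sym. Qed.

(** The two cones are bounded by the coordinate lines through x and by the
    lines through x parallel to the projections of E_v^* and E_w^*, which are
    the directions of the two denominators. *)
Lemma wedge_union x :
  ([set l : expo V | l v < x v \/ l w < x w] =
  [set l : expo V | lb l < lb x /\ l w < x w] `|` [set l : expo V | la l < la x /\ l v < x
    v])%classic.
Proof.
have g1 : 0 < gvv by apply: dual_gt0. have g2 : 0 < gww by apply: dual_gt0.
have g3 : 0 < gvw by apply: dual_gt0. have d0 := det_gt0 vw.
apply/seteqP; split=> l /=; last by case=> [] [_ h]; [right | left].
rewrite !(lbE v w) !laE => h.
have [a0|a0] := ltP (l v * gww - l w * gvw) (x v * gww - x w * gvw); last first.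
  have hw : l w < x w by case: h => // h; nra.
  left; split=> //; have [hv|hv] := ltP (l v) (x v); last by nra.
  have p1 := mulr_gt0 d0 (_ : 0 < x v - l v); rewrite subr_gt0 in p1; have {}p1 := p1 hv.
  have p2 : 0 <= gvv * (gvw * (x w - l w) - gww * (x v - l v)).
    by apply: mulr_ge0; [exact: ltW | lra].
  rewrite -(ltr_pM2l g3); lra.
have [hv|hv] := ltP (l v) (x v); first by right.
have hw : l w < x w by case: h => // h; lra.
left; split=> //; nra.
Qed.

Lemma wedge_inter x :
  ([set l : expo V | lb l < lb x /\ l w < x w] `&` [set l : expo V | la l < la x /\ l v < x
    v] =
  [set l : expo V | lb l < lb x /\ la l < la x])%classic.
Proof.
apply/seteqP; split=> l /=; first by case=> [] [? _] [? _].
move=> [hb ha]; rewrite (pair_coordw vw l) (pair_coordw vw x) (pair_coordv vw l)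
  (pair_coordv vw x).
by do 2 split=> //; apply: ltrD; rewrite ltr_pM2l // divr_gt0 ?(det_gt0 vw) // dual_gt0.
Qed.

(** The coordinate at w is a combination of lb and la with positive
    coefficients; lb vanishes on the directions of Ev, and la on those of Ew. *)
Lemma good_corner P3 :
  (forall z, z \in gsupp P3 -> 0 <= lb z < \sum_(u in Ew) lb (np u) /\
     la z < \sum_(u in Ev) la (np u)) ->
  good (fun x => (cnt N [set l | lb l < lb x /\ l w < x w]%classic
     (P3%:F / ((denom Ev)%:F * (denom Ew)%:F)))%:~R) 0.
Proof.
move=> HP3.
have H t := tau_ge0 vw t.
apply: (@good_denom_two Ev Ew lb (fun x => x w) (gww / det)) => //.
- exact: lam_linear.
- exact: linear_coord.
- by move=> u uE; rewrite lb_near // order_dual_proj_gt0.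
- move=> u uE; split; first exact: la_near.
  by rewrite (pair_coordw vw) (lam_far vN wN vw uE) mulr0 addr0.
- by move=> B B'; apply: bounded_sub (half_bounded B wN) => l [].
- by move=> u; apply: lam_dual_ge0.
- move=> u; rewrite (pair_coordw vw (Ed u)) addrC addKr mulr_ge0 ?H //.
  exact: lam_dual_ge0.
move=> z /HP3[h1 h2]; split=> //; rewrite (pair_coordw vw z) addrC addKr.
have -> : \sum_(u in Ev) np u w = gvw / det * \sum_(u in Ev) la (np u).
  rewrite mulr_sumr; apply: eq_bigr => u uE.
  by rewrite (pair_coordw vw) lb_near // mulr0 add0r.
by rewrite ltr_pM2l // divr_gt0 ?(det_gt0 vw) // dual_gt0.
Qed.

(** In the coordinates lb and la the two denominators have independent
    directions. *)
Lemma good_strip P3 :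
  (forall z, z \in gsupp P3 -> 0 <= lb z < \sum_(u in Ew) lb (np u) /\
     la z < \sum_(u in Ev) la (np u)) ->
  good (fun x => (cnt N [set l | lb l < lb x /\ la l < la x]%classic
     (P3%:F / ((denom Ev)%:F * (denom Ew)%:F)))%:~R) 0.
Proof.
move=> HP3.
apply: (@good_denom_two Ev Ew lb la 0) => //.
- exact: lam_linear.
- exact: lam_linear.
- by move=> u uE; rewrite lb_near // la_near.
- by move=> u uE; rewrite mul0r (lam_far vN wN vw uE) la_near.
- move=> B B'; exists (gvw / det * B' + gvv / det * B) => l [hb ha].
  exists v => //; rewrite (pair_coordv vw l).
  by apply: ltrD; rewrite ltr_pM2l // divr_gt0 ?(det_gt0 vw) // dual_gt0.
- by move=> u; apply: lam_dual_ge0.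
- by move=> u; rewrite mul0r subr0; apply: lam_dual_ge0.
by move=> z /HP3; rewrite mul0r subr0.
Qed.

End PairCount.

(** The polynomial part contributes its value at 1. A fraction over the
    denominator of one side reduces to one node, and the last fraction is
    counted over the two cones of the wedge and over their intersection. *)
Lemma good_part2 f v w P : orb_adj e v w -> is_poly_part2 e b f v w P ->
  good (fun x => (cnt N [set l | l v < x v \/ l w < x w]%classic f)%:~R) (eval_one P)%:~R.
Proof.
move=> adj [P1 [P2 [P3 [_ -> _ [H1 H2 H3]]]]].
have /orb_adjP[_ [vN wN _ _]] := adj; have vw := orb_adj_neq adj.
have wv : w != v by rewrite eq_sym.
have exv := subtree_end_exists e_tree vN vw.
have exw := subtree_end_exists e_tree wN wv.
set D1 := denom _; set D2 := denom (subtree_ends e w v).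
have bdd x : bounded N [set l : expo V | l v < x v \/ l w < x w]%classic.
  by exists (Num.max (x v) (x w)) => l [] h; [exists v | exists w] => //; rewrite lt_max h
    ?orbT.
have e1 := frac_expandable P1 (subtree_ends e v w).
have e2 := frac_expandable P2 (subtree_ends e w v).
have e3 := frac2_expandable P3 (subtree_ends e v w) (subtree_ends e w v).
have e0 := expandable_poly N P; rewrite -/D1 -/D2 in e1 e2 e3.
rewrite (_ : (fun x => _) = fun x =>
   (cnt N [set l | l v < x v \/ l w < x w]%classic P%:F)%:~R +
   (cnt N [set l | l v < x v \/ l w < x w]%classic (P1%:F / D1%:F))%:~R +
   (cnt N [set l | l v < x v \/ l w < x w]%classic (P2%:F / D2%:F))%:~R +
   (cnt N [set l | l v < x v \/ l w < x w]%classic (P3%:F / (D1%:F * D2%:F)))%:~R); last first.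
  have e01 := expandableD e0 e1; have e012 := expandableD e01 e2.
  by apply/funext => x; rewrite (cntD nodes0 e012 e3 (bdd x)) (cntD nodes0 e01 e2 (bdd x))
    (cntD nodes0 e0 e1 (bdd x)) !rmorphD.
rewrite -[X in good _ X]addr0; apply: goodD; last first.
  pose la := lam e b v w; pose lb := lam e b w v.
  pose F := P3%:F / (D1%:F * D2%:F).
  rewrite (_ : (fun x => _) = fun x =>
    (cnt N [set l | lb l < lb x /\ l w < x w]%classic F)%:~R +
    (cnt N [set l | la l < la x /\ l v < x v]%classic F)%:~R +
    (-1) * (cnt N [set l | lb l < lb x /\ la l < la x]%classic F)%:~R); last first.
    apply/funext => x.
    have -> : cnt N [set l | l v < x v \/ l w < x w]%classic F = cnt N (_ `|` _)%classic F :=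
      congr1 (fun A => cnt N A F) (wedge_union vw x).
    rewrite /cnt (csumU (N := N)).
    + by rewrite -(wedge_inter vw x) rmorphB rmorphD mulN1r.
    + exact: (lfin_expansion nodes0).
    + by apply: bounded_sub (half_bounded (x w) wN) => l [].
    + by apply: bounded_sub (half_bounded (x v) vN) => l [].
  have bnd z : z \in gsupp P3 -> 0 <= la z < \sum_(u in subtree_ends e v w) la (np u) /\
      0 <= lb z < \sum_(u in subtree_ends e w v) lb (np u).
    move=> /H3[y yb zb]; split.
      by apply: (corner_bounds vN wN vw yb _ exv); rewrite setUC.
    apply: (@corner_bounds w v wN vN wv z (z - y)) => //; first by rewrite setUC.
    by rewrite opprB addrCA subrr addr0.
  have -> : 0 = 0 + 0 + (-1) * 0 :> R by rewrite mulr0 !addr0.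
  apply: goodD; last apply: goodZ; last apply: good_strip => // z /bnd[/andP[_ ->] ->] //.
  apply: goodD; first by apply: good_corner => // z /bnd[/andP[_ ->] ->].
  have -> : F = P3%:F / (D2%:F * D1%:F) by rewrite [D2%:F * _]mulrC.
  by apply: good_corner => // z /bnd[-> /andP[_ ->]].
rewrite -[X in good _ X]addr0; apply: goodD; last first.
  have h := good_edge_side wN vN wv exw.
  rewrite (_ : (fun x => _) = fun x => (cnt N [set l | l w < x w \/ l v < x v]%classic
    (P2%:F / D2%:F))%:~R).
    by apply: h => z /H2[q q0 zb]; exists q => //; rewrite setUC.
  apply/funext => x; congr (cnt _ _ _)%:~R; by apply/seteqP; split=> l /= [] ; tauto.
rewrite -[X in good _ X]addr0; apply: goodD; last exact: good_edge_side exv H1.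
apply: (@good_poly (fun x => x v) v) => //; last by move=> x l; left.
- exact: linear_coord.
- by move=> u; apply: dual_ge0.
exact: dual_gt0.
Qed.

End Parts.

(** * Existence of the polynomial parts *)

Lemma regroup (A : comPzRingType) (p q d r r' : A) :
  (p * d + r') * q + r = p * (q * d) + (r' * q + r).
Proof. by ring. Qed.

Section Division.
Variables (R : comNzRingType) (G : zmodType).
Implicit Types (l n : G) (s : seq G) (a P r : galg R G).
Variables (kap : G -> rat) (K : G -> Prop).
Hypothesis kapD : forall x y, kap (x + y) = kap x + kap y.

Local Notation mon n := (gmon 1 n : galg R G).

Let kapB x y : kap (x - y) = kap x - kap y.
Proof. by rewrite -[in RHS](subrK y x) kapD addrK. Qed.

Let in0 z : z \in gsupp (0 : galg R G) -> False.
Proof. by apply/negP; rewrite -gcoef_eq0 gcoef0. Qed.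

Definition ok_from l := K l /\ 0 <= kap l.
Definition ok_upto (B : rat) l := K l /\ 0 <= kap l < B.

(** The quotient consists of the translates of l by negative multiples of n up
    to the last one with kap nonnegative. *)
Lemma divide_mon (c : R) n l : 0 < kap n -> (forall l, K l -> K (l - n)) -> ok_from l ->
  exists P r, [/\ gmon c l = P * (1 - mon n) + r,
    forall z, z \in gsupp P -> ok_from z & forall z, z \in gsupp r -> ok_upto (kap n) z].
Proof.
move=> n0 Kn; have [k kP] : exists k : nat, kap l < k%:R * kap n.
  exists (Num.truncn (kap l / kap n)).+1; rewrite -ltr_pdivrMr //.
  exact: truncnS_gt.
elim: k l kP => [|k IH] l kP [Kl l0]; first by rewrite mul0r ltNge l0 in kP.
have [ln|ln] := ltP (kap l) (kap n).
  exists 0, (gmon c l); split; first by rewrite mul0r add0r.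
    by move=> z /in0.
  by move=> z /gsupp_gmon ->; split; rewrite ?l0.
have ok : ok_from (l - n) by split; [exact: Kn | rewrite kapB subr_ge0].
have [|P [r [E HP Hr]]] := IH (l - n) _ ok.
  by rewrite kapB ltrBlDr; rewrite -natr1 mulrDl mul1r in kP.
exists (P - gmon c (l - n)), r; split=> //.
  rewrite mulrBl addrAC -E mulrBr mulr1 gmulUU' mulr1 subrK; ring.
by move=> z /gsuppD[/HP //|]; rewrite gsuppN => /gsupp_gmon ->.
Qed.

Lemma divide_one a n : 0 < kap n -> (forall l, K l -> K (l - n)) ->
  (forall z, z \in gsupp a -> ok_from z) ->
  exists P r, [/\ a = P * (1 - mon n) + r,
    forall z, z \in gsupp P -> ok_from z & forall z, z \in gsupp r -> ok_upto (kap n) z].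
Proof.
move=> n0 Kn Ha; suff: forall s, {in s, forall z, ok_from z} -> exists P r,
    [/\ \sum_(l <- s) gmon (gcoef a l) l = P * (1 - mon n) + r,
    forall z, z \in gsupp P -> ok_from z & forall z, z \in gsupp r -> ok_upto (kap n) z].
  by move/(_ (gsupp a) Ha); rewrite -gmonE.
elim=> [|l s IH] Hs.
  exists 0, 0; split; first by rewrite big_nil mul0r addr0.
    by move=> z /in0.
  by move=> z /in0.
have [|P [r [E HP Hr]]] := IH; first by move=> z zs; apply: Hs; rewrite inE zs orbT.
have [P' [r' [E' HP' Hr']]] := divide_mon (gcoef a l) n0 Kn (Hs l (mem_head _ _)).
exists (P' + P), (r' + r); split; first by rewrite big_cons E' E mulrDl addrACA.
  by move=> z /gsuppD[/HP'|/HP].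
by move=> z /gsuppD[/Hr'|/Hr].
Qed.

(** Division with remainder by a product of binomials, in the direction of
    kap. The condition K is carried along to record bounds in the other
    directions. *)
Lemma divide s a : {in s, forall n, 0 < kap n /\ forall l, K l -> K (l + n) /\ K (l - n)} ->
  (forall z, z \in gsupp a -> ok_from z) ->
  exists P r, [/\ a = P * \prod_(n <- s) (1 - mon n) + r,
    forall z, z \in gsupp P -> ok_from z &
    forall z, z \in gsupp r -> ok_upto (\sum_(n <- s) kap n) z].
Proof.
elim: s a => [|n s IH] a Hs Ha.
  exists a, 0; split=> //; first by rewrite big_nil mulr1 addr0.
  by move=> z /in0.
have [n0 Kn] := Hs n (mem_head _ _).
have [P [r [-> HP Hr]]] := divide_one n0 (fun l Kl => (Kn l Kl).2) Ha.
have [|P' [r' [-> HP' Hr']]] := IH P _ HP.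
  by move=> m ms; apply: Hs; rewrite inE ms orbT.
have s0 : 0 <= \sum_(m <- s) kap m.
  rewrite big_seq sumr_ge0 // => m ms.
  by have [|/ltW] := Hs m; rewrite ?inE ?ms ?orbT.
exists P', (r' * (1 - mon n) + r); rewrite !big_cons; split=> //.
  exact: regroup.
move=> z /gsuppD[|/Hr[Kz /andP[z0 zn]]]; last first.
  by split=> //; rewrite z0 (lt_le_trans zn) // lerDl.
move=> /gsuppM[y [y' [/Hr'[Ky /andP[y0 ys]] /gsuppD[|] ]]].
  move=> /gsupp_gmon -> ->; rewrite addr0; split=> //.
  by rewrite y0 (lt_le_trans ys) // lerDr ltW.
rewrite gsuppN => /gsupp_gmon -> ->; split; first by case: (Kn y Ky).
by rewrite kapD addr_ge0 ?(ltW n0) //= addrC ltrD2l.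
Qed.

End Division.

Section Existence.
Import mathcomp.boot.fintype mathcomp.boot.finset.
Variables (V : finType) (e : rel V) (b : V -> int).
Hypothesis e_tree : is_tree e.
Hypothesis b_neg : negative_definite e b.
Hypothesis nodes0 : nodes e != set0.
Implicit Types (x y z l n : expo V) (u v w : V) (S : {set V}) (p : lpoly V).

Local Notation Ed := (dual_vec e b).
Local Notation N := (nodes e).
Local Notation np := (order_dual_proj e b).
Local Notation denom := (denom e b).
Local Notation pdual := (proj_dual e b).

Lemma divide_denom S (kap : expo V -> rat) (K : expo V -> Prop) p :
  additive_fun kap -> (forall u, u \in S -> 0 < kap (np u)) ->
  (forall u l, u \in S -> K l -> K (l + np u) /\ K (l - np u)) ->
  (forall z, z \in gsupp p -> pdual z /\ K z /\ 0 <= kap z) ->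
  exists P r, [/\ p%:F / (denom S)%:F = P%:F + r%:F / (denom S)%:F :> ratfun V,
    forall z, z \in gsupp P -> [/\ pdual z, K z & 0 <= kap z] &
    forall z, z \in gsupp r -> [/\ pdual z, K z & 0 <= kap z < \sum_(u in S) kap (np u)]].
Proof.
move=> kapD kap0 HK Hp.
have [||P [r [pE HP Hr]]] :=
    @divide _ _ kap (fun z => pdual z /\ K z) kapD [seq np u | u <- enum S] p.
- move=> m /mapP[u]; rewrite mem_enum => uS -> {m}; split; first exact: kap0.
  move=> l [dl Kl]; have [k1 k2] := HK u l uS Kl; have du := order_dual_proj_dual e_tree
    b_neg u.
  by do 2 split=> //; apply: proj_dual_D => //; apply: proj_dual_N.
- by move=> z /Hp[dz [Kz z0]].
exists P, r; split.
- have dE : \prod_(n <- [seq np u | u <- enum S]) (1 - gmon 1 n) = denom S :> lpoly V.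
    by rewrite big_map big_enum.
  have d0 : (denom S)%:F != 0 :> ratfun V by rewrite tofrac_neq0 denom_neq0.
  by rewrite pE dE tofracD tofracM mulrDl mulfK.
- by move=> z /HP[[dz Kz] z0].
- move=> z /Hr[[dz Kz]]; rewrite big_map big_enum => z0; by split.
Qed.

Lemma in_box_intro (I S : {set V}) x (a : rat) : 0 <= a < 1 -> I \subset N ->
  (forall i, i \in I -> x i = a * \sum_(u in S) np u i) -> in_box e b I S x.
Proof.
move=> a01 IN xE; exists (fun=> a) => // i iI; rewrite xE // mulr_sumr.
by apply: eq_bigr => u _; rewrite order_dual_projE ?(subsetP IN).
Qed.

Lemma poly_part1_exists h v : v \in N -> exists P, is_poly_part1 e b (f_nodes e b h) v P.
Proof.
move=> vN; rewrite f_nodesE //.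
have [||||P [r [E HP Hr]]] :=
    @divide_denom (ends e) (fun x => x v) (fun=> True) (numer_nodes e b h).
- by move=> x y; rewrite ffunE.
- by move=> u _; apply: order_dual_proj_gt0.
- by [].
- move=> z zf; split; first exact: numer_nodes_laurent zf.
  by split=> //; have [y /(dual_cone_ge0 e_tree b_neg v) y0 ->] := numer_nodes_supp zf;
    rewrite projE.
exists P, r; split=> //; first by split=> z => [/HP|/Hr] [].
  by move=> z /HP[].
move=> z /Hr[_ _ /andP[z0 zS]]; have S0 := le_lt_trans z0 zS.
apply: (@in_box_intro _ _ _ (z v / \sum_(u in ends e) np u v)).
- by rewrite divr_ge0 ?(ltW S0) //= ltr_pdivrMr // mul1r.
- by rewrite sub1set.
- by move=> i; rewrite inE => /eqP ->; rewrite divfK // gt_eqF.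
Qed.

Section Edge.
Variables (v w : V).
Hypothesis adj : orb_adj e v w.

Local Notation Ev := (subtree_ends e v w).
Local Notation Ew := (subtree_ends e w v).
Local Notation la := (lam e b v w).
Local Notation lb := (lam e b w v).
Local Notation gvv := (Ed v v).
Local Notation gww := (Ed w w).
Local Notation gvw := (Ed v w).
Local Notation det := (gvv * gww - gvw * gvw).
Local Notation I := [set v; w].

Let vN : v \in N. Proof. by have /orb_adjP[p []] := adj. Qed.
Let wN : w \in N. Proof. by have /orb_adjP[p []] := adj. Qed.
Let vw : v != w. Proof. exact: orb_adj_neq adj. Qed.
Let wv : w != v. Proof. by rewrite eq_sym. Qed.
Let d0 : 0 < det. Proof. exact: det_gt0. Qed.
Let coordw := pair_coordw e_tree b_neg vw.
Let coordv := pair_coordv e_tree b_neg vw.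

Lemma denom_split : denom (ends e) = denom Ev * denom Ew.
Proof.
rewrite /Defs.denom (subtree_ends_cover e_tree adj).
by under eq_bigl do rewrite in_setU; rewrite bigU //; apply: subtree_ends_disj.
Qed.

Lemma sum_coordw : \sum_(u in Ev) np u w = gvw / det * \sum_(u in Ev) la (np u).
Proof.
rewrite mulr_sumr; apply: eq_bigr => u uE.
by rewrite coordw lb_near // mulr0 add0r.
Qed.

Lemma sum_coordv : \sum_(u in Ev) np u v = gvv / det * \sum_(u in Ev) la (np u).
Proof.
rewrite mulr_sumr; apply: eq_bigr => u uE.
by rewrite coordv lb_near // mulr0 add0r.
Qed.

(** The box of one side is a segment on the line lb = 0 of the plane of v and
    w; the points with the same coordinate at w that lie below it at v are
    those with lb nonnegative. *)
Lemma strip_box z : 0 <= z w < \sum_(u in Ev) np u w -> 0 <= lb z ->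
  exists2 q : rat, q <= 0 & in_box e b I Ev (z - axis v q).
Proof.
move=> /andP[zw0 zwS] lz; have S0 := le_lt_trans zw0 zwS.
have g0 : 0 < gvw by apply: dual_gt0.
exists (z v - z w * gvv / gvw).
  rewrite subr_le0 ler_pdivlMr // -subr_ge0; by rewrite lbE in lz.
apply: (@in_box_intro _ _ _ (z w / \sum_(u in Ev) np u w)); last 1 first.
- move=> i; rewrite in_set2 => /orP[] /eqP -> {i}; rewrite !ffunE ?eqxx.
    have E : \sum_(u in Ev) np u v = gvv / gvw * \sum_(u in Ev) np u w.
      by rewrite sum_coordw sum_coordv; field; rewrite !gt_eqF.
    by rewrite E; field; rewrite !gt_eqF.
  by rewrite (negPf wv) subr0 divfK // gt_eqF.
- by rewrite divr_ge0 ?(ltW S0) //= ltr_pdivrMr // mul1r.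
- exact: pair_sub.
Qed.

End Edge.

Lemma lam_shift v w u l : lam e b v w (np u) = 0 ->
  lam e b v w (l + np u) = lam e b v w l /\ lam e b v w (l - np u) = lam e b v w l.
Proof.
move=> h; split; first by rewrite lamD h addr0.
by rewrite -[in RHS](subrK (np u) l) [in RHS]lamD h addr0.
Qed.

Lemma lam_cone_ge0 v w y : v \in N -> w \in N -> dual_cone e b y ->
  0 <= lam e b v w (proj N y).
Proof.
move=> vN wN [k yE]; rewrite /lam !projE // -/(lam e b v w y) yE.
elim/big_rec: _ => [|u x _ x0]; first by rewrite /lam !ffunE !mul0r subr0.
rewrite lamD addr_ge0 // additive_funM; last exact: lamD.
by rewrite mulrn_wge0 // lam_dual_ge0.
Qed.

(** The numerator lies in the cone where la and lb are nonnegative, and la is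
    positive on the directions of D_v and zero on those of D_w, while lb is
    the opposite. Dividing in these two directions gives the corner term,
    Laurent polynomials with exponents in the cone, and one strip on each
    side. A strip is divided once more in the direction of the coordinate at
    the far node, which is what its box condition restricts. *)
Lemma poly_part2_exists h v w : orb_adj e v w ->
  exists P, is_poly_part2 e b (f_nodes e b h) v w P.
Proof.
move=> adj; rewrite f_nodesE // (denom_split adj).
have /orb_adjP[p0 [vN wN _ _]] := adj.
have vw := orb_adj_neq adj; have wv : w != v by rewrite eq_sym.
have adj' : orb_adj e w v by rewrite orb_adj_sym.
pose la := lam e b v w; pose lb := lam e b w v.
have laD : additive_fun la by exact: lamD.
have lbD : additive_fun lb by exact: lamD.
have la1 u : u \in subtree_ends e v w -> 0 < la (np u) by move=> uE; apply: la_near.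
have lb1 u : u \in subtree_ends e w v -> 0 < lb (np u) by move=> uE; apply: la_near.
have la0 u l : u \in subtree_ends e w v -> la (l + np u) = la l /\ la (l - np u) = la l.
  by move=> uE; apply/lam_shift/lb_near.
have lb0 u l : u \in subtree_ends e v w -> lb (l + np u) = lb l /\ lb (l - np u) = lb l.
  by move=> uE; apply/lam_shift/lb_near.
have Hf z : z \in gsupp (numer_nodes e b h) -> [/\ pdual z, 0 <= lb z & 0 <= la z].
  move=> zf; split; first exact: numer_nodes_laurent zf.
    by have [y dy ->] := numer_nodes_supp zf; apply: lam_cone_ge0.
  by have [y dy ->] := numer_nodes_supp zf; apply: lam_cone_ge0.
set Sa := \sum_(u in subtree_ends e v w) la (np u).
set Sb := \sum_(u in subtree_ends e w v) lb (np u).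
have t0 s t : 0 <= Ed s t / (Ed v v * Ed w w - Ed v w * Ed v w).
  by rewrite divr_ge0 ?dual_ge0 // ltW // det_gt0.
have pos_w z : 0 <= lb z -> 0 <= la z -> 0 <= z w.
  move=> b0 a0; rewrite (pair_coordw e_tree b_neg vw z).
  by apply: addr_ge0; apply: mulr_ge0.
have pos_v z : 0 <= lb z -> 0 <= la z -> 0 <= z v.
  move=> b0 a0; rewrite (pair_coordv e_tree b_neg vw z).
  by apply: addr_ge0; apply: mulr_ge0.
(* The numerator is divided by both products, in the directions la and lb. *)
have [|z /Hf[] //|A1 [A2 [E1 H1 H2]]] :=
    divide_denom (K := fun z => 0 <= lb z) laD la1 _ _ (p := numer_nodes e b h).
  by move=> u l /(lb0 u l)[-> ->].
have [|z /H2[dz bz az]|A3 [A4 [E2 H3 H4]]] :=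
    divide_denom (K := fun z => 0 <= la z < Sa) lbD lb1 _ _ (p := A2).
- by move=> u l /(la0 u l)[-> ->].
- by [].
have [|z /H1[dz bz az]|A5 [A6 [E3 H5 H6]]] :=
    divide_denom (K := fun z => 0 <= la z) lbD lb1 _ _ (p := A1).
- by move=> u l /(la0 u l)[-> ->].
- by [].
(* What is left over one product is divided again, in the direction of the
   coordinate at the other node. *)
have [|||z /H3[dz /andP[az _] bz]|A7 [A8 [E4 H7 H8]]] :=
    @divide_denom (subtree_ends e v w) (fun z => z w) (fun z => 0 <= lb z) A3.
- by move=> x y; rewrite ffunE.
- by move=> u _; apply: order_dual_proj_gt0.
- by move=> u l /(lb0 u l)[-> ->].
- by split=> //; split=> //; apply: pos_w.
have [|||z /H6[dz az /andP[bz _]]|A9 [A10 [E5 H9 H10]]] :=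
    @divide_denom (subtree_ends e w v) (fun z => z v) (fun z => 0 <= la z) A6.
- by move=> x y; rewrite ffunE.
- by move=> u _; apply: order_dual_proj_gt0.
- by move=> u l /(la0 u l)[-> ->].
- by split=> //; split=> //; apply: pos_v.
exists (A5 + A7 + A9), A8, A10, A4; split.
- split=> z; first by move=> /gsuppD[/gsuppD[/H5[]|/H7[]]|/H9[]].
  + by case/H8.
  + by case/H10.
  + by case/H4.
- rewrite !tofracD.
  have Dv0 : (denom (subtree_ends e v w))%:F != 0 :> ratfun V by rewrite tofrac_neq0
    denom_neq0.
  have Dw0 : (denom (subtree_ends e w v))%:F != 0 :> ratfun V by rewrite tofrac_neq0
    denom_neq0.
  have comb (F : fieldType) (a dv dw a1 a2 a3 a4 a5 a6 a7 a8 a9 a10 : F) : dv != 0 -> dw !=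
    0 ->
    a / dv = a1 + a2 / dv -> a2 / dw = a3 + a4 / dw -> a1 / dw = a5 + a6 / dw ->
    a3 / dv = a7 + a8 / dv -> a6 / dw = a9 + a10 / dw ->
    a / (dv * dw) = a5 + a7 + a9 + a8 / dv + a10 / dw + a4 / (dv * dw).
    move=> _ _ h1 h2 h3 h4 h5; rewrite !invfM !mulrA h1 mulrDl h3 h5.
    by rewrite [a2 / dv / dw]mulrAC h2 [(_ + a4 / dw) / dv]mulrDl h4 [a4 / dw / dv]mulrAC;
      ring.
  rewrite [(denom _ * denom _)%:F]tofracM.
  exact: (comb _ _ _ _ _ _ _ _ _ _ _ _ _ _ Dv0 Dw0 E1 E2 E3 E4 E5).
- move=> z /gsuppD[/gsuppD[/H5[_ az bz]|/H7[_ _ wz]]|/H9[_ _ vz]] [zv zw].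
  + by have := pos_v z bz az; rewrite leNgt zv.
  + by move: wz; rewrite leNgt zw.
  + by move: vz; rewrite leNgt zv.
split.
- by move=> z /H8[_ bz wz]; apply: strip_box.
- by move=> z /H10[_ az vz]; rewrite setUC; apply: strip_box.
move=> z /H4[_ /andP[a0 aS] /andP[b0 bS]].
have Sa0 := le_lt_trans a0 aS; have Sb0 := le_lt_trans b0 bS.
have dt := det_gt0 e_tree b_neg vw.
pose y : expo V := [ffun t => la z / Sa * \sum_(u in subtree_ends e v w) np u t].
exists y.
  apply: (@in_box_intro _ _ _ (la z / Sa)).
  - by rewrite divr_ge0 ?(ltW Sa0) //= ltr_pdivrMr // mul1r.
  - exact: pair_sub.
  - by move=> i _; rewrite ffunE.
apply: (@in_box_intro _ _ _ (lb z / Sb)).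
- by rewrite divr_ge0 ?(ltW Sb0) //= ltr_pdivrMr // mul1r.
- exact: pair_sub.
have c1 := sum_coordw adj; have c2 := sum_coordv adj.
have c3 := sum_coordw adj'; have c4 := sum_coordv adj'.
rewrite -/la -/Sa in c1 c2; rewrite -/lb -/Sb in c3 c4.
move=> i; rewrite in_set2 => /orP[] /eqP -> {i}; rewrite !ffunE.
  rewrite c2 c3 (pair_coordv e_tree b_neg vw z) (dualC e_tree b_neg w v) -/la -/lb.
  by field; rewrite !gt_eqF // [Ed w w * _]mulrC.
rewrite c1 c4 (pair_coordw e_tree b_neg vw z) (dualC e_tree b_neg w v) -/la -/lb.
by field; rewrite !gt_eqF // [Ed w w * _]mulrC.
Qed.

End Existence.

(** * Gluing along the orbifold tree *)

Section Handshake.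
Import mathcomp.boot.fintype mathcomp.boot.finset.
Variables (V : finType) (e : rel V).
Hypothesis e_tree : is_tree e.
Hypothesis nodes0 : nodes e != set0.

Local Notation N := (nodes e).
Local Notation edge p := (orb_adj e p.1 p.2 && (enum_rank p.1 < enum_rank p.2)%N).

Lemma handshake (M : zmodType) (F : V -> M) :
  \sum_(p : V * V | edge p) (F p.1 + F p.2) = \sum_(v in N) F v *+ orb_valency e v.
Proof.
have swapI : injective (fun p : V * V => (p.2, p.1)) by move=> [a c] [a' c'] /= [-> ->].
rewrite big_split /= [X in _ + X](reindex_inj swapI) /=.
rewrite [X in _ + X](eq_bigl (fun p : V * V => orb_adj e p.1 p.2 && ~~ (enum_rank p.1 <
  enum_rank p.2)%N)).
  rewrite -(bigID (fun p : V * V => enum_rank p.1 < enum_rank p.2)%N (fun p => orb_adj e p.1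
    p.2) (fun p => F p.1)).
  rewrite -(pair_big_dep xpredT (fun v w => orb_adj e v w) (fun v w => F v)) /=.
  rewrite [RHS]big_mkcond; apply: eq_bigr => v _.
  transitivity (\sum_(w in [set w | orb_adj e v w]) F v).
    by apply: eq_bigl => w; rewrite inE.
  rewrite sumr_const -/(orb_valency e v); have [//|vN] := boolP (v \in N).
  rewrite /orb_valency (_ : [set w | _] = set0) ?cards0 //.
  by apply/setP => w; rewrite !inE; apply/negP => /orb_adjP[p []]; rewrite (negPf vN).
move=> [v w] /=; rewrite (orb_adj_sym e_tree); case: (boolP (orb_adj e v w)) => //= vw.
rewrite -leqNgt ltn_neqAle; case: eqP => //= h.
have := orb_adj_neq vw; rewrite -(inj_eq enum_rank_inj) -val_eqE /= h eqxx //.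
Qed.

(** The Euler characteristic of the orbifold tree is 1: every node but the
    root has one edge to its parent. *)
Lemma euler (M : zmodType) (k : M) :
  \sum_(p : V * V | edge p) k - \sum_(v in N) k *~ ((orb_valency e v)%:Z - 1) = k.
Proof.
have [rho rhoN] := set0Pn _ nodes0.
have E : \sum_(p : V * V | edge p) k = \sum_(v in N :\ rho) k.
  exact: (sum_edges_parent e_tree rhoN (F := fun _ _ => k)).
have H := handshake (fun=> k); rewrite big_split /= in H.
have -> : \sum_(v in N) k *~ ((orb_valency e v)%:Z - 1) =
   \sum_(v in N) k *+ orb_valency e v - \sum_(v in N) k.
  by rewrite -sumrB; apply: eq_bigr => v _; rewrite mulrzBr mulr1z pmulrn.
rewrite -H [X in _ - (_ - X)](bigD1 rho) //=.
have -> : \sum_(i in N | i != rho) k = \sum_(v in N :\ rho) k.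
  by apply: eq_bigl => v; rewrite !inE andbC.
by rewrite -E opprB addrA addrCA addrK.
Qed.

End Handshake.

Section EvalOne.
Variable V : finType.
Implicit Types P Q : lpoly V.

Lemma eval_oneD P Q : eval_one (P + Q) = eval_one P + eval_one Q.
Proof. exact: (gsum_add (F := fun r _ => r)). Qed.

Lemma eval_one0 : eval_one (0 : lpoly V) = 0.
Proof. by apply: (addrI (eval_one (0 : lpoly V))); rewrite -eval_oneD !addr0. Qed.

Lemma eval_oneN P : eval_one (- P) = - eval_one P.
Proof. by apply: (addrI (eval_one P)); rewrite -eval_oneD !subrr eval_one0. Qed.

Lemma eval_oneMz P (n : int) : eval_one (P *~ n) = eval_one P *~ n.
Proof.
have nat k : eval_one (P *+ k) = eval_one P *+ k.
  by elim: k => [|k IH]; rewrite ?mulr0n ?eval_one0 // !mulrS eval_oneD IH.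
by case: n => k; rewrite ?NegzE ?mulrNz ?eval_oneN -!pmulrn nat.
Qed.

Lemma eval_one_sum (I : Type) (s : seq I) (A : pred I) (F : I -> lpoly V) :
  eval_one (\sum_(i <- s | A i) F i) = \sum_(i <- s | A i) eval_one (F i).
Proof. by apply: (big_morph _ eval_oneD eval_one0). Qed.

Lemma gsuppMz P (n : int) x : x \in gsupp (P *~ n) -> x \in gsupp P.
Proof.
have nat k : x \in gsupp (P *+ k) -> x \in gsupp P.
  elim: k => [|k IH]; first by rewrite mulr0n -[_ \in _]negbK -gcoef_eq0 gcoef0 eqxx.
  by rewrite mulrS => /gsuppD[].
by case: n => k; rewrite ?NegzE ?mulrNz ?gsuppN -pmulrn; apply: nat.
Qed.

End EvalOne.

Section Gluing.
Import mathcomp.boot.fintype mathcomp.boot.finset.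
Variables (R : realType) (V : finType) (e : rel V) (b : V -> int).
Hypothesis e_tree : is_tree e.
Hypothesis b_neg : negative_definite e b.
Hypothesis nodes0 : nodes e != set0.
Implicit Types (x y z l n : expo V) (u v w : V) (S : {set V}) (h : rat_quot V).

Local Notation Ed := (dual_vec e b).
Local Notation N := (nodes e).
Local Notation deep := (@deep R V e b).
Local Notation good := (@good R V e b).
Local Notation f_ := (f_nodes e b).
Local Notation edge p := (orb_adj e p.1 p.2 && (enum_rank p.1 < enum_rank p.2)%N).
Local Notation P1 h := (poly_part1 e b (f_ h)).
Local Notation P2 h := (poly_part2 e b (f_ h)).

Lemma poly_part1P h v : v \in N -> is_poly_part1 e b (f_ h) v (P1 h v).
Proof.
move=> vN; have [P HP] := poly_part1_exists e_tree b_neg nodes0 h vN.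
exact: (xgetPex 0 (ex_intro _ P HP)).
Qed.

Lemma poly_part2P h v w : orb_adj e v w -> is_poly_part2 e b (f_ h) v w (P2 h v w).
Proof.
move=> vw; have [P HP] := poly_part2_exists e_tree b_neg nodes0 h vw.
exact: (xgetPex 0 (ex_intro _ P HP)).
Qed.

Definition poly_part h : lpoly V :=
  \sum_(p : V * V | edge p) P2 h p.1 p.2 -
  \sum_(v in N) P1 h v *~ ((orb_valency e v)%:Z - 1).

Lemma poly_part_supp h l : l \in gsupp (poly_part h) ->
  proj_dual e b l /\ ~ forall v, v \in N -> l v < 0.
Proof.
case/gsuppD => [/gsupp_sum[[v w] /andP[/= vw _] lP]|].
  have [? [? [? [[lau _ _ _] _ npos _]]]] := poly_part2P h vw; split; first exact: lau.
  have /orb_adjP[p [vN wN _ _]] := vw.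
  by move=> neg; apply: (npos l lP); rewrite !neg.
rewrite gsuppN => /gsupp_sum[v vN /gsuppMz lP].
have [? [[lau _] _ pos _]] := poly_part1P h vN; split; first exact: lau.
by move=> /(_ v vN); rewrite ltNge pos.
Qed.

(** The copies of f on the right add up to one by [euler]. *)
Lemma sum_neg_parts h : f_ h - (poly_part h)%:F =
  sum_orb_edges e (neg_part2 e b (f_ h)) -
  \sum_(v in N) ((orb_valency e v)%:Z - 1)%:~R * neg_part1 e b (f_ h) v.
Proof.
rewrite /sum_orb_edges /neg_part1 /neg_part2.
have tofracMz (P : lpoly V) (n : int) : (P *~ n)%:F = P%:F *~ n :> ratfun V by exact: raddfMz.
rewrite /poly_part tofracB !rmorph_sum /=.
under [X in _ = _ - X]eq_bigr do rewrite mulrzl mulrzBl.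
under [X in _ - (_ - X)]eq_bigr do rewrite tofracMz.
by rewrite !sumrB -[X in X - _](euler e_tree nodes0 (f_ h)); set A := \sum_(_ | _) _; set B
  := \sum_(_ in _) _; ring.
Qed.

Lemma ends_neq0 : exists u, u \in ends e.
Proof.
have [rho rhoN] := set0Pn _ nodes0.
have [r vr _] := node_nbr rho rhoN.
have [u uE _] := branch_ends e_tree vr; by exists u.
Qed.

Lemma counting_cnt h x : counting e (taylor e b (f_ h)) x =
  cnt N (some_small N x h) (zeta_sum e b).
Proof.
rewrite taylorE // (_ : counting _ _ _ = cnt N [set l : expo V |
   ~ forall v, v \in N -> x v <= l v]%classic (f_ h)) // cnt_f_nodes //.
  congr (cnt _ _ _); apply/seteqP; split=> y /= [Hy yh]; split=> //.
    apply: contrapT => no; apply: Hy => v vN; rewrite projE // leNgt; apply/negP => yx.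
    by apply: no; exists v.
  by case: Hy => v vN yx /(_ v vN); rewrite projE // leNgt yx.
exists (\sum_v `|x v|) => l /existsNP[v /not_implyP[vN /negP]]; rewrite -ltNge => lx.
exists v => //; apply: lt_le_trans lx _; rewrite (bigD1 v) //= ler_wpDr ?sumr_ge0 //.
exact: ler_norm.
Qed.

Lemma cnt_one_node h x v : v \in N ->
  cnt N (all_small [set v] x h) (zeta_sum e b) = cnt N [set l | l v < x v]%classic (f_ h).
Proof.
move=> vN; rewrite cnt_f_nodes //; last by apply: half_bounded.
congr (cnt _ _ _); apply/seteqP; split=> y /= [Hy yh]; split=> //.
  by rewrite projE //; apply: Hy; rewrite inE.
by move=> s; rewrite inE => /eqP ->; rewrite projE in Hy.
Qed.

Lemma cnt_two_nodes h x v w : v \in N -> w \in N ->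
  cnt N (all_small [set v; w] x h) (zeta_sum e b) =
  cnt N [set l | l v < x v]%classic (f_ h) + cnt N [set l | l w < x w]%classic (f_ h) -
  cnt N [set l | l v < x v \/ l w < x w]%classic (f_ h).
Proof.
move=> vN wN; have bv := half_bounded (x v) vN; have bw := half_bounded (x w) wN.
have lf : lfin N (expansion N (f_ h)) by apply/(lfin_expansion nodes0)/f_nodes_expandable.
have U : cnt N [set l | l v < x v \/ l w < x w]%classic (f_ h) =
    cnt N [set l | l v < x v]%classic (f_ h) + cnt N [set l | l w < x w]%classic (f_ h) -
    cnt N ([set l | l v < x v] `&` [set l | l w < x w])%classic (f_ h) := csumU lf bv bw.
rewrite {}U opprB addrC subrK cnt_f_nodes //.
  congr (cnt _ _ _); apply/seteqP; split=> y /= [Hy yh]; split=> //.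
    by rewrite !projE //; split; apply: Hy; rewrite !inE eqxx ?orbT.
  by case: Hy; rewrite !projE // => ? ? s; rewrite !inE => /orP[] /eqP ->.
by apply: bounded_sub bv => l [].
Qed.

(** The gluing formula, rewritten so that each node occurs once by itself and
    once for each of its edges. *)
Lemma good_counting h : good (fun x => (counting e (taylor e b (f_ h)) x)%:~R)
  (eval_one (poly_part h))%:~R.
Proof.
have [rho rhoN] := set0Pn _ nodes0.
pose Q1 v x : int := cnt N [set l | l v < x v]%classic (f_ h).
pose Q2 v w x : int := cnt N [set l | l v < x v \/ l w < x w]%classic (f_ h).
have Q2C v w x : Q2 v w x = Q2 w v x.
  by congr (cnt _ _ _); apply/seteqP; split=> l /= []; tauto.
have [L HL] := union_count R e_tree b_neg rhoN.
apply: (good_eq (F' := fun x => \sum_(p : V * V | edge p) (Q2 p.1 p.2 x)%:~R +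
   \sum_(v in N) (- ((orb_valency e v)%:Z - 1)%:~R) * (Q1 v x)%:~R)).
  exists L => x dx; rewrite counting_cnt HL //.
  have -> : \sum_(v in N) cnt N (all_small [set v] x h) (zeta_sum e b) = \sum_(v in N) Q1 v x.
    by apply: eq_bigr => v vN; apply: cnt_one_node.
  have -> : \sum_(w in N :\ rho) cnt N (all_small [set w; parent e rho w] x h) (zeta_sum e b) =
     \sum_(w in N :\ rho) (Q1 w x + Q1 (parent e rho w) x - Q2 w (parent e rho w) x).
    apply: eq_bigr => w /setD1P[wr wN]; apply: cnt_two_nodes => //.
    have /andP[] := parentP e_tree rhoN wN wr; by case/orb_adjP=> p [].
  rewrite -(sum_edges_parent e_tree rhoN (F := fun v w => Q1 v x + Q1 w x - Q2 v w x)); last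
    first.
    by move=> v w; rewrite Q2C [Q1 v x + _]addrC.
  rewrite sumrB (handshake e_tree (fun v => Q1 v x)) -rmorph_sum /=.
  under [X in _ = _ + X]eq_bigr do rewrite -rmorphN -rmorphM.
  rewrite -rmorph_sum -rmorphD /=; congr (_%:~R).
  rewrite opprB addrCA -sumrB; congr (_ + _); apply: eq_bigr => v _.
  by rewrite -mulr_natr natz; ring.
rewrite /poly_part eval_oneD eval_oneN !eval_one_sum rmorphD rmorphN !rmorph_sum /=.
rewrite -[X in good _ (_ + X)]sumrN; apply: goodD.
  apply: good_sum => -[v w] _ /andP[/= vw _].
  exact: (good_part2 R e_tree b_neg nodes0 vw (poly_part2P h vw)).
rewrite [X in good _ X](eq_bigr (fun v =>
   (- ((orb_valency e v)%:Z - 1)%:~R) * (eval_one (P1 h v))%:~R)) => [|v _]; last first.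
  by rewrite eval_oneMz mulrzz rmorphM /= mulrC mulNr.
apply: good_sum => v _ vN; apply: goodZ.
exact: (good_part1 R e_tree b_neg nodes0 vN ends_neq0 (poly_part1P h vN)).
Qed.

Lemma finite_index_refl (M : set (expo V)) : M 0 -> (forall x y, M x -> M y -> M (x - y)) ->
  finite_index M M.
Proof.
by move=> M0 MB; split=> //; exists [:: 0] => x Mx; exists 0; rewrite ?mem_head ?subr0.
Qed.

(** The coordinates have a common denominator D, and the class of an element
    is determined by its coordinates times D modulo K D. *)
Lemma divisible_finite_index (K : nat) : (0 < K)%N ->
  finite_index [set x | proj_dual e b x /\ divisible e K x]%classic (proj_dual e b).
Proof.
move=> K0; have [D D0 HD] := proj_dual_denom e_tree b_neg.
have dB x y : proj_dual e b x -> proj_dual e b y -> proj_dual e b (x - y).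
  by move=> dx dy; apply: proj_dual_D => //; apply: proj_dual_N.
split=> //=.
- by split; [apply: proj_dual_0|move=> v _; rewrite ffunE mul0r].
- move=> x y [dx xK] [dy yK]; split; first exact: dB.
  by move=> v vN; rewrite !ffunE mulrBl rpredB ?xK ?yK.
- by move=> x [].
have KD0 : (0 < K * D)%N by rewrite muln_gt0 K0.
pose res x : {ffun V -> 'I_(K * D)} :=
  [ffun v => Ordinal (ltn_pmod `|(Num.floor (x v * D%:R) %% (K * D)%:Z)%Z| KD0)].
have /choice[rep Hrep] r : exists y, (exists2 x, proj_dual e b x & res x = r) ->
    proj_dual e b y /\ res y = r.
  have [[x dx xr]|no] := pselect (exists2 x, proj_dual e b x & res x = r); first by exists x.
  by exists 0 => ex; case: no.
exists [seq rep r | r <- enum {: {ffun V -> 'I_(K * D)}}] => x dx.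
have [dy yr] := Hrep (res x) (ex_intro2 _ _ x dx erefl).
exists (rep (res x)); first by apply/mapP; exists (res x); rewrite ?mem_enum.
split; first exact: dB.
move=> v vN; rewrite !ffunE; set y := rep _ in dy yr *.
have /(congr1 val) : res y v = res x v by rewrite yr.
rewrite /res !ffunE /=.
have /intrP[i iE] := HD x dx v; have /intrP[j jE] := HD y dy v.
rewrite iE jE !intrKfloor.
have KDz : (K * D)%:Z != 0 by rewrite eqz_nat -lt0n.
have small (k : int) : (`|(k %% (K * D)%:Z)%Z| %% (K * D))%N = `|(k %% (K * D)%:Z)%Z|%N.
  apply: modn_small; rewrite -ltz_nat gez0_abs ?modz_ge0 //.
  by apply: ltz_pmod.
rewrite !small => /(congr1 Posz); rewrite !gez0_abs ?modz_ge0 // => ij.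
have /dvdzP[c cE] : ((K * D)%:Z %| i - j)%Z by rewrite -eqz_mod_dvd ij.
have Dr : D%:R != 0 :> rat by rewrite pnatr_eq0 -lt0n.
have Kr : K%:R != 0 :> rat by rewrite pnatr_eq0 -lt0n.
have -> : (x v - y v) / K%:R = c%:~R; last exact: intr_int.
have := congr1 (fun k : int => k%:~R : rat) cE; rewrite rmorphB rmorphM /= -iE -jE.
rewrite -pmulrn natrM => h; apply: (mulIf Kr); apply: (mulIf Dr).
by rewrite divfK // -mulrA -h mulrBl.
Qed.

(** The translate of the cone starts at the multiple of the sum of the E_u^*
    required by [good], and a polynomial is in particular a quasipolynomial. *)
Lemma good_periodic_constant (c : expo V -> int) (k : R) :
  good (fun x => (counting e c x)%:~R) k -> is_periodic_constant e b c k.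
Proof.
move=> [L [K [G [K0 [p Gp] G0 HG]]]]; have FI := divisible_finite_index K0.
pose L' := Num.max L 0; have L0 : 0 <= L' by rewrite le_max lexx orbT.
exists [set x | proj_dual e b x /\ divisible e K x]%classic,
  (fun v => if v \in N then \sum_u L' * ratr (Ed u v) else 0), G; split=> //.
- by exists (fun=> L').
- exists [set x | proj_dual e b x /\ divisible e K x]%classic.
    by case: FI => M0 MB _ _; apply: finite_index_refl.
  by move=> r _; exists p => m _; rewrite Gp.
move=> x [dx xK] [a a0 Ha]; apply: HG => //.
apply: (@deep_mono R V e b L L'); first by rewrite le_max lexx.
exists (fun u => a u + L') => [u|v vN]; first by rewrite lerDr.
have := Ha v; rewrite vN => /(congr1 (fun t => t + \sum_u L' * ratr (Ed u v))).
rewrite subrK => ->; rewrite -big_split; apply: eq_bigr => u _.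
by rewrite mulrDl.
Qed.

End Gluing.

Import mathcomp.boot.fintype mathcomp.boot.finset.

Theorem theorem24 (R : realType) (V : finType) (e : rel V) (b : V -> int)
    (e_tree : is_tree e) (b_neg : negative_definite e b)
    (nodes_neq0 : nodes e != set0)
    (h : rat_quot V) (hH : disc_group e b h) :
  exists! d : lpoly V * ratfun V,
  let P := d.1 in
  let fminus := d.2 in
  let f := f_nodes e b h in
  [/\ f = P%:F + fminus,
      laurent e b P /\
      (forall x, x \in gsupp P -> ~ forall v, v \in nodes e -> x v < 0),
      is_periodic_constant e b (taylor e b f) ((eval_one P)%:~R : R) &
      fminus = sum_orb_edges e (neg_part2 e b f)
        - \sum_(v in nodes e)
            ((orb_valency e v)%:Z - 1)%:~R * neg_part1 e b f v].
Proof.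
exists (poly_part e b h, f_nodes e b h - (poly_part e b h)%:F); split=> /=.
  split.
  - by rewrite addrC subrK.
  - by split=> x /(poly_part_supp e_tree b_neg nodes_neq0)[].
  - exact/good_periodic_constant/good_counting.
  - exact: sum_neg_parts.
move=> [P fm] /= [fE _ _ fmE].
have E : f_nodes e b h - (poly_part e b h)%:F = fm by rewrite fmE sum_neg_parts.
congr (_, _) => //; apply/eqP; rewrite -tofrac_eq; apply/eqP.
by apply: (addIr fm); rewrite -fE -E addrC subrK.
Qed.
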